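(* Let $T>0$ be a fixed time, and suppose that the exact solution $u$ of the nonlocal Cahn-Hilliard equation on $\Omega=(0,L)\times(0,L)$ with periodic boundary conditions is smooth enough and satisfies, for some $\delta>0$, the separation property $\|u\|_\infty\le 1-2\delta$ at a point-wise level. If $\tau\le\frac12$ and $h$ is sufficiently small, then the numerical solution $u^n$ generated by the P-ETDRK2 scheme with time step $\tau$, mesh size $h$ and initial data $u^0=I^hu_N(\cdot,0)$ has the error estimate $$\|u^n-I^hu(t_n)\|\le C(\tau^2+h^2),\qquad t_n=n\tau\le T,$$ where the constant $C>0$ depends on $T$, $u$, $\epsilon$, $\kappa$, $\theta_c$ and $\theta$, but is independent of $\tau$ and $h$.
   Context: **Equation.** The nonlocal Cahn-Hilliard equation is $u_t=\Delta\mu$, $\mu=\frac\theta2\ln(1+u)-\frac\theta2\ln(1-u)-\theta_cu-\epsilon^2\Delta u+\sigma(-\Delta)^{-1}(u-\overline u)$, with $\epsilon>0$, $\sigma>0$, $0<\theta<\theta_c$, and $\overline u$ the spatial mean of $u$. **Grid functions.** Let $M$ be a positive integer, $h=L/M$, and let $\mathcal{M}_h$ be the space of real grid functions $v=(v_{ij})$ on the mesh points $(x_i,y_j)=(ih,jh)$, $1\le i,j\le M$, extended $M$-periodically in each index. Set $\langle v,w\rangle=h^2\sum_{i,j=1}^M v_{ij}w_{ij}$, $\|v\|=\sqrt{\langle v,v\rangle}$, $\|v\|_\infty=\max_{i,j}|v_{ij}|$, $\overline v$ the mean of $v$ over the mesh points, and $\Delta_hv_{ij}=h^{-2}(v_{i+1,j}+v_{i-1,j}+v_{i,j-1}+v_{i,j+1}-4v_{ij})$.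 $I^h$ restricts a function to the mesh: $(I^h\varphi)_{ij}=\varphi(x_i,y_j)$. Linear operators on $\mathcal{M}_h$ are regarded as matrices, and functions of symmetric matrices are understood spectrally; products and inequalities of grid functions are pointwise. **Fourier projection.** $u_N(\cdot,t)=\mathcal P_Nu(\cdot,t)$ is the spatial Fourier projection of the exact solution into the space $\mathcal{B}^N$ of (periodic) trigonometric polynomials of degree up to $N$. The degree $N$ is tied to the mesh so that the standard estimate $\|u_N-u\|_{L^\infty(0,T;H^k)}\le Ch^{l-k}\|u\|_{L^\infty(0,T;H^l)}$ for $0\le k\le l$ holds and so that $\int_\Omega u_N(\bm{x},t_n)\,d\bm{x}=h^2\sum_{i,j=1}^M u_N(x_i,y_j,t_n)$. **Operators.** With a stabilizing constant $\kappa>0$, $L_h=\epsilon^2\Delta_h^2-\kappa\Delta_h+\sigma I$ and $F(v)=\frac\theta2\Delta_h[\ln(1+v)-\ln(1-v)]-\theta_c\Delta_hv-\kappa\Delta_hv+\sigma\overline v$. Let $\varphi_0(a)=e^{-a}$, $\varphi_1(a)=\frac{1-e^{-a}}a$, $\varphi_2(a)=\frac{e^{-a}-1+a}{a^2}$. **Projection step.** Given $\widetilde v\in\mathcal{M}_h$, its projection $v$ is the minimizer of $\frac12\|\phi-\widetilde v\|^2$ over all $\phi\in\mathcal{M}_h$ with $\|\phi\|_\infty\le1-\delta$ and $\langle\phi,1\rangle=\langle\widetilde v,1\rangle$, with the same $\delta$ as in the separation property. It is computed from the Karush-Kuhn-Tucker system: with $g(u)=(1-\delta)^2-u^2$ and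 Lagrange multipliers $\lambda\in\mathcal{M}_h$, $\xi\in\mathbb{R}$, $v=\widetilde v+\lambda g'(v)+\xi$, $\lambda g(v)=0$, $\lambda\ge0$, $g(v)\ge0$, $\langle v,1\rangle=\langle\widetilde v,1\rangle$. **P-ETDRK2 scheme.** Given $u^n\in\mathcal{M}_h$: 1. $\widetilde u^{n+1}_{\rm mid}=\varphi_0(\tau L_h)u^n+\tau\varphi_1(\tau L_h)F(u^n)$, and $u^{n+1}_{\rm mid}$ is the projection of $\widetilde u^{n+1}_{\rm mid}$. 2. $\widetilde u^{n+1}=\varphi_0(\tau L_h)u^n+\tau[(\varphi_1(\tau L_h)-\varphi_2(\tau L_h))F(u^n)+\varphi_2(\tau L_h)F(u^{n+1}_{\rm mid})]$, and $u^{n+1}$ is the projection of $\widetilde u^{n+1}$. *)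

(* Defs.v *)
From HB Require Import structures.
From mathcomp Require Import all_boot all_order all_algebra.
From mathcomp Require Import all_classical all_reals all_analysis.
Import Order.TTheory GRing.Theory Num.Theory.
Import numFieldNormedType.Exports.

Set Implicit Arguments.
Unset Strict Implicit.
Unset Printing Implicit Defensive.

Local Open Scope classical_set_scope.
Local Open Scope ring_scope.

(** * Functions on the square (0,L) x (0,L) with periodic boundary conditions *)

Definition periodic2 {R : realType} (L : R) (w : R -> R -> R) : Prop :=
  forall x y, w (x + L) y = w x y /\ w x (y + L) = w x y.

Definition int2 {R : realType} (L : R) (w : R -> R -> R) : R :=
  \int[lebesgue_measure]_(x in `[0, L])
    (\int[lebesgue_measure]_(y in `[0, L]) w x y).

Definition mean {R : realType} (L : R) (w : R -> R -> R) : R :=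
  int2 L w / L ^+ 2.

(* d_x^a d_y^b w *)
Definition pderiv {R : realType} (a b : nat) (w : R -> R -> R) : R -> R -> R :=
  fun x y => derive1n a (fun x' : R => derive1n b (fun y' : R => w x' y') y) x.

Definition laplacian {R : realType} (w : R -> R -> R) : R -> R -> R :=
  fun x y => pderiv 2 0 w x y + pderiv 0 2 w x y.

(* [derive1n] is total, so differentiability is required explicitly. *)
Definition classC2 {R : realType} (w : R -> R -> R) : Prop :=
  forall a b : nat, (a + b <= 2)%N ->
    continuous (fun p : R * R => pderiv a b w p.1 p.2) /\
    ((a + b < 2)%N -> forall x y : R,
       derivable (fun x' : R => pderiv a b w x' y) x 1 /\
       derivable (fun y' : R => pderiv a b w x y') y 1).

(* [psi = (- Delta)^-1 v]: the unique mean-zero periodic solution of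
   [- Delta psi = v]. *)
Definition is_inv_neg_laplacian {R : realType} (L : R)
    (v psi : R -> R -> R) : Prop :=
  [/\ periodic2 L psi, classC2 psi, mean L psi = 0
    & forall x y, - laplacian psi x y = v x y].

(** * The nonlocal Cahn-Hilliard equation; space-time functions are [u t x y] *)

Definition chem_potential {R : realType} (eps sigma theta theta_c : R)
    (w psi : R -> R -> R) : R -> R -> R :=
  fun x y => theta / 2 * ln (1 + w x y) - theta / 2 * ln (1 - w x y)
    - theta_c * w x y - eps ^+ 2 * laplacian w x y + sigma * psi x y.

Definition is_nonlocal_CH_solution {R : realType}
    (L T eps sigma theta theta_c : R) (u : R -> R -> R -> R) : Prop :=
  (forall t : R, 0 <= t <= T -> periodic2 L (u t)) /\
  (forall t : R, 0 < t < T -> exists psi : R -> R -> R,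
     let mu := chem_potential eps sigma theta theta_c (u t) psi in
     [/\ is_inv_neg_laplacian L (fun x y => u t x y - mean L (u t)) psi,
         classC2 mu
       & forall x y : R,
           is_derive t (1 : R) (fun s : R => u s x y) (laplacian mu x y)]).

(* Class C^r on [0,T] x R^2: [D c a b] is d_t^c d_x^a d_y^b u, continuous up to
   the end points of [0,T]; the values of [u] outside [0,T] play no role. *)
Definition smooth_upto {R : realType} (r : nat) (T : R)
    (u : R -> R -> R -> R) : Prop :=
  exists D : nat -> nat -> nat -> R -> R -> R -> R,
  [/\ forall t x y : R, 0 <= t <= T -> D 0%N 0%N 0%N t x y = u t x y,
      forall c a b : nat, (c + a + b <= r)%N ->
        {within [set p : R * (R * R) | 0 <= p.1 <= T],
           continuous (fun p : R * (R * R) => D c a b p.1 p.2.1 p.2.2)},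
      forall c a b : nat, (c + a + b < r)%N ->
        forall t x y : R, 0 <= t <= T ->
        is_derive x (1 : R) (fun x' : R => D c a b t x' y) (D c a.+1 b t x y) /\
        is_derive y (1 : R) (fun y' : R => D c a b t x y') (D c a b.+1 t x y)
    & forall c a b : nat, (c + a + b < r)%N ->
        forall t x y : R, 0 < t < T ->
        is_derive t (1 : R) (fun s : R => D c a b s x y) (D c.+1 a b t x y)].

(** * Sobolev norms and the Fourier projection *)

Definition sobolev_norm {R : realType} (L : R) (k : nat)
    (w : R -> R -> R) : R :=
  Num.sqrt (\sum_(a < k.+1) \sum_(b < k.+1 | (a + b <= k)%N)
              int2 L (fun x y => pderiv a b w x y ^+ 2)).

(* Norm of L^oo(0,T; H^k); used for functions that are continuous in time, for
   which the essential supremum is the supremum. *)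
Definition Linfty_sobolev_norm {R : realType} (L T : R) (k : nat)
    (w : R -> R -> R -> R) : \bar R :=
  ereal_sup [set (sobolev_norm L k (w t))%:E | t in `[0, T]].

(* The L^2-orthogonal projection onto the trigonometric polynomials of degree at
   most [N] in each variable: the real form of
   [\sum_(-N <= k, l <= N) w^_kl exp (2 pi i (k x + l y) / L)],
   with [k = i - N] and [l = j - N]. *)
Definition fourier_proj {R : realType} (L : R) (N : nat)
    (w : R -> R -> R) : R -> R -> R :=
  fun x y => \sum_(i < (2 * N).+1) \sum_(j < (2 * N).+1)
    let phase := fun x' y' : R =>
      2 * pi * ((i%:R - N%:R) * x' + (j%:R - N%:R) * y') / L in
    mean L (fun x' y' => w x' y' * cos (phase x' y')) * cos (phase x y) +
    mean L (fun x' y' => w x' y' * sin (phase x' y')) * sin (phase x y).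

(** * Grid functions
    A periodic grid function is stored by its values over one period: entry
    [(i, j)] of the matrix, with [i, j] counted from 0, is the value at
    [((i+1) h, (j+1) h)].  [ordS] and [ord_pred] are the cyclic shifts. *)

Definition Ih {R : realType} (M : nat) (h : R) (w : R -> R -> R) : 'M[R]_M :=
  \matrix_(i, j) w (i.+1%:R * h) (j.+1%:R * h).

Definition inner_h {R : realType} (M : nat) (h : R) (v w : 'M[R]_M) : R :=
  h ^+ 2 * \sum_(i < M) \sum_(j < M) v i j * w i j.

Definition norm_h {R : realType} (M : nat) (h : R) (v : 'M[R]_M) : R :=
  Num.sqrt (inner_h h v v).

Definition norm_inf {R : realType} (M : nat) (v : 'M[R]_M) : R :=
  \big[Num.max/0]_(i < M) \big[Num.max/0]_(j < M) `|v i j|.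

Definition mean_h {R : realType} (M : nat) (v : 'M[R]_M) : R :=
  (\sum_(i < M) \sum_(j < M) v i j) / M%:R ^+ 2.

Definition lap_h {R : realType} (M : nat) (h : R) (v : 'M[R]_M) : 'M[R]_M :=
  \matrix_(i, j) (h ^- 2 * (v (ordS i) j + v (ord_pred i) j +
                            v i (ord_pred j) + v i (ordS j) - 4 * v i j)).

(* How the degree [N M] is tied to the mesh size [h = L / M]: the approximation
   estimate (with [r] the available smoothness of [u]), and the exactness of the
   quadrature on [u_N]. *)
Definition proj_estimate {R : realType} (L T : R) (r : nat)
    (u : R -> R -> R -> R) (N : nat -> nat) : Prop :=
  forall k l : nat, (k <= l)%N -> (l <= r)%N ->
  exists2 Ce : R, 0 < Ce & forall M : nat, (0 < M)%N ->
    (Linfty_sobolev_norm L T k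
       (fun t x y => fourier_proj L (N M) (u t) x y - u t x y)%R
     <= (Ce * (L / M%:R) ^+ (l - k))%:E * Linfty_sobolev_norm L T l u)%E.

Definition proj_quadrature {R : realType} (L T : R)
    (u : R -> R -> R -> R) (N : nat -> nat) : Prop :=
  forall M : nat, (0 < M)%N -> forall t : R, 0 <= t <= T ->
    let h := L / M%:R in
    let uN := fourier_proj L (N M) (u t) in
    int2 L uN = h ^+ 2 * \sum_(i < M) \sum_(j < M) (Ih M h uN) i j.

(** * The P-ETDRK2 scheme *)

Definition Lh {R : realType} (M : nat) (h eps kappa sigma : R)
    (v : 'M[R]_M) : 'M[R]_M :=
  eps ^+ 2 *: lap_h h (lap_h h v) - kappa *: lap_h h v + sigma *: v.

Definition Fh {R : realType} (M : nat) (h sigma theta theta_c kappa : R)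
    (v : 'M[R]_M) : 'M[R]_M :=
  (theta / 2) *: lap_h h (\matrix_(i, j) (ln (1 + v i j) - ln (1 - v i j)))
  - theta_c *: lap_h h v - kappa *: lap_h h v + const_mx (sigma * mean_h v).

(* Only evaluated at positive arguments: the eigenvalues of [Lh] are at least
   [sigma]. *)
Definition phi0 {R : realType} (a : R) : R := expR (- a).
Definition phi1 {R : realType} (a : R) : R := (1 - expR (- a)) / a.
Definition phi2 {R : realType} (a : R) : R := (expR (- a) - 1 + a) / a ^+ 2.

(* [B = f(A)] for a symmetric matrix [A], by orthogonal diagonalization. *)
Definition is_spectral_fun {R : realType} (n : nat) (f : R -> R)
    (A B : 'M[R]_n) : Prop :=
  exists (P : 'M[R]_n) (d : 'rV[R]_n),
    [/\ P *m P^T = 1%:M, A = P^T *m diag_mx d *m P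
      & B = P^T *m diag_mx (map_mx f d) *m P].

(* The action on grid functions of a matrix in the basis used by [mxvec] and
   [lin_mx]. *)
Definition appmx {R : realType} (M : nat) (B : 'M[R]_(M * M))
    (v : 'M[R]_M) : 'M[R]_M :=
  vec_mx (mxvec v *m B).

Definition feasible {R : realType} (M : nat) (h delta : R)
    (vt phi : 'M[R]_M) : Prop :=
  norm_inf phi <= 1 - delta /\
  inner_h h phi (const_mx 1) = inner_h h vt (const_mx 1).

Definition is_projection {R : realType} (M : nat) (h delta : R)
    (vt v : 'M[R]_M) : Prop :=
  feasible h delta vt v /\
  forall phi : 'M[R]_M, feasible h delta vt phi ->
    2^-1 * norm_h h (v - vt) ^+ 2 <= 2^-1 * norm_h h (phi - vt) ^+ 2.

Definition PETDRK2_step {R : realType} (M : nat)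
    (h eps sigma theta theta_c kappa delta tau : R)
    (un un1 : 'M[R]_M) : Prop :=
  let A := tau *: lin_mx (@Lh R M h eps kappa sigma) in
  let F := @Fh R M h sigma theta theta_c kappa in
  exists (E0 E1 E2 : 'M[R]_(M * M)) (umid : 'M[R]_M),
    [/\ is_spectral_fun phi0 A E0,
        is_spectral_fun phi1 A E1,
        is_spectral_fun phi2 A E2,
        is_projection h delta
          (appmx E0 un + tau *: appmx E1 (F un)) umid
      & is_projection h delta
          (appmx E0 un +
           tau *: (appmx (E1 - E2) (F un) + appmx E2 (F umid))) un1].

(* Main.v *)
(* The numerical stage value before projection is y(tau), where y solves the
   linear ODE y' = - L_h y + F0 + (s/tau) (F1 - F0) exactly.  Its distance e to
   the exact solution on the grid therefore satisfies
   e' = - L_h e + Delta_h g + r, where g is controlled by the errors at the two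
   nodes through the Lipschitz continuity of the logarithms away from +-1, and r
   collects the interpolation error in time and the consistency error in space.
   The biharmonic part of L_h absorbs Delta_h g in the energy estimate
   (|e|^2)' <= alpha |e|^2 + |g|^2 / (2 eps^2) + |r|^2 / alpha, which is used with
   alpha = 1 / tau for the predictor and alpha = 1 for the corrector.

   The projection does not increase the distance to the exact solution u: only
   u + c, with the constant c that corrects the mass, is feasible, but constants
   are orthogonal to differences of grid functions of equal mass.  One has
   |c| = O(h^2), since the equation makes the discrete mass of u drift slowly. *)
Require Import Defs.
From HB Require Import structures.
From mathcomp Require Import all_boot all_order all_algebra.
From mathcomp Require Import all_classical all_reals all_analysis.
From mathcomp Require Import zify ring lra.
Import Order.TTheory GRing.Theory Num.Theory.
Import numFieldNormedType.Exports.
Set Implicit Arguments.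
Unset Strict Implicit.
Unset Printing Implicit Defensive.
Local Open Scope classical_set_scope.
Local Open Scope ring_scope.

(** * Grid functions *)

(** Bounding a difference of two values of [Fh] in the grid norm would cost h^-2; hence it is kept
    as Delta_h g, and only g is estimated. Freezing [Fh] at the left node leaves the predictor a
    residual of size tau + h^2. Its square enters the energy with the factor tau / alpha, so alpha =
    1 / tau gains tau^2 at the price of exp(alpha tau) = e, and the predictor adds only an error of
    order tau^2 + h^2. In the corrector, alpha = 1 keeps the growth factor of a step at exp(O(tau)).
    The equation contains the continuous mean, the scheme the discrete one. Instead of a quadrature
    error, u_N is inserted: the quadrature is exact for it, and u_N - u is O(h^2) in the maximum
    norm by the projection estimate from H^4 to H^2 and the embedding of H^2. Small h makes |c| <=
    delta and puts the initial data within 1 - delta; the gap between 2 delta in the separation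
    property and delta in the projection leaves room for this. Energies use [dot], without the
    weight h^2: constant grid functions then bring the factor M^2, which M h = L removes at the
    end. *)

Definition dot {R : realType} (M : nat) (v w : 'M[R]_M) : R :=
  \sum_(i < M) \sum_(j < M) v i j * w i j.

Section GridAlgebra.
Context {R : realType} (M : nat).
Implicit Types (u v w : 'M[R]_M) (h a b : R).

Lemma inner_hE h v w : inner_h h v w = h ^+ 2 * dot v w.
Proof. by []. Qed.

Lemma dotC v w : dot v w = dot w v.
Proof. by apply: eq_bigr => i _; apply: eq_bigr => j _; rewrite mulrC. Qed.

Lemma dotDl u v w : dot (u + v) w = dot u w + dot v w.
Proof.
rewrite -big_split /=; apply: eq_bigr => i _; rewrite -big_split /=.
by apply: eq_bigr => j _; rewrite mxE mulrDl.
Qed.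

Lemma dotZl a v w : dot (a *: v) w = a * dot v w.
Proof.
rewrite mulr_sumr; apply: eq_bigr => i _; rewrite mulr_sumr.
by apply: eq_bigr => j _; rewrite mxE mulrA.
Qed.

Lemma dotDr u v w : dot u (v + w) = dot u v + dot u w.
Proof. by rewrite dotC dotDl !(dotC u). Qed.

Lemma dotZr a v w : dot v (a *: w) = a * dot v w.
Proof. by rewrite dotC dotZl dotC. Qed.

Lemma dotNl v w : dot (- v) w = - dot v w.
Proof. by rewrite -scaleN1r dotZl mulN1r. Qed.

Lemma dotNr v w : dot v (- w) = - dot v w.
Proof. by rewrite -scaleN1r dotZr mulN1r. Qed.

Lemma dotBl u v w : dot (u - v) w = dot u w - dot v w.
Proof. by rewrite dotDl dotNl. Qed.

Definition dotE := (dotDl, dotDr, dotNl, dotNr, dotZl, dotZr).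

Lemma dot_ge0 v : 0 <= dot v v.
Proof.
by apply: sumr_ge0 => i _; apply: sumr_ge0 => j _; rewrite -expr2 sqr_ge0.
Qed.

Lemma le_dot v w : (forall i j, `|v i j| <= `|w i j|) -> dot v v <= dot w w.
Proof.
move=> vw; apply: ler_sum => i _; apply: ler_sum => j _.
rewrite -!expr2 -[leLHS]real_normK ?num_real // -[leRHS]real_normK ?num_real //.
by rewrite lerXn2r ?nnegrE.
Qed.

Lemma dot_const_mx a : dot (const_mx a : 'M[R]_M) (const_mx a) = M%:R ^+ 2 * a ^+ 2.
Proof.
rewrite /dot (eq_bigr (fun=> M%:R * a ^+ 2)); last first.
  move=> i _; rewrite (eq_bigr (fun=> a ^+ 2)); last by move=> j _; rewrite !mxE.
  by rewrite sumr_const card_ord mulr_natl.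
by rewrite sumr_const card_ord -[LHS]mulr_natl mulrA.
Qed.

Lemma dot_le_const v a : (forall i j, `|v i j| <= a) ->
  dot v v <= M%:R ^+ 2 * a ^+ 2.
Proof.
move=> va; rewrite -dot_const_mx; apply: le_dot => i j.
by rewrite mxE; apply: le_trans (va i j) (ler_norm _).
Qed.

Lemma dot_young v w a : 0 < a -> 2 * dot v w <= a * dot v v + a^-1 * dot w w.
Proof.
move=> a0; have := dot_ge0 (a *: v - w); rewrite !dotE (dotC w v) => h0.
have : 0 <= a^-1 * (a * (a * dot v v) - a * dot v w + - (a * dot v w) + dot w w).
  rewrite mulr_ge0 ?invr_ge0 ?(ltW a0) //; lra.
have -> : a^-1 * (a * (a * dot v v) - a * dot v w + - (a * dot v w) + dot w w) =
   a * dot v v + a^-1 * dot w w - 2 * dot v w by field; rewrite gt_eqF.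
by rewrite subr_ge0.
Qed.

Lemma dotD_le u v : dot (u + v) (u + v) <= 2 * dot u u + 2 * dot v v.
Proof.
have := dot_young u v ltr01; rewrite invr1 !mul1r => h0.
rewrite !dotE (dotC v u); lra.
Qed.

Lemma mean_h_dot v : mean_h v = dot v (const_mx 1) / M%:R ^+ 2.
Proof.
by congr (_ / _); apply: eq_bigr => i _; apply: eq_bigr => j _; rewrite mxE mulr1.
Qed.

Lemma mean_hB v w : mean_h (v - w) = mean_h v - mean_h w.
Proof. by rewrite !mean_h_dot dotBl mulrBl. Qed.

Lemma mean_hD v w : mean_h (v + w) = mean_h v + mean_h w.
Proof. by rewrite !mean_h_dot dotDl mulrDl. Qed.

Lemma mean_hZ a v : mean_h (a *: v) = a * mean_h v.
Proof. by rewrite !mean_h_dot dotZl mulrA. Qed.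

Lemma mean_h_const a : (0 < M)%N -> mean_h (const_mx a : 'M[R]_M) = a.
Proof.
move=> M0; have Mn0 : M%:R ^+ 2 != 0 :> R by rewrite expf_neq0 // pnatr_eq0 -lt0n.
rewrite /mean_h (eq_bigr (fun=> M%:R * a)); last first.
  move=> i _; rewrite (eq_bigr (fun=> a)) => [|j _]; last by rewrite mxE.
  by rewrite sumr_const card_ord mulr_natl.
by rewrite sumr_const card_ord -[X in X / _]mulr_natl mulrA -expr2 mulrC mulrA mulVf // mul1r.
Qed.

Lemma le_mean_h v a : (0 < M)%N -> (forall i j, `|v i j| <= a) -> `|mean_h v| <= a.
Proof.
move=> M0 va; rewrite -[leRHS](mean_h_const a M0) /mean_h normrM normfV.
rewrite [X in _ / X]ger0_norm ?exprn_ge0 ?ler0n //.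
rewrite ler_wpM2r ?invr_ge0 ?exprn_ge0 ?ler0n //.
apply: (le_trans (ler_norm_sum _ _ _)); apply: ler_sum => i _.
apply: (le_trans (ler_norm_sum _ _ _)); apply: ler_sum => j _.
by rewrite mxE.
Qed.

(** Expand the nonnegative square norm of [v] minus its mean. This bounds the mean term of [Fh] by
    an energy. *)
Lemma mean_h_sqr_le v : (0 < M)%N -> M%:R ^+ 2 * mean_h v ^+ 2 <= dot v v.
Proof.
move=> M0; have Mn0 : M%:R ^+ 2 != 0 :> R by rewrite expf_neq0 // pnatr_eq0 -lt0n.
have := dot_ge0 (v - const_mx (mean_h v)).
have -> : const_mx (mean_h v) = mean_h v *: const_mx 1 :> 'M[R]_M.
  by apply/matrixP => i j; rewrite !mxE mulr1.
rewrite !dotE (dotC _ v) dot_const_mx.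
have -> : dot v (const_mx 1) = M%:R ^+ 2 * mean_h v.
  by rewrite mean_h_dot mulrCA mulfV // mulr1.
by rewrite expr1n mulr1 => h0; nra.
Qed.

(** Cyclic shifts by one node. [S1], [S2] and [S3], [S4] are pairs of mutually inverse and adjoint
    maps, hence isometries; symmetry and sign of the discrete Laplacian follow without a discrete
    gradient. *)
Let S1 v : 'M[R]_M := \matrix_(i, j) v (ordS i) j.
Let S2 v : 'M[R]_M := \matrix_(i, j) v (ord_pred i) j.
Let S3 v : 'M[R]_M := \matrix_(i, j) v i (ord_pred j).
Let S4 v : 'M[R]_M := \matrix_(i, j) v i (ordS j).

Let S12 v w : dot (S1 v) w = dot v (S2 w).
Proof.
rewrite /dot [RHS](reindex_inj (@ordS_inj M)) /=.
by apply: eq_bigr => i _; apply: eq_bigr => j _; rewrite !mxE ordSK.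
Qed.

Let S34 v w : dot (S3 v) w = dot v (S4 w).
Proof.
apply: eq_bigr => i _; rewrite [RHS](reindex_inj (@ord_pred_inj M)) /=.
by apply: eq_bigr => j _; rewrite !mxE ord_predK.
Qed.

Let S21K v : S2 (S1 v) = v.
Proof. by apply/matrixP => i j; rewrite !mxE ord_predK. Qed.

Let S43K v : S4 (S3 v) = v.
Proof. by apply/matrixP => i j; rewrite !mxE ordSK. Qed.

Let lapE h v : lap_h h v = h ^- 2 *: (S1 v + S2 v + S3 v + S4 v - 4 *: v).
Proof. by apply/matrixP => i j; rewrite !mxE. Qed.

Lemma lap_hD h v w : lap_h h (v + w) = lap_h h v + lap_h h w.
Proof. by apply/matrixP => i j; rewrite !mxE; ring. Qed.

Lemma lap_hZ h a v : lap_h h (a *: v) = a *: lap_h h v.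
Proof. by apply/matrixP => i j; rewrite !mxE; ring. Qed.

Lemma lap_hN h v : lap_h h (- v) = - lap_h h v.
Proof. by rewrite -scaleN1r lap_hZ scaleN1r. Qed.

Lemma lap_hB h v w : lap_h h (v - w) = lap_h h v - lap_h h w.
Proof. by rewrite lap_hD lap_hN. Qed.

Lemma dot_lap_h h v w : dot (lap_h h v) w = dot v (lap_h h w).
Proof.
have S21 : dot (S2 v) w = dot v (S1 w) by rewrite dotC -S12 dotC.
have S43 : dot (S4 v) w = dot v (S3 w) by rewrite dotC -S34 dotC.
by rewrite !lapE !dotE S12 S34 S21 S43; ring.
Qed.

(** For an isometric shift S, expanding |S v - v|^2 >= 0 gives <S v, v> <= <v, v>; [S2] and [S4]
    reduce to [S1] and [S3] by adjointness. *)
Lemma dot_lap_h_le0 h v : dot (lap_h h v) v <= 0.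
Proof.
have e1 : dot (S1 v) (S1 v) = dot v v by rewrite S12 S21K.
have e3 : dot (S3 v) (S3 v) = dot v v by rewrite S34 S43K.
have h1 : dot (S1 v) v <= dot v v.
  have := dot_ge0 (S1 v - v); rewrite !dotE e1 (dotC v (S1 v)); lra.
have h3 : dot (S3 v) v <= dot v v.
  have := dot_ge0 (S3 v - v); rewrite !dotE e3 (dotC v (S3 v)); lra.
rewrite lapE !dotE [dot (S2 v) v]dotC -S12 [dot (S4 v) v]dotC -S34.
by rewrite mulr_ge0_le0 ?invr_ge0 ?sqr_ge0 //; lra.
Qed.

Lemma lap_h_const h a : lap_h h (const_mx a : 'M[R]_M) = 0.
Proof. by apply/matrixP => i j; rewrite !mxE; ring. Qed.

Lemma mean_h_lap h v : mean_h (lap_h h v) = 0.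
Proof.
rewrite mean_h_dot dot_lap_h lap_h_const.
by rewrite -(scale0r (0 : 'M[R]_M)) dotZr mul0r mul0r.
Qed.

End GridAlgebra.

(** * Pointwise derivatives and Gronwall's inequality *)

Section PointwiseDerivatives.
Context {R : realType}.
Implicit Types (f g : R -> R) (x a b : R).

Lemma is_derive_add f g x a b : is_derive x 1 f a -> is_derive x 1 g b ->
  is_derive x 1 (fun s => f s + g s) (a + b).
Proof. exact: is_deriveD. Qed.

Lemma is_derive_opp f x a : is_derive x 1 f a ->
  is_derive x 1 (fun s => - f s) (- a).
Proof. exact: is_deriveN. Qed.

Lemma is_derive_sub f g x a b : is_derive x 1 f a -> is_derive x 1 g b ->
  is_derive x 1 (fun s => f s - g s) (a - b).
Proof. exact: is_deriveB. Qed.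

Lemma is_derive_mul f g x a b : is_derive x 1 f a -> is_derive x 1 g b ->
  is_derive x 1 (fun s => f s * g s) (f x * b + g x * a).
Proof. exact: is_deriveM. Qed.

Lemma is_derive_scale c f x a : is_derive x 1 f a ->
  is_derive x 1 (fun s => c * f s) (c * a).
Proof. exact: is_deriveZ. Qed.

Lemma is_derive_const c x : is_derive x 1 (fun=> c : R) 0.
Proof. exact: is_derive_cst. Qed.

Lemma is_derive_comp f g x a b : is_derive (g x) 1 f a -> is_derive x 1 g b ->
  is_derive x 1 (fun s => f (g s)) (a * b).
Proof. exact: is_derive1_comp. Qed.

Lemma is_derive_bigsum n (F : 'I_n -> R -> R) (dF : 'I_n -> R) x :
  (forall i, is_derive x 1 (F i) (dF i)) ->
  is_derive x 1 (fun s => \sum_(i < n) F i s) (\sum_(i < n) dF i).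
Proof.
move=> dFP; have := @is_derive_sum _ _ _ n F x 1 dF dFP.
by congr is_derive; apply/funext => s; rewrite fct_sumE.
Qed.

Lemma cvg_bigsum {T : Type} (F : set_system T) {FF : Filter F} n
    (f : 'I_n -> T -> R) (l : 'I_n -> R) :
  (forall i, f i x @[x --> F] --> l i) ->
  (\sum_(i < n) f i x) @[x --> F] --> \sum_(i < n) l i.
Proof.
elim: n f l => [|n IH] f l fl.
  by under eq_fun do rewrite big_ord0; rewrite big_ord0; exact: cvg_cst.
under eq_fun do rewrite big_ord_recl; rewrite big_ord_recl.
by apply: cvgD; [exact: fl|apply: IH => i; exact: fl].
Qed.

Lemma is_derive_expRM c x : is_derive x 1 (fun s => expR (c * s)) (c * expR (c * x)).
Proof.
have := @is_derive_comp expR (fun s => c * s) x _ _ (is_derive_expR _)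
  (is_derive_scale c (is_derive_id x 1)).
by move=> h; apply: is_derive_eq h _; rewrite mulr1 mulrC.
Qed.

Lemma is_derive_continuous f x a : is_derive x 1 f a -> {for x, continuous f}.
Proof.
by move=> -[fx _]; apply: differentiable_continuous; apply/derivable1_diffP.
Qed.

(** The mean value theorem for exp(-k s) E(s) - b s, whose derivative is at most b (exp(-k s) - 1)
    <= 0. Derivatives are taken only inside the interval, because the equation is given only for 0 <
    t < T. *)
Lemma gronwall_diff (E dE : R -> R) (k b tau : R) :
  0 < tau -> 0 <= k -> 0 <= b ->
  {within `[0, tau], continuous E} ->
  (forall s, 0 < s < tau -> is_derive s 1 E (dE s)) ->
  (forall s, 0 < s < tau -> dE s <= k * E s + b) ->
  E tau <= expR (k * tau) * (E 0 + tau * b).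
Proof.
move=> tau0 k0 b0 Ec Ed dEle.
pose f s := expR (- k * s) * E s - b * s.
pose df s := expR (- k * s) * dE s + E s * (- k * expR (- k * s)) - b.
have fd s : s \in `]0, tau[ -> is_derive s 1 f (df s).
  rewrite in_itv /= => st; apply: is_derive_sub; last first.
    by rewrite -[X in is_derive _ _ _ X]mulr1; apply: is_derive_scale; exact: is_derive_id.
  by apply: is_derive_mul; [exact: is_derive_expRM|exact: Ed].
have fc : {within `[0, tau], continuous f}.
  move=> s; apply: cvgB; last first.
    by apply: continuous_subspaceT => z; exact: mulrl_continuous.
  apply: cvgM; last exact: Ec.
  apply: continuous_subspaceT => z.
  exact: is_derive_continuous (is_derive_expRM _ _).
have [c] := MVT tau0 fd fc.
rewrite in_itv /= subr0 => c0 fE.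
have : f tau <= f 0.
  rewrite -subr_le0 fE pmulr_lle0 // /df.
  have -> : expR (- k * c) * dE c + E c * (- k * expR (- k * c)) - b =
     expR (- k * c) * (dE c - k * E c) - b by ring.
  rewrite subr_le0; apply: (@le_trans _ _ (expR (- k * c) * b)).
    by rewrite ler_pM2l ?expR_gt0 // lerBlDl; apply: dEle.
  rewrite -[leRHS]mul1r ler_wpM2r // -expR0 ler_expR.
  by rewrite mulNr oppr_le0 mulr_ge0 //; case/andP: c0 => /ltW.
rewrite /f !mulr0 expR0 mul1r subr0 lerBlDr => h.
have -> : E tau = expR (k * tau) * (expR (- k * tau) * E tau).
  by rewrite mulrA -expRD mulNr subrr expR0 mul1r.
by rewrite ler_pM2l ?expR_gt0 // (mulrC tau).
Qed.

End PointwiseDerivatives.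

(** * Exponential time differencing as an exact linear flow *)

Section SpectralCalculus.
Context {R : realType} (n : nat).
Implicit Types (A B P : 'M[R]_n) (d : 'rV[R]_n) (f : R -> R).

(** The scheme's matrices may come with different diagonalizations; this moves them to a common one.
    The change of basis S = Q P^T intertwines the two diagonal matrices, so either S_ij = 0 or the
    eigenvalues d_j and e_i agree, and S intertwines their images under [f] too. *)
Lemma spectral_fun_unique f A B P d : is_spectral_fun f A B ->
  P *m P^T = 1%:M -> A = P^T *m diag_mx d *m P ->
  B = P^T *m diag_mx (map_mx f d) *m P.
Proof.
move=> [Q [e [QQ AQ ->]]] PP AP.
have PP' : P^T *m P = 1%:M by exact: mulmx1C.
pose S := Q *m P^T.
have QS : Q = S *m P by rewrite -mulmxA PP' mulmx1.
have PS : P^T = Q^T *m S by rewrite mulmxA (mulmx1C QQ) mul1mx.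
have Sde : S *m diag_mx d = diag_mx e *m S.
  transitivity (Q *m A *m P^T).
    by rewrite AP !mulmxA -(mulmxA _ P P^T) PP mulmx1.
  by rewrite AQ !mulmxA QQ mul1mx.
have Sfde : S *m diag_mx (map_mx f d) = diag_mx (map_mx f e) *m S.
  apply/matrixP => i j; have /matrixP/(_ i j) := Sde.
  rewrite !mul_mx_diag !mul_diag_mx !mxE; set z := (\sum_k _).
  have [->|Sij] := eqVneq z 0; first by rewrite !mul0r !mulr0.
  move=> eq_de; have -> : d 0 j = e 0 i by apply: (mulfI Sij); rewrite eq_de mulrC.
  by rewrite mulrC.
by rewrite PS -(mulmxA Q^T S) Sfde mulmxA -(mulmxA _ S P) -QS.
Qed.

End SpectralCalculus.

(** The solution of y' = - l y + (1 - s/t) b + (s/t) c with y(0) = a. At s = t the coefficients of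
    a, b, c are phi0, t (phi1 - phi2) and t phi2, evaluated at l t. *)
Definition etd {R : realType} (l t a b c s : R) : R :=
  expR (- l * s) * a + (1 - expR (- l * s)) / l * b +
  (expR (- l * s) - 1 + l * s) / (l ^+ 2 * t) * (c - b).

Lemma is_derive_etd {R : realType} (l t a b c s : R) : l != 0 -> t != 0 ->
  is_derive s 1 (etd l t a b c)
    (- l * etd l t a b c s + (1 - s / t) * b + s / t * c).
Proof.
move=> l0 t0.
have -> : etd l t a b c =
   (fun s => (a - b / l + (c - b) / (l ^+ 2 * t)) * expR (- l * s) +
      (c - b) / (l * t) * s + (b / l - (c - b) / (l ^+ 2 * t))).
  by apply/funext => s'; rewrite /etd; field; rewrite t0 l0.
have h := is_derive_add (is_derive_add
  (is_derive_scale (a - b / l + (c - b) / (l ^+ 2 * t)) (is_derive_expRM (- l) s))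
  (is_derive_scale ((c - b) / (l * t)) (is_derive_id s 1)))
  (is_derive_const (b / l - (c - b) / (l ^+ 2 * t)) s).
by apply: (is_derive_eq h); rewrite /etd; field; rewrite t0 l0.
Qed.

Section Curve.
Context {R : realType} (M : nat) (L : {linear 'M[R]_M -> 'M[R]_M}).
Variables (sigma tau : R).
Hypotheses (sigma0 : 0 < sigma) (tau0 : 0 < tau).
Hypothesis Lpos : forall v, sigma * dot v v <= dot (L v) v.

(** A row of [P], reshaped to a grid function, is an eigenvector, nonzero because P P^T = 1;
    coercivity does the rest. Positivity keeps the denominators of [phi1] and [phi2] away from 0. *)
Lemma eigenvalue_pos (P : 'M[R]_(M * M)) (d : 'rV[R]_(M * M)) k :
  P *m P^T = 1%:M -> tau *: lin_mx L = P^T *m diag_mx d *m P -> 0 < d 0 k.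
Proof.
move=> PP AP; pose V := vec_mx (row k P).
have eV : tau *: L V = d 0 k *: V.
  apply: (can_inj mxvecK); rewrite !linearZ /= -mul_vec_lin /=.
  rewrite /V vec_mxK scalemxAr AP !mulmxA -row_mul PP row1.
  by rewrite -rowE row_diag_mx -scalemxAl -rowE.
have V0 : 0 < dot V V.
  rewrite lt_neqAle dot_ge0 andbT eq_sym; apply/negP => /eqP V0.
  have V00 : V = 0.
    apply/matrixP => i j; rewrite [RHS]mxE; apply/eqP; rewrite -sqrf_eq0 expr2; apply/eqP.
    have /psumr_eq0P : \sum_i \sum_j V i j * V i j = 0 by exact: V0.
    move=> /(_ _ i isT) h1.
    have /psumr_eq0P : \sum_j V i j * V i j = 0.
      by apply: h1 => i' _; apply: sumr_ge0 => ? _; rewrite -expr2 sqr_ge0.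
    by move=> /(_ _ j isT) ->// j' _; rewrite -expr2 sqr_ge0.
  have /matrixP/(_ k k) := PP; rewrite !mxE eqxx /= => /eqP.
  rewrite big1 ?(eq_sym 0) ?oner_eq0 // => l _.
  suff -> : P k l = 0 by rewrite mul0r.
  have : row k P = 0 by rewrite -[row k P]vec_mxK -/V V00 linear0.
  by move=> /matrixP/(_ 0 l); rewrite !mxE.
have := ler_wpM2l (ltW tau0) (Lpos V).
rewrite -(dotZl tau (L V)) eV dotZl mulrA ler_pM2r //; apply: lt_le_trans.
exact: mulr_gt0.
Qed.

(** In the eigenbasis common to [E0], [E1], [E2] the linear ODE decouples, and [etd] solves each
    component. *)
Lemma ETD_curve (E0 E1 E2 : 'M[R]_(M * M)) (v F0 F1 : 'M[R]_M) :
  is_spectral_fun phi0 (tau *: lin_mx L) E0 ->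
  is_spectral_fun phi1 (tau *: lin_mx L) E1 ->
  is_spectral_fun phi2 (tau *: lin_mx L) E2 ->
  exists y : R -> 'M[R]_M,
    [/\ y 0 = v,
        y tau = appmx E0 v + tau *: (appmx (E1 - E2) F0 + appmx E2 F1)
      & forall (s : R) i j, is_derive s 1 (fun s : R => y s i j)
          ((- L (y s) + (1 - s / tau) *: F0 + (s / tau) *: F1) i j)].
Proof.
move=> [P [d [PP AP ->]]] /spectral_fun_unique/(_ PP AP) -> /spectral_fun_unique/(_ PP AP) ->.
have PP' : P^T *m P = 1%:M by exact: mulmx1C.
have d0 k : 0 < d 0 k by apply: eigenvalue_pos PP AP.
have dn0 k : d 0 k != 0 by rewrite gt_eqF.
have tn0 : tau != 0 by rewrite gt_eqF.
(* Coordinates in the eigenbasis, named opaquely so that [mxE] does not expand the products. *)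
have [a aE] : exists a, mxvec v *m P^T = a by eexists.
have [f0 f0E] : exists a, mxvec F0 *m P^T = a by eexists.
have [f1 f1E] : exists a, mxvec F1 *m P^T = a by eexists.
(* [d] holds the eigenvalues of tau L; those of L are d / tau. *)
pose lam k := d 0 k / tau.
have ln0 k : lam k != 0 by rewrite mulf_neq0 // invr_eq0.
pose Y s : 'rV[R]_(M * M) := \row_k etd (lam k) tau (a 0 k) (f0 0 k) (f1 0 k) s.
pose dY s : 'rV[R]_(M * M) := \row_k (- lam k * Y s 0 k + (1 - s / tau) * f0 0 k +
  s / tau * f1 0 k).
have Yd (s : R) k : is_derive s 1 (fun s : R => Y s 0 k) (dY s 0 k).
  have := is_derive_etd (a 0 k) (f0 0 k) (f1 0 k) s (ln0 k) tn0.
  have YE s' : Y s' 0 k = etd (lam k) tau (a 0 k) (f0 0 k) (f1 0 k) s' by rewrite mxE.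
  have -> : dY s 0 k = - lam k * Y s 0 k + (1 - s / tau) * f0 0 k + s / tau * f1 0 k.
    by rewrite mxE.
  by rewrite YE; congr is_derive; apply/funext => s'; rewrite YE.
pose y s := vec_mx (Y s *m P).
have Ly s : mxvec (- L (y s) + (1 - s / tau) *: F0 + (s / tau) *: F1) = dY s *m P.
  rewrite !linearD /= !linearZ /= linearN /= -mul_vec_lin /= /y vec_mxK.
  have -> : lin_mx L = tau^-1 *: (P^T *m diag_mx d *m P).
    by rewrite -AP scalerA mulVf // scale1r.
  rewrite -scalemxAr !mulmxA -(mulmxA (Y s)) PP mulmx1.
  have mf (F : 'M[R]_M) : mxvec F = mxvec F *m P^T *m P by rewrite -mulmxA PP' mulmx1.
  rewrite (mf F0) (mf F1) f0E f1E !scalemxAl -mulNmx -!mulmxDl; congr (_ *m P).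
  rewrite mul_mx_diag /dY; move: (Y s) => Ys.
  by apply/rowP => k; rewrite !mxE /lam /GRing.scale /=; field.
exists y; split.
- rewrite /y (_ : Y 0 = a) -?aE -?mulmxA ?PP' ?mulmx1 ?mxvecK //.
  apply/rowP => k; rewrite mxE /etd !mulr0 expR0.
  by rewrite addr0 subrr !mul0r mul1r !addr0 aE.
- apply: (can_inj mxvecK); rewrite !linearD /= !linearZ /= /appmx !vec_mxK.
  rewrite -mulmxBl -mulmxBr !mulmxA aE f0E f1E !scalemxAl -!mulmxDl.
  congr (_ *m P); apply/rowP => k.
  have lt : lam k * tau = d 0 k by rewrite /lam mulfVK.
  rewrite -linearB /= 2!mxE !mul_mx_diag !mxE /etd mulNr lt /phi0 /phi1 /phi2 /lam.
  by field; rewrite ?tn0 ?dn0.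
move=> s i j; have -> : (fun s => y s i j) =
    (fun s => \sum_l Y s 0 l * P l (mxvec_index i j)).
  by apply/funext => s'; rewrite !mxE.
rewrite -mxvecE Ly mxE; apply: is_derive_bigsum => l.
have := is_derive_scale (P l (mxvec_index i j)) (Yd s l).
rewrite mulrC; congr is_derive; apply/funext => s'; exact: mulrC.
Qed.

End Curve.

(** * Stability of one stage and of the projection *)

Section StepStability.
Context {R : realType} (M : nat).
Variables (h eps kappa sigma : R).
Hypotheses (kappa0 : 0 < kappa) (sigma0 : 0 < sigma).
Local Notation L := (@Lh R M h eps kappa sigma).

Lemma Lh_linear : linear L.
Proof.
move=> a v w; rewrite /Lh !(lap_hD, lap_hZ).
by apply/matrixP => i j; rewrite !mxE; ring.
Qed.

HB.instance Definition _ := GRing.isLinear.Build R 'M[R]_M 'M[R]_M _ L Lh_linear.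

(** By symmetry the biharmonic part is eps^2 |lap_h v|^2; the stabilizing part has a good sign and
    is dropped. *)
Lemma dot_Lh v : eps ^+ 2 * dot (lap_h h v) (lap_h h v) + sigma * dot v v <= dot (L v) v.
Proof.
have k0 := ltW kappa0; have := dot_lap_h_le0 h v => hv.
by rewrite /Lh !dotE (dot_lap_h _ (lap_h h v)); nra.
Qed.

Lemma Lh_coercive v : sigma * dot v v <= dot (L v) v.
Proof.
apply: le_trans (dot_Lh v); rewrite lerDr mulr_ge0 ?sqr_ge0 //; exact: dot_ge0.
Qed.

Lemma mean_h_Lh v : mean_h (L v) = sigma * mean_h v.
Proof.
by rewrite /Lh mean_hD mean_hB !mean_hZ !mean_h_lap !mulr0 subrr add0r.
Qed.

(* The biharmonic term absorbs [lap_h g]. *)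
Lemma dissipation (e g r : 'M[R]_M) (alpha : R) : 0 < eps -> 0 < alpha ->
  2 * dot e (- L e + lap_h h g + r) <=
  alpha * dot e e + (dot g g / (2 * eps ^+ 2) + dot r r / alpha).
Proof.
move=> eps0 alpha0; rewrite !dotDr dotNr (dotC e (L e)) -dot_lap_h.
have hL := dot_Lh e.
have hr : 2 * dot e r <= alpha * dot e e + alpha^-1 * dot r r by exact: dot_young.
have e2 : 0 < 2 * eps ^+ 2 by rewrite mulr_gt0 // exprn_gt0.
(* The weight 2 eps^2 is exactly the amount of |lap_h e|^2 that twice [hL] provides. *)
have hg := dot_young (lap_h h e) g e2.
have := mulr_ge0 (ltW sigma0) (dot_ge0 e).
rewrite ![_ / alpha]mulrC ![_ / (2 * eps ^+ 2)]mulrC => h0; lra.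
Qed.

(** [B] is the whole forcing of the exact solution [W], and y - W obeys the equation treated in
    [dissipation]; its energy then satisfies Gronwall's inequality with k = alpha. *)
Lemma stage_stability (tau alpha gam rho : R) (A0 A1 : 'M[R]_M) (y W B g r : R -> 'M[R]_M) :
  0 < eps -> 0 < alpha -> 0 < tau ->
  (forall (s : R) i j, is_derive s 1 (fun s : R => y s i j)
     ((- L (y s) + (1 - s / tau) *: A0 + (s / tau) *: A1) i j)) ->
  (forall i j, {within `[0, tau], continuous (fun s : R => W s i j)}) ->
  (forall (s : R) i j, 0 < s < tau -> is_derive s 1 (fun s : R => W s i j)
     ((- L (W s) + B s) i j)) ->
  (forall s, 0 < s < tau ->
     (1 - s / tau) *: A0 + (s / tau) *: A1 - B s = lap_h h (g s) + r s) ->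
  (forall s, 0 < s < tau -> dot (g s) (g s) <= gam) ->
  (forall s, 0 < s < tau -> dot (r s) (r s) <= rho) ->
  dot (y tau - W tau) (y tau - W tau) <= expR (alpha * tau) *
    (dot (y 0 - W 0) (y 0 - W 0) + tau * (gam / (2 * eps ^+ 2) + rho / alpha)).
Proof.
move=> eps0 alpha0 tau0 yd Wc Wd ABE gle rle.
(* Any interior time shows that the bounds [gam] and [rho] are nonnegative. *)
have t2 : 0 < tau / 2 < tau by lra.
have gam0 : 0 <= gam by apply: le_trans (dot_ge0 _) (gle _ t2).
have rho0 : 0 <= rho by apply: le_trans (dot_ge0 _) (rle _ t2).
have e2 : 0 < 2 * eps ^+ 2 by rewrite mulr_gt0 // exprn_gt0.
pose e s := y s - W s.
pose de s := - L (e s) + lap_h h (g s) + r s.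
have ed (s : R) i j : 0 < s < tau -> is_derive s 1 (fun s : R => e s i j) (de s i j).
  move=> st; have /matrixP/(_ i j) := ABE s st.
  have := is_derive_sub (yd s i j) (Wd s i j st).
  have -> : (fun s0 => y s0 i j - W s0 i j) = (fun s0 => e s0 i j).
    by apply/funext => s'; rewrite !mxE.
  move=> hd hE; apply: (is_derive_eq hd).
  have LE : L (e s) = L (y s) - L (W s) by rewrite /e linearB.
  by rewrite /de -(addrA (- L (e s))) [RHS]mxE -hE LE !mxE; ring.
apply: (@gronwall_diff _ (fun s => dot (e s) (e s)) (fun s => 2 * dot (e s) (de s))) => //.
- exact: ltW.
- by rewrite addr_ge0 // divr_ge0 // ltW.
- move=> s; rewrite /dot; apply: cvg_bigsum => i; apply: cvg_bigsum => j.
  have ec : {within `[0, tau], continuous (fun s : R => e s i j)}.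
    have -> : (fun s0 => e s0 i j) = (fun s0 => y s0 i j - W s0 i j).
      by apply/funext => s'; rewrite !mxE.
    move=> s'; apply: cvgB; last exact: Wc.
    by apply: continuous_subspaceT => z; exact: is_derive_continuous (yd z i j).
  by apply: cvgM; exact: ec.
- move=> s st; have -> : 2 * dot (e s) (de s) =
      \sum_i \sum_j (e s i j * de s i j + e s i j * de s i j).
    rewrite /dot mulr_sumr; apply: eq_bigr => i _; rewrite mulr_sumr.
    by apply: eq_bigr => j _; ring.
  apply: is_derive_bigsum => i; apply: is_derive_bigsum => j.
  exact: is_derive_mul (ed s i j st) (ed s i j st).
move=> s st; apply: le_trans (dissipation (e s) (g s) (r s) eps0 alpha0) _.
rewrite lerD2l lerD // ler_wpM2r ?invr_ge0 ?(ltW e2) ?(ltW alpha0) //; [exact: gle|exact: rle].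
Qed.

(** The Laplacians have mean zero, so the mean obeys mean' = sigma (m - mean) and starts at the
    stationary value m. Its squared deviation from m cannot grow and stays 0. *)
Lemma mean_h_curve (tau m : R) (A0 A1 : 'M[R]_M) (y : R -> 'M[R]_M) : 0 < tau ->
  (forall (s : R) i j, is_derive s 1 (fun s : R => y s i j)
     ((- L (y s) + (1 - s / tau) *: A0 + (s / tau) *: A1) i j)) ->
  mean_h A0 = sigma * m -> mean_h A1 = sigma * m -> mean_h (y 0) = m ->
  mean_h (y tau) = m.
Proof.
move=> tau0 yd mA0 mA1 my0.
have md (s : R) : is_derive s 1 (fun s : R => mean_h (y s)) (sigma * (m - mean_h (y s))).
  have -> : sigma * (m - mean_h (y s)) =
      mean_h (- L (y s) + (1 - s / tau) *: A0 + (s / tau) *: A1).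
    move: (L (y s)) (mean_h_Lh (y s)) => z zE.
    by rewrite !mean_hD -(scaleN1r z) !mean_hZ zE mA0 mA1; ring.
  rewrite /mean_h.
  have -> : (fun s0 => (\sum_i \sum_j y s0 i j) / M%:R ^+ 2) =
      (fun s0 => (M%:R ^+ 2)^-1 * (\sum_i \sum_j y s0 i j)).
    by apply/funext => s'; rewrite mulrC.
  rewrite [X in is_derive _ _ _ X]mulrC; apply: is_derive_scale.
  by apply: is_derive_bigsum => i; apply: is_derive_bigsum => j; exact: yd.
pose E s := (mean_h (y s) - m) ^+ 2.
have Ed (s : R) : is_derive s 1 E (- 2 * sigma * E s).
  have h0 := is_derive_sub (md s) (is_derive_const m s).
  have := is_derive_mul h0 h0.
  by move=> h1; apply: (is_derive_eq h1); rewrite /E; ring.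
have E0 : E 0 = 0 by rewrite /E my0 subrr expr0n.
have E00 : E tau <= expR (0 * tau) * (E 0 + tau * 0).
  apply: (gronwall_diff tau0 (lexx _) (lexx _) (E := E) (dE := fun s => - 2 * sigma * E s)).
  - by apply: continuous_subspaceT => z; exact: is_derive_continuous (Ed z).
  - move=> s _; rewrite mul0r addr0 !mulNr oppr_le0. by rewrite mulr_ge0 ?sqr_ge0 ?mulr_ge0 ?(ltW sigma0).
move: E00; rewrite E0 mulr0 addr0 mulr0 => E00.
by apply/eqP; rewrite -subr_eq0 -sqrf_eq0 eq_le E00 sqr_ge0.
Qed.

End StepStability.

(** * Nonexpansiveness of the projection *)

Section Projection.
Context {R : realType} (M : nat).
Variables (h delta : R).
Hypothesis h0 : 0 < h.
Implicit Types (v w vt : 'M[R]_M).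

Lemma norm_h_sqr v : norm_h h v ^+ 2 = h ^+ 2 * dot v v.
Proof. by rewrite sqr_sqrtr // mulr_ge0 ?sqr_ge0 //; exact: dot_ge0. Qed.

Lemma norm_inf_leP v a : 0 <= a -> (norm_inf v <= a) <-> (forall i j, `|v i j| <= a).
Proof.
move=> a0; split=> [va i j|va].
  apply: le_trans va; apply: (@le_trans _ _ (\big[Num.max/0]_(j < M) `|v i j|)).
    exact: (le_bigmax_cond _ (fun j => `|v i j|)).
  exact: (le_bigmax_cond _ (fun i => \big[Num.max/0]_(j < M) `|v i j|)).
by apply/bigmax_leP; split=> // i _; apply/bigmax_leP; split=> // j _.
Qed.

Lemma norm_inf_ge0 v : 0 <= norm_inf v.
Proof. exact: bigmax_ge_id. Qed.

Lemma feasible_convex vt v w t : 0 <= t <= 1 ->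
  feasible h delta vt v -> feasible h delta vt w ->
  feasible h delta vt (v + t *: (w - v)).
Proof.
move=> /andP[t0 t1] [vd vm] [wd wm].
have d0 : 0 <= 1 - delta by apply: le_trans (norm_inf_ge0 v) vd.
split; last first.
  rewrite -vm !inner_hE !dotE; move: wm; rewrite -vm !inner_hE => h1.
  by rewrite mulrDr mulrCA mulrBr h1 subrr mulr0 addr0.
apply/norm_inf_leP => // i j.
have /norm_inf_leP - /(_ d0 i j) v1 := vd; have /norm_inf_leP - /(_ d0 i j) w1 := wd.
rewrite !mxE (_ : _ + _ = (1 - t) * v i j + t * w i j); last by ring.
apply: (le_trans (ler_normD _ _)); rewrite !normrM (ger0_norm t0) ger0_norm ?subr_ge0 //.
have t1' : 0 <= 1 - t by rewrite subr_ge0.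
have := ler_wpM2l t0 w1; have := ler_wpM2l t1' v1; lra.
Qed.

(** Minimality of [v] along the segment to [w] gives <v - vt, w - v> >= 0: the angle at [v] is
    obtuse. Expanding |(v - vt) + (w - v)|^2 then gives the bound. *)
Lemma projection_nonexpansive vt v w : is_projection h delta vt v ->
  feasible h delta vt w -> dot (v - w) (v - w) <= dot (vt - w) (vt - w).
Proof.
move=> [vf vmin] wf; have h2 : 0 < h ^+ 2 by rewrite exprn_gt0.
pose a := dot (v - vt) (w - v); pose b := dot (w - v) (w - v).
have key t : 0 <= t <= 1 -> 0 <= 2 * t * a + t ^+ 2 * b.
  move=> t01; have := vmin _ (feasible_convex t01 vf wf).
  rewrite !norm_h_sqr !(mulrCA _ (h ^+ 2)) ler_pM2l // ler_pM2l ?invr_gt0 //.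
  have -> : v + t *: (w - v) - vt = (v - vt) + t *: (w - v) by rewrite addrAC.
  rewrite /a /b; move: (v - vt) (w - v) => x z.
  have -> : dot (x + t *: z) (x + t *: z) = dot x x + (2 * t * dot x z + t ^+ 2 * dot z z).
    by rewrite !dotE (dotC z x); ring.
  by rewrite lerDl.
have b0 : 0 <= b by exact: dot_ge0.
have a0 : 0 <= a.
  rewrite leNgt; apply/negP => a0.
  (* For a < 0 this choice gives 2 t a + t^2 b = t a (1 + t) < 0; the denominator b - a keeps t <= 1
     and also covers b = 0. *)
  pose t := - a / (b - a).
  have ba : 0 < b - a by lra.
  have t01 : 0 <= t <= 1.
    by rewrite /t divr_ge0 ?ler_pdivrMr ?mul1r //=; lra.
  have := key t t01; have -> : 2 * t * a + t ^+ 2 * b = - t * (2 * - a - t * b) by ring.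
  have t0 : 0 < t by rewrite divr_gt0 // oppr_gt0.
  rewrite mulNr oppr_ge0 leNgt mulr_gt0 //.
  have : t * (b - a) = - a by rewrite /t divfK // gt_eqF.
  by move=> tE; nra.
have -> : vt - w = - ((v - vt) + (w - v)).
  by apply/matrixP => i j; rewrite !mxE; ring.
have -> : v - w = - (w - v) by rewrite opprB.
move: a0; rewrite /a; move: (v - vt) (w - v) => x z a0.
by rewrite !dotE (dotC z x); have := dot_ge0 x; lra.
Qed.

(* [u] itself need not have the mass of [vt]: it may be shifted by a constant,
   because constants are orthogonal to all differences of grid functions of equal mass. *)
Lemma projection_nonexpansive_shift vt v u c : is_projection h delta vt v ->
  feasible h delta vt (u + const_mx c) -> dot (v - u) (v - u) <= dot (vt - u) (vt - u).
Proof.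
move=> vp uf; have := projection_nonexpansive vp uf.
have [[_ vm] _] := vp; have [_ um] := uf.
have h2 : h ^+ 2 != 0 by rewrite expf_neq0 // gt_eqF.
set w := u + _; pose k : 'M[R]_M := const_mx c.
have shiftE x : inner_h h x (const_mx 1) = inner_h h vt (const_mx 1) ->
    dot (x - u) (x - u) = dot (x - w) (x - w) + dot k k.
  rewrite -um !inner_hE => /(mulfI h2) xm.
  have -> : x - u = (x - w) + k by rewrite /w opprD addrA subrK.
  have x0 : dot (x - w) k = 0.
    have -> : k = c *: const_mx 1 by apply/matrixP => i j; rewrite !mxE mulr1.
    by rewrite dotZr dotBl xm -/w subrr mulr0.
  by move: (x - w) x0 => z z0; rewrite !dotE (dotC k) z0; ring.
by rewrite !shiftE // lerD2r.
Qed.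

End Projection.

(** The recursion is assumed only below [m], as steps exist only up to the final time. In the
    induction the newest term tau q is enlarged by the exponential that the older ones carry. *)
Lemma gronwall_discrete {R : realType} (a : nat -> R) (K tau q : R) (m : nat) :
  0 <= K -> 0 <= tau -> 0 <= q ->
  (forall n, (n < m)%N -> a n.+1 <= expR (K * tau) * (a n + tau * q)) ->
  forall n, (n <= m)%N -> a n <= expR (K * (n%:R * tau)) * (a 0%N + n%:R * tau * q).
Proof.
move=> K0 t0 q0 step; elim=> [|n IH] nm; first by rewrite !mul0r mulr0 expR0 mul1r addr0.
apply: le_trans (step n nm) _; have IHn := IH (ltnW nm).
have -> : K * (n.+1%:R * tau) = K * tau + K * (n%:R * tau) by rewrite -natr1; ring.
rewrite expRD -mulrA ler_wpM2l ?expR_ge0 //.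
have -> : a 0%N + n.+1%:R * tau * q = a 0%N + n%:R * tau * q + tau * q.
  by rewrite -natr1; ring.
rewrite mulrDr lerD // -[leLHS]mul1r ler_wpM2r ?mulr_ge0 //.
by rewrite -expR0 ler_expR !mulr_ge0.
Qed.

(** * Finite differences and interpolation in one variable *)

Section Differences.
Context {R : realType}.
Implicit Types (f : R -> R) (a h x C : R).

Lemma mvt_le f (df : R -> R) a b C : a <= b ->
  (forall x, a < x < b -> is_derive x 1 f (df x)) ->
  {within `[a, b], continuous f} ->
  (forall x, a < x < b -> `|df x| <= C) -> `|f b - f a| <= C * (b - a).
Proof.
rewrite le_eqVlt => /orP[/eqP ->|ab] fd fc dfC; first by rewrite !subrr mulr0 normr0.
have fd' x : x \in `]a, b[ -> is_derive x 1 f (df x) by rewrite in_itv /=; exact: fd.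
have [c] := MVT ab fd' fc.
rewrite in_itv /= => cab ->; rewrite normrM (gtr0_norm (x := b - a)) ?subr_gt0 //.
by rewrite ler_wpM2r ?subr_ge0 ?(ltW ab) // dfC.
Qed.

Lemma mvt_le_derive f (df : R -> R) a b C : a <= b ->
  (forall x, is_derive x 1 f (df x)) ->
  (forall x, a <= x <= b -> `|df x| <= C) -> `|f b - f a| <= C * (b - a).
Proof.
move=> ab fd dfC; have fc : {within `[a, b], continuous f}.
  by apply: continuous_subspaceT => z; exact: is_derive_continuous (fd z).
apply: (mvt_le ab (fun x _ => fd x) fc) => x /andP[ax xb].
by apply: dfC; rewrite !ltW.
Qed.

Lemma is_derive_translate f a x l : is_derive (a + x) 1 f l ->
  is_derive x 1 (fun s => f (a + s)) l.
Proof.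
move=> fl; have := is_derive_comp (g := fun s => a + s) fl (is_derive_add (is_derive_const a x) (is_derive_id x 1)).
by rewrite add0r mulr1.
Qed.

Lemma is_derive_reflect f a x l : is_derive (a - x) 1 f l ->
  is_derive x 1 (fun s => f (a - s)) (- l).
Proof.
move=> fl; have := is_derive_comp (g := fun s => a - s) fl (is_derive_sub (is_derive_const a x) (is_derive_id x 1)).
by rewrite sub0r mulrN1.
Qed.

(** f(a + s) + f(a - s) has the derivative f1(a + s) - f1(a - s), at most 2 C h by the mean value
    theorem, which is then applied once more. *)
Lemma second_difference_le f f1 f2 a h C : 0 <= h ->
  (forall x, is_derive x 1 f (f1 x)) -> (forall x, is_derive x 1 f1 (f2 x)) ->
  (forall x, `|x - a| <= h -> `|f2 x| <= C) ->
  `|f (a + h) + f (a - h) - 2 * f a| <= 2 * C * h ^+ 2.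
Proof.
move=> h0 fd f1d f2C.
have C0 : 0 <= C by apply: le_trans (f2C a _); rewrite // subrr normr0.
have d1 x : is_derive x 1 (fun s => f (a + s) + f (a - s)) (f1 (a + x) - f1 (a - x)).
  by apply: is_derive_add; [exact: is_derive_translate|exact: is_derive_reflect].
have b1 x : 0 <= x <= h -> `|f1 (a + x) - f1 (a - x)| <= C * (2 * h).
  move=> /andP[x0 xh]; have axx : a - x <= a + x by lra.
  have := mvt_le_derive axx f1d (C := C).
  have -> : a + x - (a - x) = 2 * x by ring.
  move=> /(_ _) h1; apply: (@le_trans _ _ (C * (2 * x))); last by rewrite ler_wpM2l //; lra.
  by apply: h1 => y yx; apply: f2C; rewrite ler_norml; lra.
have := mvt_le_derive h0 d1 b1; rewrite addr0 !subr0.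
have -> : f (a + h) + f (a - h) - (f a + f a) = f (a + h) + f (a - h) - 2 * f a by ring.
by have -> : C * (2 * h) * h = 2 * C * h ^+ 2 by ring.
Qed.

(** The second derivative [p2] of the even remainder [p] is a second difference of [f2], hence of
    order s^2. Since [p1] vanishes at 0, two mean value steps lead back to [p]. *)
Lemma second_difference_taylor f f1 f2 f3 f4 a h C : 0 <= h ->
  (forall x, is_derive x 1 f (f1 x)) -> (forall x, is_derive x 1 f1 (f2 x)) ->
  (forall x, is_derive x 1 f2 (f3 x)) -> (forall x, is_derive x 1 f3 (f4 x)) ->
  (forall x, `|x - a| <= h -> `|f4 x| <= C) ->
  `|f (a + h) + f (a - h) - 2 * f a - h ^+ 2 * f2 a| <= 2 * C * h ^+ 4.
Proof.
move=> h0 fd f1d f2d f3d f4C.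
have C0 : 0 <= C by apply: le_trans (f4C a _); rewrite // subrr normr0.
pose p s := f (a + s) + f (a - s) - s ^+ 2 * f2 a.
pose p1 s := f1 (a + s) - f1 (a - s) - 2 * s * f2 a.
pose p2 s := f2 (a + s) + f2 (a - s) - 2 * f2 a.
have pd x : is_derive x 1 p (p1 x).
  have hx : is_derive x 1 (fun s => s ^+ 2 * f2 a) (2 * x * f2 a).
    have -> : (fun s : R => s ^+ 2 * f2 a) = (fun s : R => f2 a * (s * s)).
      by apply/funext => s; ring.
    have hs := is_derive_scale (f2 a) (is_derive_mul (is_derive_id x 1) (is_derive_id x 1)).
    by apply: (is_derive_eq hs); rewrite /=; ring.
  apply: is_derive_sub hx.
  by apply: is_derive_add; [exact: is_derive_translate|exact: is_derive_reflect].
have p1d x : is_derive x 1 p1 (p2 x).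
  have hx : is_derive x 1 (fun s => 2 * s * f2 a) (2 * f2 a).
    have := is_derive_scale (2 * f2 a) (is_derive_id x 1); rewrite mulr1.
    by congr is_derive; apply/funext => s; rewrite mulrAC.
  apply: is_derive_sub hx; have := is_derive_sub (is_derive_translate (f1d (a + x)))
    (is_derive_reflect (f1d (a - x))).
  by rewrite opprK.
have b2 x : 0 <= x <= h -> `|p2 x| <= 2 * C * h ^+ 2.
  move=> /andP[x0 xh]; apply: (@le_trans _ _ (2 * C * x ^+ 2)).
    apply: (second_difference_le x0 f2d f3d) => y yx; apply: f4C.
    exact: le_trans yx xh.
  by rewrite ler_wpM2l ?mulr_ge0 // lerXn2r ?nnegrE.
have b1 x : 0 <= x <= h -> `|p1 x| <= 2 * C * h ^+ 3.
  move=> /andP[x0 xh]; have := @mvt_le_derive p1 p2 0 x (2 * C * h ^+ 2) x0 p1d.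
  have -> : p1 x - p1 0 = p1 x by rewrite /p1 addr0 subr0; ring.
  rewrite subr0 => h1; apply: (@le_trans _ _ (2 * C * h ^+ 2 * x)).
    apply: h1 => y /andP[y0 yx]; apply: b2; rewrite y0 /=; exact: le_trans yx xh.
  by rewrite [in leRHS]exprSr !mulrA ler_wpM2l // !mulr_ge0 // exprn_ge0.
have := mvt_le_derive h0 pd b1.
have -> : p h - p 0 = f (a + h) + f (a - h) - 2 * f a - h ^+ 2 * f2 a.
  by rewrite /p addr0 subr0; ring.
by have -> : 2 * C * h ^+ 3 * (h - 0) = 2 * C * h ^+ 4 by ring.
Qed.

(** Mean value points b in (a, a + tau) and c in (a, a + s) turn the error into s (f1 b - f1 c), and
    a third application bounds f1 b - f1 c by C tau. All derivatives are taken at interior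
    points. *)
Lemma linear_interpolation_le f f1 f2 (a tau s C : R) : 0 < s < tau ->
  (forall x, a < x < a + tau -> is_derive x 1 f (f1 x)) ->
  (forall x, a < x < a + tau -> is_derive x 1 f1 (f2 x)) ->
  {within `[a, a + tau], continuous f} ->
  (forall x, a < x < a + tau -> `|f2 x| <= C) ->
  `|(1 - s / tau) * f a + s / tau * f (a + tau) - f (a + s)| <= C * tau ^+ 2.
Proof.
move=> /andP[s0 st] fd f1d fc f2C.
have tau0 : 0 < tau by exact: lt_trans st.
have at2 : a < a + tau by lra.
have C0 : 0 <= C by apply: le_trans (normr_ge0 _) (f2C (a + s) _); lra.
have fd' x : x \in `]a, a + tau[ -> is_derive x 1 f (f1 x).
  by rewrite in_itv /=; exact: fd.
have [b] := MVT at2 fd' fc.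
have as2 : a < a + s by lra.
have fc' : {within `[a, a + s], continuous f}.
  by apply: continuous_subspaceW fc; apply: subset_itvl; rewrite bnd_simp; lra.
have fd'' x : x \in `]a, a + s[ -> is_derive x 1 f (f1 x).
  by rewrite in_itv /= => xs; apply: fd; lra.
have [c] := MVT as2 fd'' fc'.
rewrite !in_itv /= => cas fs bat ft.
have -> : (1 - s / tau) * f a + s / tau * f (a + tau) - f (a + s) = s * (f1 b - f1 c).
  have -> : f (a + tau) = f a + f1 b * tau by rewrite -(subrK (f a) (f _)) ft; ring.
  have -> : f (a + s) = f a + f1 c * s by rewrite -(subrK (f a) (f (a + s))) fs; ring.
  by field; rewrite gt_eqF.
have h1 x y : a < x <= y -> y < a + tau -> `|f1 y - f1 x| <= C * tau.
  move=> /andP[ax xy] yt; apply: (@le_trans _ _ (C * (y - x))); last first.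
    by rewrite ler_wpM2l //; lra.
  have f1c : {within `[x, y], continuous f1}.
    apply: derivable_within_continuous => z; rewrite in_itv /= => zxy.
    by have zz : a < z < a + tau by [lra]; have [] := f1d z zz.
  have f1d' z : x < z < y -> is_derive z 1 f1 (f2 z) by move=> zxy; apply: f1d; lra.
  by apply: (mvt_le xy f1d' f1c) => z zxy; apply: f2C; lra.
rewrite normrM gtr0_norm // expr2 mulrCA ler_pM ?(ltW s0) ?(ltW st) //.
have [bc|cb] := leP b c; first by rewrite distrC; apply: h1; lra.
by apply: h1; lra.
Qed.

End Differences.

(** * Smooth space-time functions *)

(* [K] bounds the spatial box on which the derivatives are required to be bounded;
   [t]-derivatives are only taken in the open interval (0,T). *)
Section SmoothFunctions.
Context {R : realType}.
Variables (T K : R).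
Implicit Types (v w : R -> R -> R -> R) (r : nat) (t x y c m : R).

Definition bounded_cont v :=
  (exists C, forall t x y, 0 <= t <= T -> `|x| <= K -> `|y| <= K -> `|v t x y| <= C) /\
  (forall x y, {within `[0, T], continuous (fun t => v t x y)}).

Definition deriv_x v w := forall t x y, 0 <= t <= T ->
  is_derive x 1 (fun x' => v t x' y) (w t x y).
Definition deriv_y v w := forall t x y, 0 <= t <= T ->
  is_derive y 1 (fun y' => v t x y') (w t x y).
Definition deriv_t v w := forall t x y, 0 < t < T ->
  is_derive t 1 (fun s => v s x y) (w t x y).

(** Recursive, with the first derivatives as witnesses, so that products, inverses and logarithms
    are handled by induction with first-order rules only, without higher Leibniz or chain rules. *)
Fixpoint smooth r v : Prop := bounded_cont v /\
  if r is r'.+1 then exists vx vy vt,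
    [/\ smooth r' vx, smooth r' vy & smooth r' vt] /\
    [/\ deriv_x v vx, deriv_y v vy & deriv_t v vt]
  else True.

Lemma smooth_bounded r v : smooth r v -> bounded_cont v.
Proof. by case: r => [|r] []. Qed.

Lemma smoothW r v : smooth r.+1 v -> smooth r v.
Proof.
elim: r v => [|r IH] v; first by move=> [? _].
move=> [bv [vx [vy [vt [[sx sy st] d]]]]]; split=> //.
by exists vx, vy, vt; split=> //; split; exact: IH.
Qed.

Lemma bounded_cont_add v w : bounded_cont v -> bounded_cont w ->
  bounded_cont (fun t x y => v t x y + w t x y).
Proof.
move=> [[C vC] vc] [[D wD] wc]; split.
  exists (C + D) => t x y t0 x0 y0; apply: le_trans (ler_normD _ _) _.
  by rewrite lerD ?vC ?wD.
by move=> x y s; apply: cvgD; [exact: vc|exact: wc].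
Qed.

Lemma bounded_cont_mul v w : bounded_cont v -> bounded_cont w ->
  bounded_cont (fun t x y => v t x y * w t x y).
Proof.
move=> [[C vC] vc] [[D wD] wc]; split.
  exists (C * D) => t x y t0 x0 y0; rewrite normrM.
  by rewrite ler_pM ?vC ?wD.
by move=> x y s; apply: cvgM; [exact: vc|exact: wc].
Qed.

Lemma bounded_cont_const c : bounded_cont (fun _ _ _ => c).
Proof. by split=> [|x y s]; [by exists (Num.norm c) | exact: cvg_cst]. Qed.

Lemma smooth_const r c : smooth r (fun _ _ _ => c).
Proof.
elim: r c => [|r IH] c; split=> //; try exact: bounded_cont_const.
exists (fun _ _ _ => 0), (fun _ _ _ => 0), (fun _ _ _ => 0); split.
  by split; exact: IH.
by split=> t x y _; exact: is_derive_const.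
Qed.

Lemma smooth_add r v w : smooth r v -> smooth r w ->
  smooth r (fun t x y => v t x y + w t x y).
Proof.
elim: r v w => [|r IH] v w; first by move=> [bv _] [bw _]; split=> //; exact: bounded_cont_add.
move=> [bv [vx [vy [vt [[sx sy st] [dx dy dt]]]]]].
move=> [bw [wx [wy [wt [[sx' sy' st'] [dx' dy' dt']]]]]].
split; first exact: bounded_cont_add.
exists (fun t x y => vx t x y + wx t x y), (fun t x y => vy t x y + wy t x y),
  (fun t x y => vt t x y + wt t x y); split; first by split; exact: IH.
by split=> t x y t0; apply: is_derive_add; auto.
Qed.

Lemma smooth_mul r v w : smooth r v -> smooth r w ->
  smooth r (fun t x y => v t x y * w t x y).
Proof.
elim: r v w => [|r IH] v w; first by move=> [bv _] [bw _]; split=> //; exact: bounded_cont_mul.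
move=> sv sw; have sv' := smoothW sv; have sw' := smoothW sw; move: sv sw.
move=> [bv [vx [vy [vt [[sx sy st] [dx dy dt]]]]]].
move=> [bw [wx [wy [wt [[sx' sy' st'] [dx' dy' dt']]]]]].
split; first exact: bounded_cont_mul.
exists (fun t x y => v t x y * wx t x y + w t x y * vx t x y),
  (fun t x y => v t x y * wy t x y + w t x y * vy t x y),
  (fun t x y => v t x y * wt t x y + w t x y * vt t x y); split.
  by split; apply: smooth_add; exact: IH.
split=> t x y t0.
- exact: (is_derive_mul (dx _ _ _ t0) (dx' _ _ _ t0)).
- exact: (is_derive_mul (dy _ _ _ t0) (dy' _ _ _ t0)).
- exact: (is_derive_mul (dt _ _ _ t0) (dt' _ _ _ t0)).
Qed.

Lemma smooth_scale r c v : smooth r v -> smooth r (fun t x y => c * v t x y).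
Proof. by move=> sv; apply: smooth_mul sv; exact: smooth_const. Qed.

Lemma smooth_opp r v : smooth r v -> smooth r (fun t x y => - v t x y).
Proof.
move=> /(smooth_scale (-1)); congr smooth; apply/funext => t; apply/funext => x.
by apply/funext => y; rewrite mulN1r.
Qed.

Lemma bounded_cont_comp v (g : R -> R) :
  (forall t x y, 0 <= t <= T -> {for v t x y, continuous g}) ->
  (exists C, forall t x y, 0 <= t <= T -> `|x| <= K -> `|y| <= K -> `|g (v t x y)| <= C) ->
  bounded_cont v -> bounded_cont (fun t x y => g (v t x y)).
Proof.
move=> gc gC [_ vc]; split=> // x y; apply/subspace_continuousP => t t0.
have /subspace_continuousP/(_ t t0) := vc x y.
move=> vt0; apply: continuous_cvg vt0; apply: gc.
by move: t0; rewrite /= in_itv.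
Qed.

Lemma is_derive_inv (f : R -> R) (x a : R) : f x != 0 -> is_derive x 1 f a ->
  is_derive x 1 (fun s => (f s)^-1) (- ((f x)^-1 * (f x)^-1 * a)).
Proof.
move=> fx fa; apply: (is_derive_eq (is_deriveV fx fa)).
by rewrite /GRing.scale /= mulNr expr2 invfM.
Qed.

(** The derivatives of 1/v are -(1/v)(1/v) v', products of functions that are smooth of the lower
    order by induction. *)
Lemma smooth_inv r v m : 0 < m -> (forall t x y, 0 <= t <= T -> m <= v t x y) ->
  smooth r v -> smooth r (fun t x y => (v t x y)^-1).
Proof.
move=> m0 vm; have v0 t x y : 0 <= t <= T -> v t x y != 0.
  by move=> t0; rewrite gt_eqF //; apply: lt_le_trans m0 (vm _ _ _ t0).
have bv : bounded_cont v -> bounded_cont (fun t x y => (v t x y)^-1).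
  apply: (@bounded_cont_comp _ GRing.inv) => [t x y t0|].
    by apply: inv_continuous; exact: v0.
  exists m^-1 => t x y t0 _ _; have vm' := vm _ x y t0.
  have v1 : 0 < v t x y by apply: lt_le_trans vm'.
  by rewrite normfV gtr0_norm // lef_pV2 ?posrE.
elim: r => [|r IH] sv; first by split=> //; apply: bv; exact: smooth_bounded sv.
have sv' := IH (smoothW sv).
move: sv => [bv' [vx [vy [vt [[sx sy st] [dx dy dt]]]]]]; split; first exact: bv.
pose d w t x y := - ((v t x y)^-1 * (v t x y)^-1 * w t x y).
have sd w : smooth r w -> smooth r (d w).
  by move=> sw; apply: smooth_opp; apply: smooth_mul => //; exact: smooth_mul.
exists (d vx), (d vy), (d vt); split; first by split; exact: sd.
split=> t x y t0.
- by apply: (is_derive_inv (v0 _ _ _ t0)); exact: dx.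
- by apply: (is_derive_inv (v0 _ _ _ t0)); exact: dy.
- have t0' : 0 <= t <= T by case/andP: t0 => *; rewrite !ltW.
  apply: (is_derive_inv (f := fun s => v s x y) (v0 _ _ _ t0')); exact: dt.
Qed.

(** One derivative turns ln v into v'/v, which [smooth_inv] covers. The lower bound [m] will come
    from the separation property. *)
Lemma smooth_ln r v m : 0 < m -> (forall t x y, 0 <= t <= T -> m <= v t x y) ->
  smooth r v -> smooth r (fun t x y => ln (v t x y)).
Proof.
move=> m0 vm; have v0 t x y : 0 <= t <= T -> 0 < v t x y.
  by move=> t0; apply: lt_le_trans m0 (vm _ _ _ t0).
have bv : bounded_cont v -> bounded_cont (fun t x y => ln (v t x y)).
  move=> bv; have [[C vC] _] := bv; move: bv.
  apply: (@bounded_cont_comp _ (@ln R)) => [t x y t0|].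
    by apply: continuous_ln; exact: v0.
  exists (`|ln m| + `|ln C|) => t x y t0 x0 y0.
  have v1 := v0 _ x y t0; have := vC _ _ _ t0 x0 y0; rewrite gtr0_norm // => v2.
  have l1 : ln m <= ln (v t x y) by rewrite ler_ln ?posrE ?vm.
  have l2 : ln (v t x y) <= ln C.
    by rewrite ler_ln ?posrE //; apply: lt_le_trans v2.
  have := ler_norm (ln C); have := lerNnormlW (lexx `|ln m|).
  have := normr_ge0 (ln C); have := normr_ge0 (ln m).
  by rewrite ler_norml => *; apply/andP; split; lra.
case: r => [|r] sv; first by split=> //; apply: bv; exact: smooth_bounded sv.
have si := smooth_inv m0 vm (smoothW sv).
move: sv => [bv' [vx [vy [vt [[sx sy st] [dx dy dt]]]]]]; split; first exact: bv.
exists (fun t x y => (v t x y)^-1 * vx t x y), (fun t x y => (v t x y)^-1 * vy t x y),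
  (fun t x y => (v t x y)^-1 * vt t x y); split; first by split; exact: smooth_mul.
split=> t x y t0.
- by apply: is_derive_comp (dx _ _ _ t0); apply: is_derive1_ln; exact: v0.
- by apply: is_derive_comp (dy _ _ _ t0); apply: is_derive1_ln; exact: v0.
- have t0' : 0 <= t <= T by case/andP: t0 => *; rewrite !ltW.
  apply: (is_derive_comp (f := @ln R) (g := fun s => v s x y)) (dt _ _ _ t0).
  by apply: is_derive1_ln; exact: v0.
Qed.

End SmoothFunctions.

(** * The five-point Laplacian *)

Section DiscreteLaplacian.
Context {R : realType}.
Implicit Types (w : R -> R -> R) (h x y C L : R).

(** The five-point Laplacian acting on functions of real variables, so that derivatives in x, y and
    t pass through it. *)
Definition Dh h w x y : R :=
  h ^- 2 * (w (x + h) y + w (x - h) y + w x (y - h) + w x (y + h) - 4 * w x y).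

Lemma grid_coord_le L (M : nat) (i : 'I_M) : 0 < L -> `|i.+1%:R * (L / M%:R)| <= L.
Proof.
move=> L0; have M0 : 0 < M%:R :> R by rewrite ltr0n (leq_trans _ (ltn_ord i)).
rewrite ger0_norm; last by rewrite mulr_ge0 // divr_ge0 // ltW.
by rewrite mulrA ler_pdivrMr // mulrC ler_pM2l // ler_nat.
Qed.

Lemma periodic2_Dh L h w : periodic2 L w -> periodic2 L (Dh h w).
Proof.
move=> wL x y; rewrite /Dh; split.
  rewrite !(addrAC x L).
  by rewrite !(proj1 (wL _ _)).
by rewrite !(addrAC y L) !(proj2 (wL _ _)).
Qed.

Lemma lap_h_Ih L (M : nat) w : (0 < M)%N -> periodic2 L w ->
  lap_h (L / M%:R) (Ih M (L / M%:R) w) = Ih M (L / M%:R) (Dh (L / M%:R) w).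
Proof.
move=> M0 wL; set h := L / M%:R.
have Mh : M%:R * h = L by rewrite /h mulrC divfK // pnatr_eq0 -lt0n.
have nxt (i : 'I_M) (f : R -> R) : (forall x, f (x + L) = f x) ->
    f ((ordS i).+1%:R * h) = f (i.+1%:R * h + h).
  (* From the last node the shift wraps to the node h, one period before L + h. *)
  move=> fL; rewrite /ordS /=; have := ltn_ord i; rewrite leq_eqVlt => /orP[/eqP iM|iM].
    by rewrite iM modnn Mh -[LHS]fL mul1r addrC.
  by rewrite modn_small //; congr f; rewrite -[i.+2%:R]natr1 mulrDl mul1r.
have prv (i : 'I_M) (f : R -> R) : (forall x, f (x + L) = f x) ->
    f ((ord_pred i).+1%:R * h) = f (i.+1%:R * h - h).
  move=> fL; case: i => [[|i] iM]; rewrite /ord_pred /=.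
    (* The predecessor of the first node is the node L, one period after h - h = 0. *)
    rewrite add0n modn_small ?ltn_predL // prednK // Mh -[RHS]fL; congr f; ring.
  rewrite modnDr modn_small ?(ltnW iM) //; congr f.
  by rewrite -[i.+2%:R]natr1 mulrDl mul1r addrK.
apply/matrixP => i j; rewrite !mxE /Dh.
rewrite (nxt i (fun x => w x _)) => [|x]; last by have [] := wL x (j.+1%:R * h).
rewrite (prv i (fun x => w x _)) => [|x]; last by have [] := wL x (j.+1%:R * h).
rewrite (nxt j (fun y => w _ y)) => [|x]; last by have [] := wL (i.+1%:R * h) x.
by rewrite (prv j (fun y => w _ y)) => [|x]; last by have [] := wL (i.+1%:R * h) x.
Qed.

Lemma Dh_le w wx wxx wy wyy h x y C : 0 < h ->
  (forall x y, is_derive x 1 (fun x' => w x' y) (wx x y)) ->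
  (forall x y, is_derive x 1 (fun x' => wx x' y) (wxx x y)) ->
  (forall x y, is_derive y 1 (fun y' => w x y') (wy x y)) ->
  (forall x y, is_derive y 1 (fun y' => wy x y') (wyy x y)) ->
  (forall x', `|x' - x| <= h -> `|wxx x' y| <= C) ->
  (forall y', `|y' - y| <= h -> `|wyy x y'| <= C) ->
  `|Dh h w x y| <= 4 * C.
Proof.
move=> h0 dx dxx dy dyy bx byy; have h2 : 0 < h ^+ 2 by rewrite exprn_gt0.
have := second_difference_le (ltW h0) (dx^~ y) (dxx^~ y) bx.
have := second_difference_le (ltW h0) (dy x) (dyy x) byy.
rewrite /Dh => hy hx; rewrite normrM normfV (gtr0_norm h2) mulrC ler_pdivrMr //.
have -> : w (x + h) y + w (x - h) y + w x (y - h) + w x (y + h) - 4 * w x y =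
  (w (x + h) y + w (x - h) y - 2 * w x y) + (w x (y + h) + w x (y - h) - 2 * w x y) by ring.
by apply: (le_trans (ler_normD _ _)); lra.
Qed.

Lemma Dh_taylor w wx wxx wxxx wxxxx wy wyy wyyy wyyyy h x y C : 0 < h ->
  (forall x y, is_derive x 1 (fun x' => w x' y) (wx x y)) ->
  (forall x y, is_derive x 1 (fun x' => wx x' y) (wxx x y)) ->
  (forall x y, is_derive x 1 (fun x' => wxx x' y) (wxxx x y)) ->
  (forall x y, is_derive x 1 (fun x' => wxxx x' y) (wxxxx x y)) ->
  (forall x y, is_derive y 1 (fun y' => w x y') (wy x y)) ->
  (forall x y, is_derive y 1 (fun y' => wy x y') (wyy x y)) ->
  (forall x y, is_derive y 1 (fun y' => wyy x y') (wyyy x y)) ->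
  (forall x y, is_derive y 1 (fun y' => wyyy x y') (wyyyy x y)) ->
  (forall x', `|x' - x| <= h -> `|wxxxx x' y| <= C) ->
  (forall y', `|y' - y| <= h -> `|wyyyy x y'| <= C) ->
  `|Dh h w x y - (wxx x y + wyy x y)| <= 4 * C * h ^+ 2.
Proof.
move=> h0 d1 d2 d3 d4 e1 e2 e3 e4 bx byy; have h2 : 0 < h ^+ 2 by rewrite exprn_gt0.
have := second_difference_taylor (ltW h0) (d1^~ y) (d2^~ y) (d3^~ y) (d4^~ y) bx.
have := second_difference_taylor (ltW h0) (e1 x) (e2 x) (e3 x) (e4 x) byy.
move=> hy hx.
have -> : Dh h w x y - (wxx x y + wyy x y) = h ^- 2 *
  ((w (x + h) y + w (x - h) y - 2 * w x y - h ^+ 2 * wxx x y) +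
   (w x (y + h) + w x (y - h) - 2 * w x y - h ^+ 2 * wyy x y)).
  by rewrite /Dh; field; rewrite gt_eqF.
rewrite normrM normfV (gtr0_norm h2) mulrC ler_pdivrMr //.
apply: (le_trans (ler_normD _ _)).
have -> : 4 * C * h ^+ 2 * h ^+ 2 = 2 * C * h ^+ 4 + 2 * C * h ^+ 4 by ring.
exact: lerD.
Qed.

Lemma is_derive_Dh_x h w wx x y :
  (forall x y, is_derive x 1 (fun x' => w x' y) (wx x y)) ->
  is_derive x 1 (fun x' => Dh h w x' y) (Dh h wx x y).
Proof.
move=> dx; have dp a b : is_derive x 1 (fun x' => w (x' + a) b) (wx (x + a) b).
  have := is_derive_comp (f := w^~ b) (g := fun x' => x' + a) (dx (x + a) b) (is_derive_add (is_derive_id x 1) (is_derive_const a x)).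
  by rewrite addr0 mulr1.
have d4 := is_derive_add (is_derive_add (is_derive_add (dp h y) (dp (- h) y))
  (dx x (y - h))) (dx x (y + h)).
have d5 := is_derive_scale (h ^- 2) (is_derive_sub d4 (is_derive_scale 4 (dx x y))).
exact: d5.
Qed.

Lemma Dh_transpose h w x y : Dh h w x y = Dh h (fun x y => w y x) y x.
Proof. by rewrite /Dh; ring. Qed.

Lemma is_derive_Dh_y h w wy x y :
  (forall x y, is_derive y 1 (fun y' => w x y') (wy x y)) ->
  is_derive y 1 (fun y' => Dh h w x y') (Dh h wy x y).
Proof.
move=> dy; rewrite Dh_transpose; under eq_fun do rewrite Dh_transpose.
by apply: (@is_derive_Dh_x h (fun x y => w y x) (fun x y => wy y x)) => *; exact: dy.
Qed.

Lemma is_derive_Dh_t h (v : R -> R -> R -> R) vt (t x y : R) :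
  (forall x y, is_derive t 1 (fun s => v s x y) (vt x y)) ->
  is_derive t 1 (fun s => Dh h (v s) x y) (Dh h vt x y).
Proof.
move=> d; have d4 := is_derive_add (is_derive_add (is_derive_add (d (x + h) y)
  (d (x - h) y)) (d x (y - h))) (d x (y + h)).
have d5 := is_derive_scale (h ^- 2) (is_derive_sub d4 (is_derive_scale 4 (d x y))).
exact: d5.
Qed.

End DiscreteLaplacian.

(** * Consistency of the discretization *)

Section Consistency.
Context {R : realType}.
Variables (T K : R).
Implicit Types (v w : R -> R -> R -> R) (h t x y a s tau C : R).

Lemma near_le h x x' : `|x| + h <= K -> `|x' - x| <= h -> `|x'| <= K.
Proof.
move=> xK xx; rewrite -(subrK x x'); apply: le_trans (ler_normD _ _) _; lra.
Qed.

Lemma le_box h x : 0 < h -> `|x| + h <= K -> `|x| <= K.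
Proof. by move=> h0 xK; lra. Qed.

Lemma bounded_cont2 v w : bounded_cont T K v -> bounded_cont T K w ->
  exists2 C, 0 <= C & forall t x y, 0 <= t <= T -> `|x| <= K -> `|y| <= K ->
    `|v t x y| <= C /\ `|w t x y| <= C.
Proof.
move=> [[C vC] _] [[D wD] _]; exists (`|C| + `|D|); first exact: addr_ge0.
move=> t x y t0 x0 y0; have := vC _ _ _ t0 x0 y0; have := wD _ _ _ t0 x0 y0.
have := ler_norm C; have := ler_norm D; have := normr_ge0 C; have := normr_ge0 D.
by move=> *; split; lra.
Qed.

Lemma Dh_bounded v : smooth T K 2 v -> exists2 C, 0 <= C & forall h t x y, 0 < h ->
  0 <= t <= T -> `|x| + h <= K -> `|y| + h <= K -> `|Dh h (v t) x y| <= C.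
Proof.
move=> [_ [vx [vy [vt [[sx sy _] [dx dy _]]]]]].
move: sx => [_ [vxx [? [? [[[bx _] _ _] [dxx _ _]]]]]].
move: sy => [_ [? [vyy [? [[_ [byy _] _] [_ dyy _]]]]]].
have [C C0 bC] := bounded_cont2 bx byy.
exists (4 * C) => [|h t x y h0 t0 xh yh]; first exact: mulr_ge0.
apply: (Dh_le h0 (fun x y => dx t x y t0) (fun x y => dxx t x y t0)
  (fun x y => dy t x y t0) (fun x y => dyy t x y t0)).
  by move=> x' xx; have [] := bC t x' y t0 (near_le xh xx) (le_box h0 yh).
by move=> y' yy; have [] := bC t x y' t0 (le_box h0 xh) (near_le yh yy).
Qed.

Lemma Dh_consistent v vx vxx vxxx vxxxx vy vyy vyyy vyyyy :
  deriv_x T v vx -> deriv_x T vx vxx -> deriv_x T vxx vxxx -> deriv_x T vxxx vxxxx ->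
  deriv_y T v vy -> deriv_y T vy vyy -> deriv_y T vyy vyyy -> deriv_y T vyyy vyyyy ->
  bounded_cont T K vxxxx -> bounded_cont T K vyyyy ->
  exists2 C, 0 <= C & forall h t x y, 0 < h ->
    0 <= t <= T -> `|x| + h <= K -> `|y| + h <= K ->
    `|Dh h (v t) x y - (vxx t x y + vyy t x y)| <= C * h ^+ 2.
Proof.
move=> d1 d2 d3 d4 e1 e2 e3 e4 bx byy; have [C C0 bC] := bounded_cont2 bx byy.
exists (4 * C) => [|h t x y h0 t0 xh yh]; first exact: mulr_ge0.
apply: (Dh_taylor h0 (fun x y => d1 t x y t0) (fun x y => d2 t x y t0)
  (fun x y => d3 t x y t0) (fun x y => d4 t x y t0) (fun x y => e1 t x y t0)
  (fun x y => e2 t x y t0) (fun x y => e3 t x y t0) (fun x y => e4 t x y t0)).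
  by move=> x' xx; have [] := bC t x' y t0 (near_le xh xx) (le_box h0 yh).
by move=> y' yy; have [] := bC t x y' t0 (le_box h0 xh) (near_le yh yy).
Qed.

Lemma Dh_consistent_smooth v : smooth T K 4 v -> exists vx vxx vy vyy,
  [/\ deriv_x T v vx, deriv_x T vx vxx, deriv_y T v vy, deriv_y T vy vyy &
  exists2 C, 0 <= C & forall h t x y, 0 < h ->
    0 <= t <= T -> `|x| + h <= K -> `|y| + h <= K ->
    `|Dh h (v t) x y - (vxx t x y + vyy t x y)| <= C * h ^+ 2].
Proof.
move=> [_ [vx [vy [_ [[sx sy _] [d1 e1 _]]]]]].
move: sx => [_ [vxx [_ [_ [[sx _ _] [d2 _ _]]]]]].
move: sx => [_ [vxxx [_ [_ [[sx _ _] [d3 _ _]]]]]].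
move: sx => [_ [vxxxx [_ [_ [[[sx _] _ _] [d4 _ _]]]]]].
move: sy => [_ [_ [vyy [_ [[_ sy _] [_ e2 _]]]]]].
move: sy => [_ [_ [vyyy [_ [[_ sy _] [_ e3 _]]]]]].
move: sy => [_ [_ [vyyyy [_ [[_ [sy _] _] [_ e4 _]]]]]].
exists vx, vxx, vy, vyy; split=> //.
exact: Dh_consistent d1 d2 d3 d4 e1 e2 e3 e4 sx sy.
Qed.

(** Two rates at once: linear interpolation between the nodes serves the corrector, freezing at the
    left node the predictor. *)
Lemma time_interpolation (f f1 f2 : R -> R) a s tau C :
  (forall t, 0 < t < T -> is_derive t 1 f (f1 t)) ->
  (forall t, 0 < t < T -> is_derive t 1 f1 (f2 t)) ->
  {within `[0, T], continuous f} ->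
  (forall t, 0 < t < T -> `|f1 t| <= C) -> (forall t, 0 < t < T -> `|f2 t| <= C) ->
  0 <= a -> 0 < s < tau -> a + tau <= T ->
  `|(1 - s / tau) * f a + s / tau * f (a + tau) - f (a + s)| <= C * tau ^+ 2 /\
  `|f a - f (a + s)| <= C * tau.
Proof.
move=> d1 d2 fc b1 b2 a0 stau aT; have [s0 st] := andP stau.
have sub t : a < t < a + tau -> 0 < t < T by move=> ?; lra.
have C0 : 0 <= C by apply: le_trans (normr_ge0 _) (b1 (a + s) _); lra.
split.
  apply: (linear_interpolation_le (f1 := f1) (f2 := f2)) => //.
  - by move=> t /sub; exact: d1.
  - by move=> t /sub; exact: d2.
  - by apply: continuous_subspaceW fc; apply: subset_itvScc; rewrite bnd_simp; lra.
  - by move=> t /sub; exact: b2.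
rewrite distrC; apply: (@le_trans _ _ (C * (a + s - a))).
  have as1 : a <= a + s by lra.
  have d1' t : a < t < a + s -> is_derive t 1 f (f1 t) by move=> ?; apply: d1; lra.
  have fc' : {within `[a, a + s], continuous f}.
    by apply: continuous_subspaceW fc; apply: subset_itvScc; rewrite bnd_simp; lra.
  by apply: (mvt_le as1 d1' fc') => t ?; apply: b1; lra.
by rewrite ler_wpM2l //; lra.
Qed.

Lemma interpolation v : smooth T K 2 v -> exists2 C, 0 <= C & forall a s tau x y,
  `|x| <= K -> `|y| <= K -> 0 <= a -> 0 < s < tau -> a + tau <= T ->
  `|(1 - s / tau) * v a x y + s / tau * v (a + tau) x y - v (a + s) x y| <= C * tau ^+ 2 /\
  `|v a x y - v (a + s) x y| <= C * tau.
Proof.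
move=> [[_ vc] [_ [_ [vt [[_ _ st] [_ _ dt]]]]]].
have bt := smooth_bounded (r := 1) st; move: st => [_ [_ [_ [vtt [[_ _ [btt _]] [_ _ dtt]]]]]].
have [C C0 bC] := bounded_cont2 bt btt; exists C => // a s tau x y xK yK a0 stau aT.
have cl t : 0 < t < T -> 0 <= t <= T by case/andP => *; rewrite !ltW.
have b1 t : 0 < t < T -> `|vt t x y| <= C by move=> /cl t0; have [] := bC t x y t0 xK yK.
have b2 t : 0 < t < T -> `|vtt t x y| <= C by move=> /cl t0; have [] := bC t x y t0 xK yK.
exact: (time_interpolation (fun t => dt t x y) (fun t => dtt t x y) (vc x y) b1 b2 a0 stau aT).
Qed.

Lemma continuous_Dh h v x y : bounded_cont T K v ->
  {within `[0, T], continuous (fun t => Dh h (v t) x y)}.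
Proof.
move=> [_ vc] t; rewrite /Dh; apply: cvgM; first exact: cvg_cst.
apply: cvgB; last by apply: cvgM; [exact: cvg_cst|exact: vc].
by do 3 (apply: cvgD; last exact: vc); exact: vc.
Qed.

(** The constant has to be uniform in h: [Dh] commutes with the time derivative, and [Dh] of the
    first two time derivatives is bounded by their second space derivatives. Two orders in time and
    two in space make 4. *)
Lemma Dh_interpolation v : smooth T K 4 v -> exists2 C, 0 <= C & forall h a s tau x y,
  0 < h -> `|x| + h <= K -> `|y| + h <= K -> 0 <= a -> 0 < s < tau -> a + tau <= T ->
  `|(1 - s / tau) * Dh h (v a) x y + s / tau * Dh h (v (a + tau)) x y
     - Dh h (v (a + s)) x y| <= C * tau ^+ 2 /\
  `|Dh h (v a) x y - Dh h (v (a + s)) x y| <= C * tau.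
Proof.
move=> sv; have vb := smooth_bounded sv; move: sv => [_ [_ [_ [vt [[_ _ st] [_ _ dt]]]]]].
have [C C0 bC] := Dh_bounded (smoothW (r := 2) st).
move: st => [_ [_ [_ [vtt [[_ _ stt] [_ _ dtt]]]]]]; have [D D0 bD] := Dh_bounded stt.
exists (C + D) => [|h a s tau x y h0 xh yh a0 stau aT]; first exact: addr_ge0.
have cl t : 0 < t < T -> 0 <= t <= T by case/andP => *; rewrite !ltW.
have d1 t : 0 < t < T -> is_derive t 1 (fun s => Dh h (v s) x y) (Dh h (vt t) x y).
  by move=> t0; exact: (is_derive_Dh_t h x y (fun x y => dt t x y t0)).
have d2 t : 0 < t < T -> is_derive t 1 (fun s => Dh h (vt s) x y) (Dh h (vtt t) x y).
  by move=> t0; exact: (is_derive_Dh_t h x y (fun x y => dtt t x y t0)).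
have b1 t : 0 < t < T -> `|Dh h (vt t) x y| <= C + D.
  by move=> /cl t0; apply: le_trans (bC h t x y h0 t0 xh yh) _; rewrite lerDl.
have b2 t : 0 < t < T -> `|Dh h (vtt t) x y| <= C + D.
  by move=> /cl t0; apply: le_trans (bD h t x y h0 t0 xh yh) _; rewrite lerDr.
exact: (time_interpolation d1 d2 (continuous_Dh vb) b1 b2 a0 stau aT).
Qed.

End Consistency.

Lemma order3_lt (r a b : nat) : (a + b + 3 <= r)%N ->
  [/\ (a + b < r)%N, (a.+2 + b < r)%N & (a + b.+2 < r)%N].
Proof. by move=> ?; split; lia. Qed.

(** * Bounds and consistency from jointly continuous derivatives *)

Section SmoothUpto.
Context {R : realType}.
Variables (T K : R) (r : nat) (D : nat -> nat -> nat -> R -> R -> R -> R).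
Hypothesis T0 : 0 < T.
Hypothesis Dc : forall c a b : nat, (c + a + b <= r)%N ->
  {within [set p : R * (R * R) | 0 <= p.1 <= T],
     continuous (fun p : R * (R * R) => D c a b p.1 p.2.1 p.2.2)}.
Hypothesis Dxy : forall c a b : nat, (c + a + b < r)%N ->
  forall t x y : R, 0 <= t <= T ->
  is_derive x (1 : R) (fun x' : R => D c a b t x' y) (D c a.+1 b t x y) /\
  is_derive y (1 : R) (fun y' : R => D c a b t x y') (D c a b.+1 t x y).
Hypothesis Dt : forall c a b : nat, (c + a + b < r)%N ->
  forall t x y : R, 0 < t < T ->
  is_derive t (1 : R) (fun s : R => D c a b s x y) (D c.+1 a b t x y).

(** The bound is the maximum of |D c a b| over the compact set [0,T] x [-K,K]^2; continuity in t is
    the joint continuity restricted to a line. *)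
Lemma smooth_upto_bounded_cont c a b : (c + a + b <= r)%N -> bounded_cont T K (D c a b).
Proof.
move=> cab; have Dcab := Dc cab; split; last first.
  move=> x y; apply/subspace_continuousP => t t0.
  have t0' : 0 <= t <= T by move: t0; rewrite /= in_itv.
  have /subspace_continuousP/(_ (t, (x, y)) t0') H := Dcab.
  apply: cvg_trans H => B /= H.
  have pc : (fun s : R => (s, (x, y))) s @[s --> t] --> (t, (x, y)).
    exact: (cvg_pair cvg_id (cvg_cst _)).
  have H2 : nbhs t ((fun s => (s, (x, y))) @^-1`
      [set p | 0 <= p.1 <= T -> B (D c a b p.1 p.2.1 p.2.2)]) by exact: pc H.
  suff : nbhs t [set s | `[0, T]%classic s -> B (D c a b s x y)] by [].
  by apply: (filterS _ H2) => s Hs sI; apply: Hs; move: sI; rewrite /= in_itv.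
(* For K < 0 no point satisfies |x| <= K, and the box, empty then, has no maximum. *)
have [K0|K0] := ltP K 0; first by exists 0 => t x y _ xK; have := normr_ge0 x; lra.
pose f (p : R * (R * R)) := D c a b p.1 p.2.1 p.2.2.
pose A : set (R * (R * R)) := `[0, T]%classic `*` (`[-K, K]%classic `*` `[-K, K]%classic).
have Acpt : compact A.
  by apply: compact_setX; [|apply: compact_setX]; exact: segment_compact.
have A0 : A !=set0.
  by exists (0, (0, 0)); rewrite /A /=; rewrite !in_itv /= !lexx (ltW T0) oppr_le0 K0.
have fc : {within A, continuous (fun p => `|f p|)}.
  have fA : {within A, continuous f}.
    by apply: continuous_subspaceW Dcab => -[t [x y]] [/=]; rewrite in_itv.
  by move=> p; apply: cvg_norm; exact: fA.
have [p _ pm] := compact_EVT_max A0 Acpt fc.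
exists `|f p| => t x y t0 x0 y0; apply: (pm (t, (x, y))); rewrite inE.
by split; [|split]; rewrite /= in_itv /= -?ler_norml.
Qed.

Lemma smooth_upto_smooth n c a b : (c + a + b + n <= r)%N -> smooth T K n (D c a b).
Proof.
elim: n c a b => [|n IH] c a b; rewrite ?addn0 ?addnS => cab.
  by split=> //; exact: smooth_upto_bounded_cont.
split; first by apply: smooth_upto_bounded_cont; apply: leq_trans (ltnW cab); rewrite leq_addr.
have cab' : (c + a + b < r)%N by apply: leq_trans cab; rewrite ltnS leq_addr.
exists (D c a.+1 b), (D c a b.+1), (D c.+1 a b); split.
  by split; apply: IH; rewrite ?addSn ?addnS ?addSn.
split=> t x y t0; [| |exact: Dt].
- by have [] := Dxy cab' x y t0.
- by have [] := Dxy cab' x y t0.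
Qed.

Local Notation D0 a b := (D 0%N a%N b%N).

(** With [rho1 a b] the truncation error of [Dh] at d_x^a d_y^b u, the total error is [Dh] of
    [rho1 0 0] plus [rho1 2 0] plus [rho1 0 2]. Differentiation of [rho1] only shifts its indices,
    so the second derivatives of [rho1 0 0] are again [rho1 2 0] and [rho1 0 2], of size h^2, and
    [Dh_le] bounds the first term without losing powers of h. This uses sixth derivatives of u; the
    margin 2 h is the reach of the double stencil. *)
Lemma biharmonic_consistent : (6 <= r)%N ->
  exists2 C, 0 <= C & forall h t x y : R, 0 < h -> 0 <= t <= T ->
    `|x| + 2 * h <= K -> `|y| + 2 * h <= K ->
  `|Dh h (Dh h (D0 0 0 t)) x y - (D0 4 0 t x y + 2 * D0 2 2 t x y + D0 0 4 t x y)|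
    <= C * h ^+ 2.
Proof.
move=> r6.
have dx a b : (a + b < r)%N -> deriv_x T (D0 a b) (D0 a.+1 b).
  by move=> ab t x y t0; have [] := @Dxy 0 a b ab t x y t0.
have dy a b : (a + b < r)%N -> deriv_y T (D0 a b) (D0 a b.+1).
  by move=> ab t x y t0; have [] := @Dxy 0 a b ab t x y t0.
have bd a b : (a + b <= r)%N -> bounded_cont T K (D0 a b).
  exact: (@smooth_upto_bounded_cont 0 a b).
have cons a b : (a + b + 4 <= r)%N -> exists2 C, 0 <= C & forall h t x y : R, 0 < h ->
    0 <= t <= T -> `|x| + h <= K -> `|y| + h <= K ->
    `|Dh h (D0 a b t) x y - (D0 a.+2 b t x y + D0 a b.+2 t x y)| <= C * h ^+ 2.
  move=> ab; apply: (@Dh_consistent _ _ _ _ (D0 a.+1 b) _ (D0 a.+3 b) (D0 a.+4 b)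
    (D0 a b.+1) _ (D0 a b.+3) (D0 a b.+4)); try (apply: dx); try (apply: dy);
    try apply: bd; lia.
have [C1 C10 b1] := cons 2%N 0%N r6; have [C2 C20 b2] := cons 0%N 2%N r6.
exists (4 * (C1 + C2) + C1 + C2) => [|h t x y h0 t0 xh yh]; first lra.
pose rho1 a b x y := Dh h (D0 a b t) x y - (D0 a.+2 b t x y + D0 a b.+2 t x y).
have rx a b (x' y' : R) : (a + b + 3 <= r)%N ->
    is_derive x' 1 (fun x'' : R => rho1 a b x'' y') (rho1 a.+1 b x' y').
  move=> /order3_lt[e1 e2 e3].
  exact: is_derive_sub (@is_derive_Dh_x _ h _ _ x' y' (fun x y => dx _ _ e1 t x y t0))
    (is_derive_add (dx _ _ e2 t x' y' t0) (dx _ _ e3 t x' y' t0)).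
have ry a b (x' y' : R) : (a + b + 3 <= r)%N ->
    is_derive y' 1 (fun y'' : R => rho1 a b x' y'') (rho1 a b.+1 x' y').
  move=> /order3_lt[e1 e2 e3].
  exact: is_derive_sub (@is_derive_Dh_y _ h _ _ x' y' (fun x y => dy _ _ e1 t x y t0))
    (is_derive_add (dy _ _ e2 t x' y' t0) (dy _ _ e3 t x' y' t0)).
have h2 : 0 <= h ^+ 2 by exact: sqr_ge0.
have rhoh : `|Dh h (rho1 0 0)%N x y| <= 4 * ((C1 + C2) * h ^+ 2).
  have lt3 a b : (a + b <= 3)%N -> (a + b + 3 <= r)%N.
    by move=> ab; apply: leq_trans r6; rewrite -(leq_add2r 3) in ab.
  apply: (Dh_le h0 (fun x y => rx 0%N 0%N x y (lt3 0%N 0%N isT))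
    (fun x y => rx 1%N 0%N x y (lt3 1%N 0%N isT)) (fun x y => ry 0%N 0%N x y (lt3 0%N 0%N isT))
    (fun x y => ry 0%N 1%N x y (lt3 0%N 1%N isT))).
    move=> x' xx; have x'h : `|x'| + h <= K.
      by rewrite -(subrK x x'); have := ler_normD (x' - x) x; lra.
    have yh'' : `|y| + h <= K by lra.
    by apply: le_trans (b1 h t x' y h0 t0 x'h yh'') _; rewrite ler_wpM2r // lerDl.
  move=> y' yy; have y'h : `|y'| + h <= K.
    by rewrite -(subrK y y'); have := ler_normD (y' - y) y; lra.
  have xh'' : `|x| + h <= K by lra.
  by apply: le_trans (b2 h t x y' h0 t0 xh'' y'h) _; rewrite ler_wpM2r // lerDr.
have xh' : `|x| + h <= K by lra.
have yh' : `|y| + h <= K by lra.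
have := b1 h t x y h0 t0 xh' yh'; have := b2 h t x y h0 t0 xh' yh'.
have -> : Dh h (Dh h (D0 0 0 t)) x y - (D0 4 0 t x y + 2 * D0 2 2 t x y + D0 0 4 t x y) =
  Dh h (rho1 0 0)%N x y + ((Dh h (D0 2 0 t) x y - (D0 4 0 t x y + D0 2 2 t x y)) +
   (Dh h (D0 0 2 t) x y - (D0 2 2 t x y + D0 0 4 t x y))).
  by rewrite /rho1 /Dh; ring.
move=> c2 c1; apply: (le_trans (ler_normD _ _)).
apply: (@le_trans _ _ (4 * ((C1 + C2) * h ^+ 2) + (C1 * h ^+ 2 + C2 * h ^+ 2))).
  by rewrite lerD //; apply: (le_trans (ler_normD _ _)); exact: lerD.
lra.
Qed.

End SmoothUpto.

(** * The equation without the potential of the nonlocal term *)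

Section ExpandedEquation.
Context {R : realType}.
Implicit Types (x y z t s : R).

Lemma derive1n2 (f f1 f2 : R -> R) x :
  (forall x, is_derive x 1 f (f1 x)) -> (forall x, is_derive x 1 f1 (f2 x)) ->
  derive1n 2 f x = f2 x.
Proof.
move=> d1 d2; have e1 : derive1 f = f1.
  by apply/funext => z; rewrite derive1E; exact: derive_val.
by rewrite /derive1n /= e1 derive1E; exact: derive_val.
Qed.

Lemma pderiv10E (w wx : R -> R -> R) : (forall x y, is_derive x 1 (fun x' => w x' y) (wx x y)) ->
  pderiv 1 0 w = wx.
Proof.
move=> d; apply/funext => x; apply/funext => y.
by rewrite /pderiv /derive1n /= derive1E; exact: derive_val.
Qed.

Lemma pderiv01E (w wy : R -> R -> R) : (forall x y, is_derive y 1 (fun y' => w x y') (wy x y)) ->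
  pderiv 0 1 w = wy.
Proof.
move=> d; apply/funext => x; apply/funext => y.
by rewrite /pderiv /derive1n /= derive1E; exact: derive_val.
Qed.

Lemma laplacianE (w wx wxx wy wyy : R -> R -> R) :
  (forall x y, is_derive x 1 (fun x' => w x' y) (wx x y)) ->
  (forall x y, is_derive x 1 (fun x' => wx x' y) (wxx x y)) ->
  (forall x y, is_derive y 1 (fun y' => w x y') (wy x y)) ->
  (forall x y, is_derive y 1 (fun y' => wy x y') (wyy x y)) ->
  laplacian w = (fun x y => wxx x y + wyy x y).
Proof.
move=> dx dxx dy dyy; apply/funext => x; apply/funext => y.
congr (_ + _); rewrite /pderiv.
  exact: (derive1n2 x (dx^~ y) (dxx^~ y)).
exact: (derive1n2 y (dy x) (dyy x)).
Qed.

Lemma classC2_derive (w : R -> R -> R) : classC2 w ->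
  [/\ forall x y, is_derive x 1 (fun x' => w x' y) (pderiv 1 0 w x y),
      forall x y, is_derive x 1 (fun x' => pderiv 1 0 w x' y) (pderiv 2 0 w x y),
      forall x y, is_derive y 1 (fun y' => w x y') (pderiv 0 1 w x y) &
      forall x y, is_derive y 1 (fun y' => pderiv 0 1 w x y') (pderiv 0 2 w x y)].
Proof.
move=> wC2; have d a b : (a + b < 2)%N -> forall x y,
    derivable (fun x' : R => pderiv a b w x' y) x 1 /\
    derivable (fun y' : R => pderiv a b w x y') y 1.
  by move=> ab; have [_ ] := wC2 a b (ltnW ab); apply.
have dd (f : R -> R) z : derivable f z 1 -> is_derive z 1 f (derive1 f z).
  by move=> fd; rewrite derive1E; exact: derivableP.
split=> x y; rewrite /pderiv /derive1n /=; apply: dd.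
- exact: (proj1 (d 0%N 0%N isT x y)).
- exact: (proj1 (d 1%N 0%N isT x y)).
- exact: (proj2 (d 0%N 0%N isT x y)).
- exact: (proj2 (d 0%N 1%N isT x y)).
Qed.

Variables (L T eps sigma theta theta_c : R) (u : R -> R -> R -> R).
Variables (r : nat) (D : nat -> nat -> nat -> R -> R -> R -> R).
Hypothesis r4 : (4 <= r)%N.
Hypothesis uD : forall t x y : R, 0 <= t <= T -> D 0%N 0%N 0%N t x y = u t x y.
Hypothesis Dxy : forall c a b : nat, (c + a + b < r)%N ->
  forall t x y : R, 0 <= t <= T ->
  is_derive x (1 : R) (fun x' : R => D c a b t x' y) (D c a.+1 b t x y) /\
  is_derive y (1 : R) (fun y' : R => D c a b t x y') (D c a b.+1 t x y).
Hypothesis uCH : is_nonlocal_CH_solution L T eps sigma theta theta_c u.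
Local Notation D0 a b := (D 0%N a%N b%N).

(** The derivative of the logarithmic Flory-Huggins energy density, that is, the local part of the
    chemical potential. *)
Definition entropy_potential (z : R) : R :=
  theta / 2 * ln (1 + z) - theta / 2 * ln (1 - z) - theta_c * z.

(** The Laplacian of mu is taken term by term, and that of psi is replaced by its defining equation,
    so that no inverse Laplacian remains to be discretized. Both mixed fourth derivatives are
    [D0 2 2], as [D] records only the numbers of derivatives. *)
Lemma CH_expanded (P Px Pxx Py Pyy : R -> R -> R -> R) :
  (forall t x y, P t x y = entropy_potential (D0 0 0 t x y)) ->
  deriv_x T P Px -> deriv_x T Px Pxx -> deriv_y T P Py -> deriv_y T Py Pyy ->
  forall t x y, 0 < t < T -> is_derive t 1 (fun s => u s x y)
   (Pxx t x y + Pyy t x y - eps ^+ 2 * (D0 4 0 t x y + 2 * D0 2 2 t x y + D0 0 4 t x y)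
    - sigma * (u t x y - mean L (u t))).
Proof.
move=> PE dPx dPxx dPy dPyy t x y t0.
have t0' : 0 <= t <= T by case/andP: t0 => *; rewrite !ltW.
have [_ /(_ t t0) [psi [[_ psiC2 _ psiE] _ ut]]] := uCH.
apply: (is_derive_eq (ut x y)).
have dx a b z z' : (a + b < r)%N -> is_derive z 1 (fun x' : R => D0 a b t x' z') (D0 a.+1 b t z z').
  by move=> ab; have [] := @Dxy 0 a b ab t z z' t0'.
have dy a b z z' : (a + b < r)%N -> is_derive z' 1 (fun y' : R => D0 a b t z y') (D0 a b.+1 t z z').
  by move=> ab; have [] := @Dxy 0 a b ab t z z' t0'.
have utE : u t = D0 0 0 t.
  by apply/funext => x'; apply/funext => y'; rewrite uD.
have lapu : laplacian (u t) = (fun x y => D0 2 0 t x y + D0 0 2 t x y).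
  by rewrite utE; apply: (@laplacianE _ (D0 1 0 t) _ (D0 0 1 t)) => x' y';
     [apply: dx|apply: dx|apply: dy|apply: dy]; lia.
have [sx sxx sy syy] := classC2_derive psiC2.
set mu := chem_potential _ _ _ _ _ _.
have muE : mu = (fun x y => P t x y - eps ^+ 2 * (D0 2 0 t x y + D0 0 2 t x y) + sigma * psi x y).
  by apply/funext => x'; apply/funext => y'; rewrite /mu /chem_potential lapu utE PE.
have add4 (f1 f2 f3 f4 : R -> R) z a1 a2 a3 a4 : is_derive z 1 f1 a1 -> is_derive z 1 f2 a2 ->
    is_derive z 1 f3 a3 -> is_derive z 1 f4 a4 ->
    is_derive z 1 (fun z => f1 z - eps ^+ 2 * (f2 z + f3 z) + sigma * f4 z)
      (a1 - eps ^+ 2 * (a2 + a3) + sigma * a4).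
  move=> d1 d2 d3 d4; exact: is_derive_add (is_derive_sub d1
    (is_derive_scale _ (is_derive_add d2 d3))) (is_derive_scale _ d4).
have lt1 a b : (a + b <= 3)%N -> (a + b < r)%N by move=> ab; apply: leq_ltn_trans ab _.
have mux z z' := add4 _ _ _ _ z _ _ _ _ (dPx t z z' t0') (dx _ _ z z' (lt1 2%N 0%N isT))
  (dx _ _ z z' (lt1 0%N 2%N isT)) (sx z z').
have muxx z z' := add4 _ _ _ _ z _ _ _ _ (dPxx t z z' t0') (dx _ _ z z' (lt1 3%N 0%N isT))
  (dx _ _ z z' (lt1 1%N 2%N isT)) (sxx z z').
have muy z z' := add4 _ _ _ _ z' _ _ _ _ (dPy t z z' t0') (dy _ _ z z' (lt1 2%N 0%N isT))
  (dy _ _ z z' (lt1 0%N 2%N isT)) (sy z z').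
have muyy z z' := add4 _ _ _ _ z' _ _ _ _ (dPyy t z z' t0') (dy _ _ z z' (lt1 2%N 1%N isT))
  (dy _ _ z z' (lt1 0%N 3%N isT)) (syy z z').
have -> : laplacian mu x y =
    (Pxx t x y - eps ^+ 2 * (D0 4 0 t x y + D0 2 2 t x y) + sigma * pderiv 2 0 psi x y) +
    (Pyy t x y - eps ^+ 2 * (D0 2 2 t x y + D0 0 4 t x y) + sigma * pderiv 0 2 psi x y).
  by rewrite muE (laplacianE mux muxx muy muyy).
have /eqP := psiE x y; rewrite eqr_oppLR => /eqP; rewrite /laplacian => pE.
have -> : u t x y - mean L (u t) = - (pderiv 2 0 psi x y + pderiv 0 2 psi x y).
  by rewrite pE opprK.
move: (pderiv 2 0 psi x y) (pderiv 0 2 psi x y) (D0 4 0 t x y) (D0 2 2 t x y) (D0 0 4 t x y).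
move: (Pxx t x y) (Pyy t x y) => *; ring.
Qed.

End ExpandedEquation.

(** * Integrals over one period *)

Section IntervalIntegral.
Context {R : realType}.
Variable L : R.
Hypothesis L0 : 0 < L.
Implicit Types (f g : R -> R) (a b c x y : R).

Definition int1 (f : R -> R) : R := \int[lebesgue_measure]_(x in `[0, L]) f x.

Lemma integrable_itv f a b : continuous f ->
  lebesgue_measure.-integrable `[a, b] (EFin \o f).
Proof.
move=> fc; apply: continuous_compact_integrable; first exact: segment_compact.
exact: continuous_subspaceT.
Qed.

Lemma int1_ge0 f : (forall x, 0 <= x <= L -> 0 <= f x) -> 0 <= int1 f.
Proof. by move=> f0; apply: Rintegral_ge0 => x; rewrite /= in_itv; exact: f0. Qed.

Lemma int1_le f g : continuous f -> continuous g ->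
  (forall x, 0 <= x <= L -> f x <= g x) -> int1 f <= int1 g.
Proof.
move=> fc gc fg; apply: le_Rintegral => //; exact: integrable_itv.
Qed.

Lemma int1_cst c : int1 (fun=> c) = c * L.
Proof.
rewrite /int1 Rintegral_cst //= lebesgue_measure_itv /= lte_fin L0.
by rewrite -EFinB /= subr0.
Qed.

Lemma int1_add f g : continuous f -> continuous g -> int1 (fun x => f x + g x) = int1 f + int1 g.
Proof. by move=> fc gc; apply: RintegralD => //; exact: integrable_itv. Qed.

Lemma int1_sub f g : continuous f -> continuous g -> int1 (fun x => f x - g x) = int1 f - int1 g.
Proof. by move=> fc gc; apply: RintegralB => //; exact: integrable_itv. Qed.

Lemma int1_scale c f : continuous f -> int1 (fun x => c * f x) = c * int1 f.
Proof. by move=> fc; apply: RintegralZl => //; exact: integrable_itv. Qed.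

(** After the fundamental theorem on [a, b], the nonnegative majorant is integrated over all of
    [0, L], which makes the bound independent of a and b. *)
Lemma int1_FTC_le f (df g : R -> R) a b : 0 <= a -> a <= b -> b <= L ->
  (forall x, is_derive x 1 f (df x)) -> continuous df -> continuous g ->
  (forall x, 0 <= g x) -> (forall x, df x <= g x) -> f b - f a <= int1 g.
Proof.
move=> a0; rewrite le_eqVlt => /orP[/eqP ->|ab] bL fd dfc gc g0 dfg.
  by rewrite subrr; apply: int1_ge0.
have fc : continuous f by move=> x; exact: is_derive_continuous (fd x).
have dfc' : {within `[a, b], continuous df} by exact: continuous_subspaceT.
have fLR : derivable_oo_LRcontinuous f a b.
  split; first by move=> x _; have [] := fd x.
    exact: cvg_at_right_filter (fc a).
  exact: cvg_at_left_filter (fc b).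
have f' : {in `]a, b[, derive1 f =1 df}.
  by move=> x _; rewrite derive1E; exact: derive_val.
have FTC := continuous_FTC2 ab dfc' fLR f'.
have -> : f b - f a = \int[lebesgue_measure]_(x in `[a, b]) df x.
  by rewrite /Rintegral FTC -EFinB.
apply: (@le_trans _ _ (\int[lebesgue_measure]_(x in `[a, b]) g x)).
  by apply: le_Rintegral => //; exact: integrable_itv.
rewrite /int1 /Rintegral; apply: fine_le.
- exact: integrable_fin_num (integrable_itv _ _ gc).
- exact: integrable_fin_num (integrable_itv _ _ gc).
apply: ge0_subset_integral => //.
- by have /integrableP[] := @integrable_itv g 0 L gc.
- by move=> x _; rewrite lee_fin.
- by apply: subset_itvScc; rewrite bnd_simp.
Qed.

(** Compare f(x)^2 with its minimum f(c)^2 over [0, L]. The minimum is at most the average of f^2,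
    which gives L^-1; the difference is bounded by the integral of |2 f f'| <= f^2 + f'^2, which
    gives 1. *)
Lemma sobolev_1d f (df : R -> R) x : (forall x, is_derive x 1 f (df x)) ->
  continuous df -> 0 <= x <= L ->
  f x ^+ 2 <= (L^-1 + 1) * int1 (fun x => f x ^+ 2 + df x ^+ 2).
Proof.
move=> fd dfc /andP[x0 xL].
have fc : continuous f by move=> z; exact: is_derive_continuous (fd z).
have sqc (g : R -> R) : continuous g -> continuous (fun z => g z ^+ 2).
  move=> gc z; have -> : (fun z => g z ^+ 2) = (fun z => g z * g z).
    by apply/funext => s; rewrite expr2.
  by apply: cvgM; exact: gc.
pose g z := f z ^+ 2 + df z ^+ 2.
have gc : continuous g by move=> z; apply: cvgD; exact: sqc.
have g0 z : 0 <= g z by rewrite addr_ge0 ?sqr_ge0.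
have f2d (z : R) : is_derive z 1 (fun z : R => f z ^+ 2) (2 * (f z * df z)).
  have := is_derive_mul (fd z) (fd z).
  have -> : (fun s => f s * f s) = (fun z => f z ^+ 2) by apply/funext => s; rewrite expr2.
  by move=> h1; apply: (is_derive_eq h1); ring.
have dc : continuous (fun z => 2 * (f z * df z)).
  by move=> z; apply: cvgM; [exact: cvg_cst|apply: cvgM; [exact: fc|exact: dfc]].
have le1 a b : 0 <= a -> a <= b -> b <= L -> f b ^+ 2 - f a ^+ 2 <= int1 g.
  move=> a0 ab bL; apply: (int1_FTC_le a0 ab bL f2d dc gc g0) => z.
  by rewrite /g; have := sqr_ge0 (f z - df z); rewrite sqrrB; lra.
have le2 a b : 0 <= a -> a <= b -> b <= L -> f a ^+ 2 - f b ^+ 2 <= int1 g.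
  move=> a0 ab bL; have n1 z := is_derive_opp (f2d z).
  have n2 : continuous (fun z => - (2 * (f z * df z))) by move=> z; apply: cvgN; exact: dc.
  have n3 z : - (2 * (f z * df z)) <= g z.
    by rewrite /g; have := sqr_ge0 (f z + df z); rewrite sqrrD; lra.
  by have := int1_FTC_le a0 ab bL n1 n2 gc g0 n3; rewrite opprK addrC.
have [||c] := @EVT_min R (fun z => f z ^+ 2) 0 L.
- exact: ltW.
- by apply: continuous_subspaceT; exact: sqc.
rewrite in_itv /= => /andP[c0 cL] cmin.
have cI : f c ^+ 2 * L <= int1 g.
  rewrite -int1_cst; apply: int1_le => //; first by move=> z; exact: cvg_cst.
  move=> z zL; apply: (@le_trans _ _ (f z ^+ 2)); first by apply: cmin; rewrite in_itv.
  by rewrite lerDl sqr_ge0.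
have xc : f x ^+ 2 - f c ^+ 2 <= int1 g.
  by have [cx|xc] := leP c x; [exact: le1|apply: le2 => //; exact: ltW].
have : f c ^+ 2 <= L^-1 * int1 g by rewrite mulrC ler_pdivlMr.
by rewrite -/g mulrDl mul1r; lra.
Qed.

Definition cont2 (w : R -> R -> R) := continuous (fun p : R * R => w p.1 p.2).

Lemma cont2_y w x : cont2 w -> continuous (w x).
Proof.
move=> wc y; apply: (@continuous_comp _ _ _ (fun y => (x, y)) (fun p => w p.1 p.2)).
  exact: (cvg_pair (cvg_cst _) cvg_id).
exact: wc.
Qed.

Lemma cont2_x w y : cont2 w -> continuous (w^~ y).
Proof.
move=> wc x; apply: (@continuous_comp _ _ _ (fun x => (x, y)) (fun p => w p.1 p.2)).
  exact: (cvg_pair cvg_id (cvg_cst _)).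
exact: wc.
Qed.

(** Dominated convergence, with the maximum of |w| over the compact set [x - 1, x + 1] x [0, L] as
    the dominating constant. *)
Lemma cont2_int1 w : cont2 w -> continuous (fun x => int1 (w x)).
Proof.
move=> wc x.
pose A : set (R * R) := `[x - 1, x + 1]%classic `*` `[0, L]%classic.
have Acpt : compact A by apply: compact_setX; exact: segment_compact.
have A0 : A !=set0.
  by exists (x, 0); rewrite /A /=; rewrite !in_itv /= lexx (ltW L0); split=> //; lra.
have fc : {within A, continuous (fun p => `|w p.1 p.2|)}.
  by apply: continuous_subspaceT => p; apply: cvg_norm; exact: wc.
have [p _ pm] := compact_EVT_max A0 Acpt fc.
set C := `|w p.1 p.2| in pm.
have := @continuity_under_integral R _ _ lebesgue_measure w `[0, L]%classic
  (measurable_itv _) (x - 1) (x + 1).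
move=> /(_ _ _ (fun=> C)); apply.
- by move=> z _; apply: integrable_itv; exact: cont2_y.
- by apply: aeW => y _ z _; exact: cont2_x.
- by apply: integrable_itv => z; exact: cvg_cst.
- move=> z zx; apply: aeW => y yL; apply: (pm (z, y)); rewrite inE; split=> //=.
  by move: zx; rewrite /= !in_itv /= => /andP[? ?]; rewrite !ltW.
- by rewrite inE /= in_itv /=; lra.
Qed.

End IntervalIntegral.

(** * Sobolev embedding on the square *)

Section SobolevEmbedding.
Context {R : realType}.
Variable L : R.
Hypothesis L0 : 0 < L.
Implicit Types (w : R -> R -> R) (a b c x y : R).

Lemma int2E w : int2 L w = int1 L (fun x => int1 L (w x)).
Proof. by []. Qed.

Lemma cont2_add w w' : cont2 w -> cont2 w' -> cont2 (fun x y => w x y + w' x y).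
Proof. by move=> wc wc' p; apply: cvgD; [exact: wc|exact: wc']. Qed.

Lemma cont2_sub w w' : cont2 w -> cont2 w' -> cont2 (fun x y => w x y - w' x y).
Proof. by move=> wc wc' p; apply: cvgB; [exact: wc|exact: wc']. Qed.

Lemma cont2_mul w w' : cont2 w -> cont2 w' -> cont2 (fun x y => w x y * w' x y).
Proof. by move=> wc wc' p; apply: cvgM; [exact: wc|exact: wc']. Qed.

Lemma cont2_cst c : cont2 (fun _ _ => c).
Proof. by move=> p; exact: cvg_cst. Qed.

Lemma cont2_sqr w : cont2 w -> cont2 (fun x y => w x y ^+ 2).
Proof.
move=> wc; have -> : (fun x y => w x y ^+ 2) = (fun x y => w x y * w x y).
  by apply/funext => x; apply/funext => y; rewrite expr2.
exact: cont2_mul.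
Qed.

Lemma int2_add w w' : cont2 w -> cont2 w' ->
  int2 L (fun x y => w x y + w' x y) = int2 L w + int2 L w'.
Proof.
move=> wc wc'; rewrite !int2E -int1_add; try exact: cont2_int1.
by congr int1; apply/funext => x; apply: int1_add; exact: cont2_y.
Qed.

Lemma int2_sub w w' : cont2 w -> cont2 w' ->
  int2 L (fun x y => w x y - w' x y) = int2 L w - int2 L w'.
Proof.
move=> wc wc'; rewrite !int2E -int1_sub; try exact: cont2_int1.
by congr int1; apply/funext => x; apply: int1_sub; exact: cont2_y.
Qed.

Lemma int2_ge0 w : (forall x y, 0 <= w x y) -> 0 <= int2 L w.
Proof. by move=> w0; apply: int1_ge0 => x _; exact: int1_ge0. Qed.

Lemma int2_le w c : cont2 w ->
  (forall x y, 0 <= x <= L -> 0 <= y <= L -> w x y <= c) -> int2 L w <= c * L ^+ 2.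
Proof.
move=> wc wle; rewrite int2E expr2 mulrA -(int1_cst L0) -(int1_cst L0).
apply: int1_le => [||x xL]; [exact: cont2_int1|by move=> z; exact: cvg_cst|].
rewrite int1_cst // -int1_cst //; apply: int1_le => [||y yL]; last exact: wle.
  exact: cont2_y.
by move=> z; exact: cvg_cst.
Qed.

Lemma mean_le w c : cont2 w ->
  (forall x y, 0 <= x <= L -> 0 <= y <= L -> `|w x y| <= c) -> `|mean L w| <= c.
Proof.
move=> wc wle; have L2 : 0 < L ^+ 2 by rewrite exprn_gt0.
rewrite /mean normrM normfV (gtr0_norm L2) ler_pdivrMr // ler_norml.
have h1 : int2 L w <= c * L ^+ 2.
  by apply: int2_le => // x y x0 y0; apply: le_trans (ler_norm _) (wle _ _ x0 y0).
have h2 : int2 L (fun x y => 0 - w x y) <= c * L ^+ 2.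
  apply: int2_le => [|x y x0 y0]; first by apply: cont2_sub => //; exact: cont2_cst.
  by rewrite sub0r; apply: le_trans (wle _ _ x0 y0); rewrite -normrN ler_norm.
move: h2; rewrite int2_sub //; last exact: cont2_cst.
have -> : int2 L (fun _ _ => 0 : R) = 0 by rewrite int2E !(int1_cst L0) !mul0r.
by rewrite sub0r => h2; apply/andP; split => //; lra.
Qed.

(* All orders of differentiation that enter the embedding of H^2 into L^oo. *)
Definition mixed_C1 w := exists wx wy wxy,
  [/\ [/\ cont2 w, cont2 wx, cont2 wy & cont2 wxy],
      (forall x y, is_derive x (1 : R) (fun x' => w x' y) (wx x y)),
      (forall x y, is_derive y (1 : R) (fun y' => w x y') (wy x y)),
      (forall x y, is_derive x (1 : R) (fun x' => wy x' y) (wxy x y))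
    & (forall x y, is_derive y (1 : R) (fun y' => wx x y') (wxy x y))].

Lemma sum_order2_ge (q : nat -> nat -> R) : (forall i j, 0 <= q i j) ->
  q 0%N 0%N + q 0%N 1%N + (q 1%N 0%N + q 1%N 1%N) <=
  \sum_(i < 3) \sum_(j < 3 | (i + j <= 2)%N) q i j.
Proof.
move=> q0; have := q0 0%N 2%N; have := q0 2%N 0%N.
have -> : \sum_(i < 3) \sum_(j < 3 | (i + j <= 2)%N) q i j =
  \sum_(i < 3) \sum_(j < 3) (if (i + j <= 2)%N then q i j else 0).
  by apply: eq_bigr => i _; rewrite big_mkcond.
by rewrite !big_ord_recl !big_ord0 /=; rewrite /bump /=; lra.
Qed.

(** The one-dimensional inequality in x, and then in y for both w and w_x inside the integral. Only
    w, w_x, w_y and w_xy appear, all of them part of the H^2 norm. *)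
Lemma sobolev_2d w x y : mixed_C1 w -> 0 <= x <= L -> 0 <= y <= L ->
  `|w x y| <= (L^-1 + 1) * sobolev_norm L 2 w.
Proof.
move=> [wx [wy [wxy [[c0 cx cy cxy] dx dy dyx dxy]]]] xL yL.
pose c := L^-1 + 1; have c_ge0 : 0 <= c by rewrite addr_ge0 ?invr_ge0 ?ltW.
pose S := int2 L (fun x y => w x y ^+ 2) + int2 L (fun x y => wy x y ^+ 2) +
  (int2 L (fun x y => wx x y ^+ 2) + int2 L (fun x y => wxy x y ^+ 2)).
have key : w x y ^+ 2 <= c * (c * S).
  have h1 := sobolev_1d L0 (dx^~ y) (cont2_x (y := y) cx) xL.
  apply: (le_trans h1); rewrite ler_wpM2l //.
  pose G z := c * (int1 L (fun y => w z y ^+ 2 + wy z y ^+ 2) +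
     int1 L (fun y => wx z y ^+ 2 + wxy z y ^+ 2)).
  have Gc1 : continuous (fun z => int1 L (fun y => w z y ^+ 2 + wy z y ^+ 2)).
    by apply: cont2_int1 => //; apply: cont2_add; exact: cont2_sqr.
  have Gc2 : continuous (fun z => int1 L (fun y => wx z y ^+ 2 + wxy z y ^+ 2)).
    by apply: cont2_int1 => //; apply: cont2_add; exact: cont2_sqr.
  apply: (@le_trans _ _ (int1 L G)).
    apply: int1_le => [||z zL].
    - exact: (cont2_x (y := y) (cont2_add (cont2_sqr c0) (cont2_sqr cx))).
    - by move=> z; apply: cvgM; [exact: cvg_cst|apply: cvgD; [exact: Gc1|exact: Gc2]].
    - have := sobolev_1d L0 (dy z) (cont2_y (x := z) cy) yL.
      have := sobolev_1d L0 (dxy z) (cont2_y (x := z) cxy) yL.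
      by rewrite /G mulrDr -/c; lra.
  rewrite /G int1_scale; last by move=> z; apply: cvgD; [exact: Gc1|exact: Gc2].
  rewrite ler_wpM2l // int1_add // -!int2E.
  by rewrite !int2_add //; apply: cont2_sqr.
have S0 : 0 <= S by rewrite !addr_ge0 //; apply: int2_ge0 => *; exact: sqr_ge0.
have SN : S <= sobolev_norm L 2 w ^+ 2.
  have p00 : pderiv 0 0 w = w by [].
  have p10 := pderiv10E dx; have p01 := pderiv01E dy.
  have p11 : pderiv 1 1 w = wxy.
    apply/funext => x'; apply/funext => y'.
    transitivity (pderiv 1 0 (pderiv 0 1 w) x' y'); first by [].
    by rewrite p01 (pderiv10E dyx).
  have n0 (a b : nat) : 0 <= int2 L (fun x y => pderiv a b w x y ^+ 2).
    by apply: int2_ge0 => *; exact: sqr_ge0.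
  rewrite sqr_sqrtr; last by apply: sumr_ge0 => i _; apply: sumr_ge0.
  by have := sum_order2_ge n0; rewrite p00 p01 p10 p11.
have SN0 : 0 <= sobolev_norm L 2 w by exact: sqrtr_ge0.
rewrite -(ler_pXn2r (n := 2)) ?nnegrE ?mulr_ge0 //.
rewrite real_normK ?num_real // exprMn (le_trans key) // -/c expr2 -mulrA.
by rewrite ler_wpM2l // ler_wpM2l.
Qed.

Lemma mixed_C1_add w w' : mixed_C1 w -> mixed_C1 w' -> mixed_C1 (fun x y => w x y + w' x y).
Proof.
move=> [wx [wy [wxy [[c0 cx cy cxy] dx dy dyx dxy]]]].
move=> [vx [vy [vxy [[e0 ex ey exy] fx fy fyx fxy]]]].
exists (fun x y => wx x y + vx x y), (fun x y => wy x y + vy x y),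
  (fun x y => wxy x y + vxy x y).
split; first by split; exact: cont2_add.
all: move=> x y.
- exact: is_derive_add (dx x y) (fx x y).
- exact: is_derive_add (dy x y) (fy x y).
- exact: is_derive_add (dyx x y) (fyx x y).
- exact: is_derive_add (dxy x y) (fxy x y).
Qed.

Lemma mixed_C1_scale c w : mixed_C1 w -> mixed_C1 (fun x y => c * w x y).
Proof.
move=> [wx [wy [wxy [[c0 cx cy cxy] dx dy dyx dxy]]]].
exists (fun x y => c * wx x y), (fun x y => c * wy x y), (fun x y => c * wxy x y).
split; first by split; apply: cont2_mul => //; exact: cont2_cst.
all: move=> x y.
- exact: is_derive_scale (dx x y).
- exact: is_derive_scale (dy x y).
- exact: is_derive_scale (dyx x y).
- exact: is_derive_scale (dxy x y).
Qed.

Lemma mixed_C1_sub w w' : mixed_C1 w -> mixed_C1 w' -> mixed_C1 (fun x y => w x y - w' x y).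
Proof.
move=> wn wn'; have := mixed_C1_add wn (mixed_C1_scale (-1) wn').
by congr mixed_C1; apply/funext => x; apply/funext => y; rewrite mulN1r.
Qed.

Lemma mixed_C1_sum n (F : 'I_n -> R -> R -> R) : (forall i, mixed_C1 (F i)) ->
  mixed_C1 (fun x y => \sum_(i < n) F i x y).
Proof.
elim: n F => [|n IH] F FC.
  have -> : (fun x y => \sum_(i < 0) F i x y) = (fun x y => 0).
    by apply/funext => x; apply/funext => y; rewrite big_ord0.
  exists (fun _ _ => 0), (fun _ _ => 0), (fun _ _ => 0).
  by split; [split; exact: cont2_cst|move=> x y; exact: is_derive_const..].
have -> : (fun x y => \sum_(i < n.+1) F i x y) =
    (fun x y => F ord0 x y + \sum_(i < n) F (lift ord0 i) x y).
  by apply/funext => x; apply/funext => y; rewrite big_ord_recl.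
by apply: mixed_C1_add => //; apply: IH.
Qed.

Lemma cont2_comp_linear (g : R -> R) a b : continuous g -> cont2 (fun x y => g (a * x + b * y)).
Proof.
move=> gc p; apply: (@continuous_comp _ _ _ (fun p : R * R => a * p.1 + b * p.2) g).
  apply: cvgD; apply: cvgM; try exact: cvg_cst; [exact: cvg_fst|exact: cvg_snd].
exact: gc.
Qed.

Lemma is_derive_linear_x (g dg : R -> R) a b x y : (forall z, is_derive z (1 : R) g (dg z)) ->
  is_derive x (1 : R) (fun x' => g (a * x' + b * y)) (a * dg (a * x + b * y)).
Proof.
move=> d; have h1 := is_derive_add (is_derive_scale a (is_derive_id x 1)) (is_derive_const (b * y) x).
have h2 := is_derive_comp (f := g) (g := fun x' => a * x' + b * y) (d _) h1.
by apply: (is_derive_eq h2); rewrite mulr1 addr0 mulrC.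
Qed.

Lemma is_derive_linear_y (g dg : R -> R) a b x y : (forall z, is_derive z (1 : R) g (dg z)) ->
  is_derive y (1 : R) (fun y' => g (a * x + b * y')) (b * dg (a * x + b * y)).
Proof.
move=> d; have := is_derive_linear_x (g := g) b a y x d; rewrite addrC.
by congr is_derive; apply/funext => y'; rewrite addrC.
Qed.

Lemma mixed_C1_linear (g g1 g2 : R -> R) a b :
  (forall z, is_derive z (1 : R) g (g1 z)) -> (forall z, is_derive z (1 : R) g1 (g2 z)) ->
  continuous g2 -> mixed_C1 (fun x y => g (a * x + b * y)).
Proof.
move=> d1 d2 c2; have c0 : continuous g by move=> z; exact: is_derive_continuous (d1 z).
have c1 : continuous g1 by move=> z; exact: is_derive_continuous (d2 z).
exists (fun x y => a * g1 (a * x + b * y)), (fun x y => b * g1 (a * x + b * y)),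
  (fun x y => a * (b * g2 (a * x + b * y))).
split.
- by split; [|apply: cont2_mul; first exact: cont2_cst..|apply: cont2_mul;
    [exact: cont2_cst|apply: cont2_mul; first exact: cont2_cst]]; exact: cont2_comp_linear.
- by move=> x y; exact: is_derive_linear_x.
- by move=> x y; exact: is_derive_linear_y.
- move=> x y; rewrite mulrCA; apply: is_derive_scale; exact: is_derive_linear_x.
- by move=> x y; apply: is_derive_scale; exact: is_derive_linear_y.
Qed.

Lemma mixed_C1_fourier_proj N w : mixed_C1 (fourier_proj L N w).
Proof.
rewrite /fourier_proj; apply: mixed_C1_sum => i; apply: mixed_C1_sum => j.
pose a := 2 * pi * (i%:R - N%:R) / L : R; pose b := 2 * pi * (j%:R - N%:R) / L : R.
have ph x y : 2 * pi * ((i%:R - N%:R) * x + (j%:R - N%:R) * y) / L = a * x + b * y.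
  by rewrite /a /b; field; rewrite gt_eqF.
have dcos (z : R) : is_derive z 1 cos (- sin z) by exact: is_derive_cos.
have dsin (z : R) : is_derive z 1 sin (cos z) by exact: is_derive_sin.
have dNsin (z : R) := is_derive_opp (dsin z).
have cNcos : continuous (fun z : R => - cos z) by move=> z; apply: cvgN; exact: continuous_cos.
have cNsin : continuous (fun z : R => - sin z) by move=> z; apply: cvgN; exact: continuous_sin.
apply: mixed_C1_add; apply: mixed_C1_scale.
- have -> : (fun x y => cos (2 * pi * ((i%:R - N%:R) * x + (j%:R - N%:R) * y) / L)) =
     (fun x y => cos (a * x + b * y)).
    by apply/funext => x; apply/funext => y; rewrite ph.
  exact: (mixed_C1_linear a b dcos dNsin cNcos).
- have -> : (fun x y => sin (2 * pi * ((i%:R - N%:R) * x + (j%:R - N%:R) * y) / L)) =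
     (fun x y => sin (a * x + b * y)).
    by apply/funext => x; apply/funext => y; rewrite ph.
  exact: (mixed_C1_linear a b dsin dcos cNsin).
Qed.

End SobolevEmbedding.

(** * The Fourier projection on the grid *)

Section ProjectionError.
Context {R : realType}.
Variables (L T : R) (u : R -> R -> R -> R) (N : nat -> nat).
Variables (r : nat) (D : nat -> nat -> nat -> R -> R -> R -> R).
Hypotheses (L0 : 0 < L) (T0 : 0 < T) (r4 : (4 <= r)%N).
Hypothesis uD : forall t x y : R, 0 <= t <= T -> D 0%N 0%N 0%N t x y = u t x y.
Hypothesis Dc : forall c a b : nat, (c + a + b <= r)%N ->
  {within [set p : R * (R * R) | 0 <= p.1 <= T],
     continuous (fun p : R * (R * R) => D c a b p.1 p.2.1 p.2.2)}.
Hypothesis Dxy : forall c a b : nat, (c + a + b < r)%N ->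
  forall t x y : R, 0 <= t <= T ->
  is_derive x (1 : R) (fun x' : R => D c a b t x' y) (D c a.+1 b t x y) /\
  is_derive y (1 : R) (fun y' : R => D c a b t x y') (D c a b.+1 t x y).
Hypothesis uN : proj_estimate L T r u N.
Local Notation D0 a b := (D 0%N a%N b%N).

Lemma smooth_upto_slice t : 0 <= t <= T -> u t = D0 0 0 t.
Proof. by move=> tT; apply/funext => x; apply/funext => y; rewrite uD. Qed.

Lemma smooth_upto_cont2 a b t : (a + b <= r)%N -> 0 <= t <= T -> cont2 (D0 a b t).
Proof.
move=> ab tT [x y]; have /subspace_continuousP/(_ (t, (x, y)) tT) H := @Dc 0 a b ab.
apply: cvg_trans H => B /= H.
have pc : (fun p : R * R => (t, p)) p @[p --> (x, y)] --> (t, (x, y)).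
  exact: (cvg_pair (cvg_cst _) cvg_id).
have H2 : nbhs (x, y) ((fun p : R * R => (t, p)) @^-1`
    [set p | 0 <= p.1 <= T -> B (D0 a b p.1 p.2.1 p.2.2)]) by exact: pc H.
suff : nbhs (x, y) [set p : R * R | B (D0 a b t p.1 p.2)] by [].
by apply: (filterS _ H2) => p; apply.
Qed.

Lemma derive1n_chain (F : nat -> R -> R) n :
  (forall k (x : R), (k < n)%N -> is_derive x 1 (F k) (F k.+1 x)) -> derive1n n (F 0%N) = F n.
Proof.
elim: n => [//|n IH] FD; have FE : derive1n n (F 0%N) = F n.
  by apply: IH => k x kn; exact/FD/ltnW.
rewrite derive1nS FE; apply/funext => x; rewrite derive1E.
by have := FD n x (ltnSn n) => ?; exact: derive_val.
Qed.

(** Makes the total derivatives in [sobolev_norm] accessible: a chain of first derivatives in y,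
    followed by one in x. *)
Lemma pderiv_smooth_upto a b t : (a + b <= r)%N -> 0 <= t <= T ->
  pderiv a b (D0 0 0 t) = D0 a b t.
Proof.
move=> ab tT; apply/funext => x; apply/funext => y; rewrite /pderiv.
have dy x' : derive1n b (fun y' => D0 0 0 t x' y') = (fun y' => D0 0 b t x' y').
  apply: (@derive1n_chain (fun k y' => D0 0 k t x' y')) => k y' kb.
  have k0 : (0 + 0 + k < r)%N by lia.
  exact: (proj2 (Dxy k0 x' y' tT)).
have dx : derive1n a (fun x' => D0 0 b t x' y) = (fun x' => D0 a b t x' y).
  apply: (@derive1n_chain (fun k x' => D0 k b t x' y)) => k x' ka.
  have k0 : (0 + k + b < r)%N by lia.
  exact: (proj1 (Dxy k0 x' y tT)).
have -> : (fun x' => derive1n b (fun y' => D0 0 0 t x' y') y) = (fun x' => D0 0 b t x' y).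
  by apply/funext => x'; rewrite dy.
by rewrite dx.
Qed.

Lemma mixed_C1_smooth_upto t : 0 <= t <= T -> mixed_C1 (D0 0 0 t).
Proof.
move=> tT; exists (D0 1 0 t), (D0 0 1 t), (D0 1 1 t).
have lt1 a b : (a + b <= 1)%N -> (0 + a + b < r)%N by lia.
split.
- by split; apply: smooth_upto_cont2 => //; lia.
- by move=> x y; exact: (proj1 (Dxy (lt1 0%N 0%N isT) x y tT)).
- by move=> x y; exact: (proj2 (Dxy (lt1 0%N 0%N isT) x y tT)).
- by move=> x y; exact: (proj1 (Dxy (lt1 0%N 1%N isT) x y tT)).
- by move=> x y; exact: (proj2 (Dxy (lt1 1%N 0%N isT) x y tT)).
Qed.

(** The projection estimate has an extended real supremum on its right side and says something only
    if that is finite. *)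
Lemma sobolev_norm4_bounded : exists S : R, 0 <= S /\
  forall t, 0 <= t <= T -> sobolev_norm L 4 (u t) <= S.
Proof.
(* One constant for every pair of orders, as [choice] requires; beyond order 4 the value 0 is a
   dummy. *)
have bd (ab : nat * nat) : exists C : R, (ab.1 + ab.2 <= 4)%N ->
    forall t, 0 <= t <= T -> int2 L (fun x y => pderiv ab.1 ab.2 (u t) x y ^+ 2) <= C.
  case: ab => a b /=; have [ab|ab] := leqP (a + b) 4; last by exists 0.
  have ab' : (0 + a + b <= r)%N by lia.
  have [[C Cb] _] := smooth_upto_bounded_cont L T0 Dc ab'.
  exists (C ^+ 2 * L ^+ 2) => _ t tT; rewrite smooth_upto_slice // pderiv_smooth_upto //.
  apply: int2_le => // [|x y /andP[x0 xL] /andP[y0 yL]].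
    exact: cont2_sqr (smooth_upto_cont2 ab' tT).
  have := Cb t x y tT; rewrite (ger0_norm x0) (ger0_norm y0) => /(_ xL yL) h1.
  rewrite -[leLHS]real_normK ?num_real // lerXn2r ?nnegrE //.
  exact: le_trans h1.
have [C CP] := choice bd.
pose S2 := \sum_(a < 5) \sum_(b < 5 | (a + b <= 4)%N) C (a : nat, b : nat).
exists (Num.sqrt S2); split=> [|t tT]; first exact: sqrtr_ge0.
rewrite /sobolev_norm ler_wsqrtr //.
by apply: ler_sum => a _; apply: ler_sum => b ab; exact: (CP (a : nat, b : nat)).
Qed.

(** The estimate with k = 2 and l = 4 yields h^2 in H^2, and the embedding carries this to the
    maximum norm. *)
Lemma projection_sup_error : exists2 C : R, 0 <= C & forall M t x y, (0 < M)%N ->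
  0 <= t <= T -> 0 <= x <= L -> 0 <= y <= L ->
  `|fourier_proj L (N M) (u t) x y - u t x y| <= C * (L / M%:R) ^+ 2.
Proof.
have [S [S0 Sb]] := sobolev_norm4_bounded.
have [Ce Ce0 est] := @uN 2%N 4%N isT r4.
have c0 : 0 <= L^-1 + 1 by rewrite addr_ge0 // invr_ge0 ltW.
exists ((L^-1 + 1) * (Ce * S)) => [|M t x y M0 tT xL yL]; first by rewrite !mulr_ge0 // ltW.
have eC1 : mixed_C1 (fun x y => fourier_proj L (N M) (u t) x y - u t x y).
  apply: mixed_C1_sub; first exact: mixed_C1_fourier_proj.
  by rewrite smooth_upto_slice //; exact: mixed_C1_smooth_upto.
apply: (le_trans (sobolev_2d L0 eC1 xL yL)); rewrite -!mulrA ler_wpM2l //.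
have h2 : 0 <= Ce * (L / M%:R) ^+ 2 by rewrite mulr_ge0 ?sqr_ge0 // ltW.
rewrite -lee_fin.
apply: (@le_trans _ _ (Linfty_sobolev_norm L T 2
  (fun t x y => fourier_proj L (N M) (u t) x y - u t x y))%R).
  by apply: ereal_sup_ubound; exists t => //=; rewrite in_itv.
apply: (le_trans (est M M0)).
apply: (@le_trans _ _ ((Ce * (L / M%:R) ^+ 2)%:E * S%:E)%E); last first.
  by rewrite -EFinM lee_fin mulrA mulrAC.
apply: lee_wpmul2l; first by rewrite lee_fin.
apply: ge_ereal_sup => _ [s sT <-]; rewrite lee_fin; apply: Sb.
by move: sT; rewrite /= in_itv.
Qed.

Hypothesis uq : proj_quadrature L T u N.

(** The continuous and the discrete mean of u_N coincide, so the difference for u is a discrete and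
    a continuous mean of u_N - u, each at most its maximum. *)
Lemma mean_h_error : exists2 C : R, 0 <= C & forall (M : nat) (t : R), (0 < M)%N ->
  0 <= t <= T ->
  `|mean L (u t) - mean_h (Ih M (L / M%:R) (u t))| <= C * (L / M%:R) ^+ 2.
Proof.
have [C C0 Ce] := projection_sup_error; exists (C + C) => [|M t M0 tT]; first exact: addr_ge0.
have MR : 0 < M%:R :> R by rewrite ltr0n.
set h := L / M%:R; pose w := fourier_proj L (N M) (u t).
have hn0 : h != 0 by rewrite gt_eqF // divr_gt0.
have wm : mean L w = mean_h (Ih M h w).
  rewrite /mean /mean_h uq // -/h -/w.
  have -> : L ^+ 2 = M%:R ^+ 2 * h ^+ 2 by rewrite -exprMn /h mulrC divfK // gt_eqF.
  by move: (\sum_(i < M) _) => s; field; rewrite hn0 gt_eqF.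
have gridc (i : 'I_M) : 0 <= i.+1%:R * h <= L.
  rewrite mulr_ge0 /=; last by rewrite ltW // divr_gt0.
    by rewrite mulrA ler_pdivrMr // mulrC ler_pM2l // ler_nat.
  by [].
have wc : cont2 w by have [? [? [? [[]]]]] := mixed_C1_fourier_proj L0 (N M) (u t).
have uc : cont2 (u t) by rewrite smooth_upto_slice //; exact: smooth_upto_cont2.
have -> : mean L (u t) - mean_h (Ih M h (u t)) =
    mean_h (Ih M h w - Ih M h (u t)) - mean L (fun x y => w x y - u t x y).
  by rewrite mean_hB -wm /mean int2_sub // mulrBl; ring.
apply: (le_trans (ler_normB _ _)); rewrite mulrDl lerD //.
  apply: le_mean_h => // i j; rewrite !mxE; exact: Ce.
by apply: mean_le => // [|x y xL yL]; [exact: cont2_sub|exact: Ce].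
Qed.

End ProjectionError.

(** * The exact solution on the grid *)

Section GridFunctions.
Context {R : realType} (M : nat).
Variables (h sigma theta theta_c kappa : R).
Hypothesis M0 : (0 < M)%N.
Local Notation F := (@Fh R M h sigma theta theta_c kappa).
Implicit Types (v w : 'M[R]_M).

Lemma Fh_map v : F v = lap_h h (map_mx (entropy_potential theta theta_c) v)
  - kappa *: lap_h h v + const_mx (sigma * mean_h v).
Proof.
rewrite /Fh; congr (_ + _); congr (_ - _); rewrite -!lap_hZ -lap_hB.
by congr lap_h; apply/matrixP => i j; rewrite !mxE /entropy_potential; ring.
Qed.

Lemma mean_h_Fh v : mean_h (F v) = sigma * mean_h v.
Proof.
rewrite Fh_map mean_hD mean_hB mean_hZ !mean_h_lap mulr0 subrr add0r.
exact: mean_h_const.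
Qed.

Lemma Fh_Ih L (w : R -> R -> R) : h = L / M%:R -> periodic2 L w ->
  F (Ih M h w) = Ih M h (Dh h (fun x y => entropy_potential theta theta_c (w x y)))
   - kappa *: Ih M h (Dh h w) + const_mx (sigma * mean_h (Ih M h w)).
Proof.
move=> hE wL; rewrite Fh_map; subst h; rewrite (lap_h_Ih M0 wL).
have -> : map_mx (entropy_potential theta theta_c) (Ih M (L / M%:R) w) =
    Ih M (L / M%:R) (fun x y => entropy_potential theta theta_c (w x y)).
  by apply/matrixP => i j; rewrite !mxE.
by rewrite lap_h_Ih // => x y; have [-> ->] := wL x y.
Qed.

End GridFunctions.

Lemma within_continuous_shift {R : realType} (f : R -> R) (T a tau : R) :
  {within `[0, T], continuous f} -> 0 <= a -> a + tau <= T ->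
  {within `[0, tau], continuous (fun s : R => f (a + s))}.
Proof.
move=> fc a0 aT; apply/subspace_continuousP => s; rewrite /= in_itv /= => /andP[s0 st].
have sT : `[0, T]%classic (a + s) by rewrite /= in_itv /=; apply/andP; split; lra.
have /subspace_continuousP/(_ (a + s) sT) H := fc.
apply: cvg_trans H => B /= H.
have H2 : nbhs s ((fun s => a + s) @^-1` [set s | `[0, T]%classic s -> B (f s)]).
  have ac : (fun s : R => a + s) x @[x --> s] --> a + s.
    by apply: cvgD; [exact: cvg_cst|exact: cvg_id].
  exact: ac H.
suff : nbhs s [set s | `[0, tau]%classic s -> B (f (a + s))] by [].
apply: (filterS _ H2) => z Hz; rewrite /= in_itv /= => /andP[z0 zt]; apply: Hz.
by rewrite /= in_itv /=; apply/andP; split; lra.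
Qed.

Section SolutionOnGrid.
Context {R : realType}.
Variables (L T eps sigma theta theta_c kappa delta : R) (u : R -> R -> R -> R) (N : nat -> nat).
Variables (r : nat) (D : nat -> nat -> nat -> R -> R -> R -> R).
Hypotheses (L0 : 0 < L) (T0 : 0 < T) (sigma0 : 0 < sigma) (delta0 : 0 < delta) (r6 : (6 <= r)%N).
Hypothesis uD : forall t x y : R, 0 <= t <= T -> D 0%N 0%N 0%N t x y = u t x y.
Hypothesis Dc : forall c a b : nat, (c + a + b <= r)%N ->
  {within [set p : R * (R * R) | 0 <= p.1 <= T],
     continuous (fun p : R * (R * R) => D c a b p.1 p.2.1 p.2.2)}.
Hypothesis Dxy : forall c a b : nat, (c + a + b < r)%N ->
  forall t x y : R, 0 <= t <= T ->
  is_derive x (1 : R) (fun x' : R => D c a b t x' y) (D c a.+1 b t x y) /\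
  is_derive y (1 : R) (fun y' : R => D c a b t x y') (D c a b.+1 t x y).
Hypothesis Dt : forall c a b : nat, (c + a + b < r)%N ->
  forall t x y : R, 0 < t < T ->
  is_derive t (1 : R) (fun s : R => D c a b s x y) (D c.+1 a b t x y).
Hypothesis uCH : is_nonlocal_CH_solution L T eps sigma theta theta_c u.
Hypothesis usep : forall t x y : R, 0 <= t <= T -> `|u t x y| <= 1 - 2 * delta.
Hypothesis uN : proj_estimate L T r u N.
Hypothesis uq : proj_quadrature L T u N.
Local Notation D0 a b := (D 0%N a%N b%N).
Local Notation P := (fun t x y => entropy_potential theta theta_c (D 0%N 0%N 0%N t x y)).
Local Notation K := (3 * L).
Local Notation W M := (fun t => Ih M (L / M%:R) (u t)).
Local Notation Lh M := (@Lh R M (L / M%:R) eps kappa sigma).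
Local Notation Fh M := (@Fh R M (L / M%:R) sigma theta theta_c kappa).
Implicit Types (a s t tau x y : R).

Lemma smooth_solution n : (n <= r)%N -> smooth T K n (D0 0 0).
Proof. by move=> nr; apply: (smooth_upto_smooth K T0 Dc Dxy Dt). Qed.

(** The separation property keeps 1 + u and 1 - u above 2 delta, away from the singularity of the
    logarithm. *)
Lemma smooth_potential n : (n <= r)%N -> smooth T K n P.
Proof.
move=> nr; have sv := smooth_solution nr.
have d2 : 0 < 2 * delta by rewrite mulr_gt0.
have vle t x y : 0 <= t <= T -> - (1 - 2 * delta) <= D0 0 0 t x y <= 1 - 2 * delta.
  by move=> tT; rewrite uD // -ler_norml usep.
have s1 : smooth T K n (fun t x y => ln (1 + D0 0 0 t x y)).
  apply: (smooth_ln d2) => [t x y tT|]; first by have := vle t x y tT; lra.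
  by apply: smooth_add sv; exact: smooth_const.
have s2 : smooth T K n (fun t x y => ln (1 - D0 0 0 t x y)).
  apply: (smooth_ln d2) => [t x y tT|]; first by have := vle t x y tT; lra.
  by apply: smooth_add (smooth_opp sv); exact: smooth_const.
apply: (smooth_add (smooth_add (smooth_scale _ s1) (smooth_opp (smooth_scale _ s2)))).
exact: smooth_opp (smooth_scale _ sv).
Qed.

Lemma mesh_le (M : nat) : (0 < M)%N -> 0 < L / M%:R <= L.
Proof.
move=> M0; have MR : 0 < M%:R :> R by rewrite ltr0n.
by rewrite divr_gt0 // ler_pdivrMr // ler_peMr ?ler1n // ltW.
Qed.

(** The origin of K = 3 L: grid coordinates are at most L, and the double stencil of the biharmonic
    operator reaches 2 h <= 2 L further. *)
Lemma grid_box (M : nat) (i : 'I_M) : (0 < M)%N ->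
  `|i.+1%:R * (L / M%:R)| + 2 * (L / M%:R) <= K.
Proof. by move=> M0; have := grid_coord_le i L0; have := mesh_le M0; lra. Qed.

Lemma grid_box1 (M : nat) (i : 'I_M) : (0 < M)%N ->
  `|i.+1%:R * (L / M%:R)| + L / M%:R <= K.
Proof. by move=> M0; have := grid_box i M0; have := mesh_le M0; lra. Qed.

Lemma solution_periodic t : 0 <= t <= T -> periodic2 L (D0 0 0 t).
Proof. by move=> tT; have [uL _] := uCH; rewrite -(smooth_upto_slice uD tT); exact: uL. Qed.

Lemma Fh_solution (M : nat) t (i j : 'I_M) : (0 < M)%N -> 0 <= t <= T ->
  Fh M (W M t) i j =
  Dh (L / M%:R) (P t) (i.+1%:R * (L / M%:R)) (j.+1%:R * (L / M%:R)) -
  kappa * Dh (L / M%:R) (D0 0 0 t) (i.+1%:R * (L / M%:R)) (j.+1%:R * (L / M%:R)) +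
  sigma * mean_h (W M t).
Proof.
move=> M0 tT; rewrite (Fh_Ih _ _ _ _ M0 (erefl _)); last by have [uL _] := uCH; exact: uL.
by rewrite (smooth_upto_slice uD tT) !mxE.
Qed.

Lemma Lh_solution (M : nat) t (i j : 'I_M) : (0 < M)%N -> 0 <= t <= T ->
  let x := i.+1%:R * (L / M%:R) in let y := j.+1%:R * (L / M%:R) in
  Lh M (W M t) i j =
  eps ^+ 2 * Dh (L / M%:R) (Dh (L / M%:R) (D0 0 0 t)) x y -
  kappa * Dh (L / M%:R) (D0 0 0 t) x y + sigma * u t x y.
Proof.
move=> M0 tT; have vL := solution_periodic tT.
rewrite /Defs.Lh (smooth_upto_slice uD tT) lap_h_Ih // lap_h_Ih //; last exact: periodic2_Dh.
by rewrite !mxE.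
Qed.

(** On the exact solution, [Fh] consists of [Dh] of smooth functions and a mean, so its time
    regularity is uniform in h. The rate tau^2 is for the corrector, tau for the predictor. *)
Lemma solution_interpolation : exists2 C, 0 <= C & forall M a s tau (i j : 'I_M),
  (0 < M)%N -> 0 <= a -> 0 < s < tau -> a + tau <= T ->
  `|((1 - s / tau) *: Fh M (W M a) + (s / tau) *: Fh M (W M (a + tau))
     - Fh M (W M (a + s))) i j| <= C * tau ^+ 2 /\
  `|(Fh M (W M a) - Fh M (W M (a + s))) i j| <= C * tau.
Proof.
have r4 : (4 <= r)%N by lia.
have r2 : (2 <= r)%N by lia.
have [C1 C10 e1] := Dh_interpolation (smooth_potential r4).
have [C2 C20 e2] := Dh_interpolation (smooth_solution r4).
have [C3 C30 e3] := interpolation (smooth_solution r2).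
exists (C1 + `|kappa| * C2 + sigma * C3) => [|M a s tau i j M0 a0 st aT].
  by rewrite !addr_ge0 ?mulr_ge0 // ltW.
have [s0 st'] := andP st.
have [h0 hL] := andP (mesh_le M0).
have aT0 : 0 <= a <= T by lra.
have aT1 : 0 <= a + s <= T by lra.
have aT2 : 0 <= a + tau <= T by lra.
have [p1 p2] := e1 _ a s tau _ _ h0 (grid_box1 i M0) (grid_box1 j M0) a0 st aT.
have [q1 q2] := e2 _ a s tau _ _ h0 (grid_box1 i M0) (grid_box1 j M0) a0 st aT.
have box (k : 'I_M) : `|k.+1%:R * (L / M%:R)| <= K by have := grid_box1 k M0; lra.
have m1 : `|mean_h ((1 - s / tau) *: W M a + (s / tau) *: W M (a + tau) - W M (a + s))|
    <= C3 * tau ^+ 2.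
  apply: le_mean_h => // k l; rewrite !mxE -!uD //.
  by have [] := e3 a s tau _ _ (box k) (box l) a0 st aT.
have m2 : `|mean_h (W M a - W M (a + s))| <= C3 * tau.
  apply: le_mean_h => // k l; rewrite !mxE -!uD //.
  by have [] := e3 a s tau _ _ (box k) (box l) a0 st aT.
have entry3 (c d : R) (A B E : 'M[R]_M) :
    (c *: A + d *: B - E) i j = c * A i j + d * B i j - E i j by rewrite !mxE.
have entry2 (A B : 'M[R]_M) : (A - B) i j = A i j - B i j by rewrite !mxE.
have tri (z1 z2 z3 b : R) : `|z1| <= C1 * b -> `|z2| <= C2 * b -> `|z3| <= C3 * b ->
    `|z1 - kappa * z2 + sigma * z3| <= (C1 + `|kappa| * C2 + sigma * C3) * b.
  move=> h1 h2 h3; rewrite !mulrDl; apply: (le_trans (ler_normD _ _)); apply: lerD.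
    apply: (le_trans (ler_normB _ _)); apply: lerD => //.
    by rewrite normrM -mulrA ler_wpM2l.
  by rewrite normrM (gtr0_norm sigma0) -mulrA ler_pM2l.
move: m1 m2; rewrite !(mean_hB, mean_hD, mean_hZ) => m1 m2.
split.
  rewrite entry3 !Fh_solution //; apply: le_trans (tri _ _ _ _ p1 q1 m1).
  by rewrite le_eqVlt; apply/orP; left; apply/eqP; congr `|_|; ring.
rewrite entry2 !Fh_solution //; apply: le_trans (tri _ _ _ _ p2 q2 m2).
by rewrite le_eqVlt; apply/orP; left; apply/eqP; congr `|_|; ring.
Qed.

(** [rem] is defined so that the exact solution satisfies the spatially discrete equation. The kappa
    terms and sigma u cancel in it; what is left are the consistency errors of the potential, of the
    biharmonic operator and of the mean. *)
Lemma solution_residual : exists2 C, 0 <= C & forall M, (0 < M)%N ->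
  exists rem : R -> 'M[R]_M, forall t (i j : 'I_M), 0 < t < T ->
    `|rem t i j| <= C * (L / M%:R) ^+ 2 /\
    is_derive t 1 (fun s => W M s i j) ((- Lh M (W M t) + (Fh M (W M t) + rem t)) i j).
Proof.
have r4 : (4 <= r)%N by lia.
have [Px [Pxx [Py [Pyy [dPx dPxx dPy dPyy [C1 C10 e1]]]]]] :=
  Dh_consistent_smooth (smooth_potential r4).
have [C2 C20 e2] := biharmonic_consistent K T0 Dc Dxy r6.
have [C3 C30 e3] := mean_h_error L0 T0 r4 uD Dc Dxy uN uq.
exists (C1 + eps ^+ 2 * C2 + sigma * C3) => [|M M0].
  exact: addr_ge0 (addr_ge0 C10 (mulr_ge0 (sqr_ge0 _) C20)) (mulr_ge0 (ltW sigma0) C30).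
pose ut t x y := Pxx t x y + Pyy t x y
  - eps ^+ 2 * (D0 4 0 t x y + 2 * D0 2 2 t x y + D0 0 4 t x y) - sigma * (u t x y - mean L (u t)).
pose Ut t : 'M[R]_M := Ih M (L / M%:R) (ut t).
exists (fun t => Ut t + Lh M (W M t) - Fh M (W M t)) => t i j tT.
have tT' : 0 <= t <= T by case/andP: tT => *; rewrite !ltW.
have UtE : Ut t i j = ut t (i.+1%:R * (L / M%:R)) (j.+1%:R * (L / M%:R)) by rewrite mxE.
split; last first.
  have -> : - Lh M (W M t) + (Fh M (W M t) + (Ut t + Lh M (W M t) - Fh M (W M t))) = Ut t.
    move: (Lh M _) (Fh M _) (Ut t) => A B Z.
    by apply/matrixP => k l; rewrite !mxE; ring.
  have := CH_expanded r4 uD Dxy uCH (fun _ _ _ => erefl) dPx dPxx dPy dPyy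
    (i.+1%:R * (L / M%:R)) (j.+1%:R * (L / M%:R)) tT.
  rewrite UtE; congr is_derive.
  by apply/funext => s; rewrite mxE.
have [h0 hL] := andP (mesh_le M0).
have b1 := e1 _ t _ _ h0 tT' (grid_box1 i M0) (grid_box1 j M0).
have b2 := e2 _ t _ _ h0 tT' (grid_box i M0) (grid_box j M0).
have b3 := e3 M t M0 tT'.
have entry (A B E : 'M[R]_M) : (A + B - E) i j = A i j + B i j - E i j by rewrite !mxE.
rewrite entry UtE Fh_solution // Lh_solution // /ut.
move: b1 b2 b3; set x := i.+1%:R * _; set y := j.+1%:R * _; set h := L / _.
set dP := Dh h (P t) x y; set b := Dh h (Dh h _) x y; set m := mean L _; set mh := mean_h _.
set q := D0 4 0 t x y + _ + _ => b1 b2 b3.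
have -> : Pxx t x y + Pyy t x y - eps ^+ 2 * q - sigma * (u t x y - m) +
   (eps ^+ 2 * b - kappa * Dh h (D0 0 0 t) x y + sigma * u t x y) -
   (dP - kappa * Dh h (D0 0 0 t) x y + sigma * mh) =
   - (dP - (Pxx t x y + Pyy t x y)) + eps ^+ 2 * (b - q) + sigma * (m - mh) by ring.
rewrite !mulrDl; apply: (le_trans (ler_normD _ _)); apply: lerD; last first.
  by rewrite normrM (gtr0_norm sigma0) -mulrA ler_pM2l.
apply: (le_trans (ler_normD _ _)); apply: lerD; first by rewrite normrN.
by rewrite normrM (ger0_norm (sqr_ge0 _)) -(mulrA (eps ^+ 2)) ler_wpM2l ?sqr_ge0.
Qed.

Lemma solution_continuous M (i j : 'I_M) :
  {within `[0, T], continuous (fun s => W M s i j)}.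
Proof.
have [_ vc] : bounded_cont T K (D0 0 0) by exact: smooth_bounded (smooth_solution (leq0n _)).
have vE : {in `[0, T]%classic, (fun s => D0 0 0 s (i.+1%:R * (L / M%:R)) (j.+1%:R * (L / M%:R)))
    =1 (fun s => W M s i j)}.
  by move=> s; rewrite inE /= in_itv /= => sT; rewrite mxE uD.
exact: subspace_eq_continuous vE (vc _ _).
Qed.

(** In the discrete mean of the equation the Laplacians vanish and the sigma terms of [Lh] and [Fh]
    cancel, so the mean changes only at the rate of the mean of [rem]. *)
Lemma mean_h_drift : exists2 C, 0 <= C & forall M t, (0 < M)%N -> 0 <= t <= T ->
  `|mean_h (W M t) - mean_h (W M 0)| <= C * (L / M%:R) ^+ 2.
Proof.
have [C C0 res] := solution_residual; exists (C * T) => [|M t M0 /andP[t0 tT]].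
  by rewrite mulr_ge0 // ltW.
have [rem remP] := res M M0.
have md s : 0 < s < t -> is_derive s 1 (fun s => mean_h (W M s)) (mean_h (rem s)).
  move=> st; have sT : 0 < s < T by lra.
  have -> : mean_h (rem s) = mean_h (- Lh M (W M s) + (Fh M (W M s) + rem s)).
    have LE := mean_h_Lh (L / M%:R) eps kappa sigma (W M s).
    rewrite mean_hD -scaleN1r mean_hZ LE mean_hD mean_h_Fh //; ring.
  rewrite /mean_h.
  have -> : (fun s0 => (\sum_i \sum_j W M s0 i j) / M%:R ^+ 2) =
      (fun s0 => (M%:R ^+ 2)^-1 * (\sum_i \sum_j W M s0 i j)).
    by apply/funext => s'; rewrite mulrC.
  rewrite [X in is_derive _ _ _ X]mulrC; apply: is_derive_scale.
  by apply: is_derive_bigsum => i; apply: is_derive_bigsum => j; have [] := remP s i j sT.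
have mc : {within `[0, t], continuous (fun s => mean_h (W M s))}.
  move=> s; apply: cvgM; last exact: cvg_cst.
  apply: cvg_bigsum => i; apply: cvg_bigsum => j.
  have Wc : {within `[0, t], continuous (fun s => W M s i j)}.
    by apply: continuous_subspaceW (@solution_continuous M i j); apply: subset_itvScc;
       rewrite bnd_simp.
  exact: Wc.
have remb s : 0 < s < t -> `|mean_h (rem s)| <= C * (L / M%:R) ^+ 2.
  move=> st; apply: le_mean_h => // i j; have sT : 0 < s < T by lra.
  by have [] := remP s i j sT.
apply: (le_trans (mvt_le t0 md mc remb)); rewrite subr0 mulrAC.
by rewrite ler_wpM2r ?sqr_ge0 // ler_wpM2l.
Qed.

End SolutionOnGrid.

(** * Error of one stage *)

Section StageError.
Context {R : realType} (M : nat).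
Variables (h eps sigma theta theta_c kappa delta tau : R).
Hypotheses (M0 : (0 < M)%N) (h0 : 0 < h) (eps0 : 0 < eps) (sigma0 : 0 < sigma)
  (theta0 : 0 < theta) (theta_c0 : 0 < theta_c) (kappa0 : 0 < kappa)
  (delta0 : 0 < delta) (tau0 : 0 < tau).
Local Notation F := (@Fh R M h sigma theta theta_c kappa).
Local Notation L := (@Lh R M h eps kappa sigma).
Local Notation A := (tau *: lin_mx L).
Implicit Types (v w : 'M[R]_M) (a b : R).

Lemma ln_lipschitz a b : delta <= a -> delta <= b -> `|ln a - ln b| <= delta^-1 * `|a - b|.
Proof.
wlog ab : a b / b <= a.
  move=> wl da db; have [ab|ab] := leP b a; first exact: wl.
  by rewrite distrC (distrC a); apply: wl => //; exact: ltW.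
move=> da db; rewrite [X in _ <= _ * X]ger0_norm ?subr_ge0 //.
have dpos x : delta <= x -> 0 < x by exact: lt_le_trans.
have dln x : b < x < a -> is_derive x 1 (@ln R) x^-1.
  by move=> /andP[bx _]; apply: is_derive1_ln; apply: dpos; apply: le_trans db (ltW bx).
have lnc : {within `[b, a], continuous (@ln R)}.
  apply: continuous_in_subspaceT => x; rewrite inE /= in_itv /= => /andP[bx _].
  by apply: continuous_ln; apply: dpos; apply: le_trans db bx.
apply: (mvt_le ab dln lnc) => x /andP[bx _].
have x0 : delta <= x by apply: le_trans db (ltW bx).
by rewrite normfV gtr0_norm ?dpos // lef_pV2 // posrE ?dpos.
Qed.

(** A Lipschitz constant of z -> entropy_potential z - kappa z on |z| <= 1 - delta: each of the two
    logarithms, with weight theta / 2, has slope at most 1 / delta. *)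
Definition lip : R := theta / delta + theta_c + kappa.

Lemma entropy_lipschitz a b : `|a| <= 1 - delta -> `|b| <= 1 - delta ->
  `|(entropy_potential theta theta_c a - kappa * a) -
    (entropy_potential theta theta_c b - kappa * b)| <= lip * `|a - b|.
Proof.
move=> ad bd; move: (ad) (bd); rewrite ler_norml => /andP[a1 a2].
rewrite ler_norml => /andP[b1 b2].
have l1 : `|ln (1 + a) - ln (1 + b)| <= delta^-1 * `|a - b|.
  have -> : a - b = (1 + a) - (1 + b) by ring.
  by apply: ln_lipschitz; lra.
have l2 : `|ln (1 - b) - ln (1 - a)| <= delta^-1 * `|a - b|.
  have -> : a - b = (1 - b) - (1 - a) by ring.
  by apply: ln_lipschitz; lra.
rewrite /entropy_potential.
have -> : theta / 2 * ln (1 + a) - theta / 2 * ln (1 - a) - theta_c * a - kappa * a -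
   (theta / 2 * ln (1 + b) - theta / 2 * ln (1 - b) - theta_c * b - kappa * b) =
   theta / 2 * (ln (1 + a) - ln (1 + b)) + theta / 2 * (ln (1 - b) - ln (1 - a))
   - (theta_c + kappa) * (a - b) by ring.
have t2 : 0 <= theta / 2 by rewrite divr_ge0 // ltW.
have h3 : `|(theta_c + kappa) * (a - b)| = (theta_c + kappa) * `|a - b|.
  by rewrite normrM gtr0_norm // addr_gt0.
have h4 (x : R) : `|theta / 2 * x| = theta / 2 * `|x| by rewrite normrM ger0_norm.
apply: (@le_trans _ _ (theta / 2 * (delta^-1 * `|a - b|) + theta / 2 * (delta^-1 * `|a - b|) +
   (theta_c + kappa) * `|a - b|)); last first.
  by rewrite le_eqVlt; apply/orP; left; apply/eqP; rewrite /lip; field; rewrite gt_eqF.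
rewrite -h3; apply: (le_trans (ler_normB _ _)); rewrite lerD2r.
by apply: (le_trans (ler_normD _ _)); rewrite !h4 lerD // ler_wpM2l.
Qed.

(** [g] is the difference of the pointwise nonlinearities before the Laplacian acts, so its bound
    contains no negative power of h. The separate constant is the mean term of [Fh]. *)
Lemma Fh_lipschitz v w : (forall i j, `|v i j| <= 1 - delta) ->
  (forall i j, `|w i j| <= 1 - delta) ->
  exists2 g : 'M[R]_M, F v - F w = lap_h h g + const_mx (sigma * mean_h (v - w))
    & dot g g <= lip ^+ 2 * dot (v - w) (v - w).
Proof.
move=> vd wd; pose E x := map_mx (entropy_potential theta theta_c) x - kappa *: x : 'M[R]_M.
exists (E v - E w).
  rewrite !Fh_map /E !lap_hB !lap_hZ mean_hB.
  by apply/matrixP => i j; move: (lap_h h _) (lap_h h _) (lap_h h _) (lap_h h _) => *;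
    rewrite !mxE; ring.
have -> : lip ^+ 2 * dot (v - w) (v - w) = dot (lip *: (v - w)) (lip *: (v - w)).
  by rewrite dotZl dotZr; ring.
apply: le_dot => i j; rewrite !mxE normrM.
apply: le_trans (entropy_lipschitz (vd i j) (wd i j)) _.
by rewrite ler_wpM2r // ler_norm.
Qed.

Lemma dot_convex (v w : 'M[R]_M) a : 0 <= a <= 1 ->
  dot ((1 - a) *: v + a *: w) ((1 - a) *: v + a *: w) <= 2 * (dot v v + dot w w).
Proof.
move=> /andP[a0 a1]; apply: (le_trans (dotD_le _ _)); rewrite !dotZl !dotZr.
have := dot_ge0 v; have := dot_ge0 w.
move: (dot v v) (dot w w) => p q q0 p0.
have a1' : 0 <= 1 - a <= 1 by apply/andP; split; lra.
have [a2 a3] := andP a1'.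
have h1 : (1 - a) * ((1 - a) * p) <= p by rewrite mulrA ler_piMl // mulr_ile1.
have h2 : a * (a * q) <= q by rewrite mulrA ler_piMl // mulr_ile1.
by rewrite mulrDr lerD // ler_pM2l.
Qed.

Variables (un v1 w0 w1 : 'M[R]_M) (W rem : R -> 'M[R]_M) (m b : R).
Hypotheses (und : forall i j, `|un i j| <= 1 - delta) (v1d : forall i j, `|v1 i j| <= 1 - delta).
Hypotheses (w0d : forall i j, `|w0 i j| <= 1 - delta) (w1d : forall i j, `|w1 i j| <= 1 - delta).
Hypothesis Wc : forall i j, {within `[0, tau], continuous (fun s : R => W s i j)}.
Hypothesis Wd : forall (s : R) i j, 0 < s < tau ->
  is_derive s 1 (fun s : R => W s i j) ((- L (W s) + (F (W s) + rem s)) i j).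
Hypothesis Wb : forall (s : R) i j, 0 < s < tau ->
  `|((1 - s / tau) *: F w0 + (s / tau) *: F w1 - (F (W s) + rem s)) i j| <= b.

(** Serves both stages: the predictor has v1 = un and w0 = w1 = W 0, the corrector has the predicted
    value as v1 and W tau as w1. [e] is the sum of the squared errors at the two nodes, [b] the
    pointwise bound of the consistency residual. *)
Lemma curve_error (alpha e : R) (y : R -> 'M[R]_M) : 0 < alpha ->
  (forall (s : R) i j, is_derive s 1 (fun s : R => y s i j)
     ((- L (y s) + (1 - s / tau) *: F un + (s / tau) *: F v1) i j)) ->
  e = dot (un - w0) (un - w0) + dot (v1 - w1) (v1 - w1) ->
  dot (y tau - W tau) (y tau - W tau) <= expR (alpha * tau) *
    (dot (y 0 - W 0) (y 0 - W 0) +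
     tau * (lip ^+ 2 * e / eps ^+ 2 + (4 * sigma ^+ 2 * e + 2 * M%:R ^+ 2 * b ^+ 2) / alpha)).
Proof.
move=> alpha0 yd eE.
have [g0 g0E g0b] := Fh_lipschitz und w0d; have [g1 g1E g1b] := Fh_lipschitz v1d w1d.
pose g s := (1 - s / tau) *: g0 + (s / tau) *: g1.
pose c s : 'M[R]_M := (1 - s / tau) *: const_mx (sigma * mean_h (un - w0)) +
  (s / tau) *: const_mx (sigma * mean_h (v1 - w1)).
pose z s := (1 - s / tau) *: F w0 + (s / tau) *: F w1 - (F (W s) + rem s).
have st1 s : 0 < s < tau -> 0 <= s / tau <= 1.
  move=> /andP[s0 st]; apply/andP; split; first by apply: divr_ge0; exact: ltW.
  by rewrite ler_pdivrMr // mul1r ltW.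
have E s : (1 - s / tau) *: F un + (s / tau) *: F v1 - (F (W s) + rem s) =
    lap_h h (g s) + (c s + z s).
  rewrite /g lap_hD !lap_hZ /c /z.
  have -> : F un = F w0 + (lap_h h g0 + const_mx (sigma * mean_h (un - w0))).
    by rewrite -g0E addrC subrK.
  have -> : F v1 = F w1 + (lap_h h g1 + const_mx (sigma * mean_h (v1 - w1))).
    by rewrite -g1E addrC subrK.
  by rewrite !scalerDr; apply/matrixP => i j;
    move: (F w0) (F w1) (F (W s)) (rem s) (lap_h h g0) (lap_h h g1) => *; rewrite !mxE; ring.
have gb s : 0 < s < tau -> dot (g s) (g s) <= 2 * lip ^+ 2 * e.
  move=> /st1 st; apply: (le_trans (dot_convex g0 g1 st)).
  by rewrite -mulrA ler_pM2l // eE mulrDr lerD.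
have cb s : 0 < s < tau -> dot (c s + z s) (c s + z s) <=
    4 * sigma ^+ 2 * e + 2 * M%:R ^+ 2 * b ^+ 2.
  move=> st; apply: (le_trans (dotD_le _ _)); apply: lerD.
    have := dot_convex (const_mx (sigma * mean_h (un - w0))) (const_mx (sigma * mean_h (v1 - w1)))
      (st1 s st).
    have k1 : M%:R ^+ 2 * (sigma * mean_h (un - w0)) ^+ 2 <= sigma ^+ 2 * dot (un - w0) (un - w0).
      rewrite exprMn mulrCA ler_wpM2l ?sqr_ge0 //; exact: mean_h_sqr_le.
    have k2 : M%:R ^+ 2 * (sigma * mean_h (v1 - w1)) ^+ 2 <= sigma ^+ 2 * dot (v1 - w1) (v1 - w1).
      rewrite exprMn mulrCA ler_wpM2l ?sqr_ge0 //; exact: mean_h_sqr_le.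
    rewrite !dot_const_mx -/(c s) eE => k3.
    apply: (@le_trans _ _ (2 * (2 * (sigma ^+ 2 * dot (un - w0) (un - w0) +
       sigma ^+ 2 * dot (v1 - w1) (v1 - w1))))); last lra.
    by rewrite ler_pM2l //; apply: (le_trans k3); rewrite ler_pM2l // lerD.
  by rewrite -mulrA ler_pM2l //; apply: dot_le_const => i j; exact: Wb.
have := stage_stability kappa0 sigma0 eps0 alpha0 tau0 yd Wc Wd (fun s _ => E s) gb cb.
have -> : 2 * lip ^+ 2 * e / (2 * eps ^+ 2) = lip ^+ 2 * e / eps ^+ 2.
  by field; rewrite gt_eqF.
by [].
Qed.

Hypotheses (unm : mean_h un = m) (v1m : mean_h v1 = m).
Hypotheses (Wm : `|m - mean_h (W tau)| <= delta).
Hypothesis Wtd : forall i j, `|W tau i j| <= 1 - 2 * delta.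

(** The value to be projected is the end point of the curve, whose mean is still m; the constant
    that makes [W tau] feasible is therefore m - mean_h (W tau). *)
Lemma stage_error (alpha e : R) (E0 E1 E2 : 'M[R]_(M * M)) v : 0 < alpha ->
  is_spectral_fun phi0 A E0 -> is_spectral_fun phi1 A E1 -> is_spectral_fun phi2 A E2 ->
  is_projection h delta
    (appmx E0 un + tau *: (appmx (E1 - E2) (F un) + appmx E2 (F v1))) v ->
  e = dot (un - w0) (un - w0) + dot (v1 - w1) (v1 - w1) ->
  [/\ mean_h v = m, (forall i j, `|v i j| <= 1 - delta) &
  dot (v - W tau) (v - W tau) <= expR (alpha * tau) *
    (dot (un - W 0) (un - W 0) +
     tau * (lip ^+ 2 * e / eps ^+ 2 + (4 * sigma ^+ 2 * e + 2 * M%:R ^+ 2 * b ^+ 2) / alpha))].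
Proof.
move=> alpha0 sE0 sE1 sE2 vp eE.
have [y [y0 yt yd]] := @ETD_curve R M (L : {linear 'M[R]_M -> 'M[R]_M}) sigma tau sigma0 tau0
  (Lh_coercive h eps sigma kappa0) E0 E1 E2 un (F un) (F v1) sE0 sE1 sE2.
have ym : mean_h (y tau) = m.
  apply: (@mean_h_curve _ _ h eps kappa sigma sigma0 tau m (F un) (F v1)) => //.
  - by rewrite mean_h_Fh // unm.
  - by rewrite mean_h_Fh // v1m.
  - by rewrite y0.
move: vp; rewrite -yt => vp; have [[vd vm] _] := vp.
have MR : M%:R ^+ 2 != 0 :> R by rewrite expf_neq0 // pnatr_eq0 -lt0n.
have h2 : h ^+ 2 != 0 by rewrite expf_neq0 // gt_eqF.
have dpos : 0 <= 1 - delta by apply: le_trans (norm_inf_ge0 v) vd.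
(* Here the two margins meet: |W tau| <= 1 - 2 delta, and the shift costs at most delta. *)
have feas : feasible h delta (y tau) (W tau + const_mx (m - mean_h (W tau))).
  split.
    apply/norm_inf_leP => // i j; rewrite mxE [X in _ + X]mxE.
    by apply: (le_trans (ler_normD _ _)); apply: (le_trans (lerD (Wtd i j) Wm)); lra.
  rewrite !inner_hE; congr (_ * _).
  have mE (x : 'M[R]_M) : dot x (const_mx 1) = M%:R ^+ 2 * mean_h x :> R.
    by rewrite mean_h_dot [RHS]mulrC divfK.
  by rewrite !mE mean_hD mean_h_const // ym addrCA subrr addr0.
split.
- rewrite -ym !mean_h_dot; congr (_ / _).
  by apply: (mulfI h2); rewrite -!inner_hE.
- by apply/norm_inf_leP.
- apply: (le_trans (projection_nonexpansive_shift h0 vp feas)).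
  by have := curve_error alpha0 yd eE; rewrite y0.
Qed.

End StageError.

(** * Error of one step *)

Section OneStep.
Context {R : realType} (M : nat).
Variables (h eps sigma theta theta_c kappa delta tau C q m b1 b2 : R).
Hypotheses (M0 : (0 < M)%N) (h0 : 0 < h) (eps0 : 0 < eps) (sigma0 : 0 < sigma)
  (theta0 : 0 < theta) (theta_c0 : 0 < theta_c) (kappa0 : 0 < kappa)
  (delta0 : 0 < delta) (tau0 : 0 < tau) (tau1 : tau <= 2^-1).
Local Notation F := (@Fh R M h sigma theta theta_c kappa).
Local Notation L := (@Lh R M h eps kappa sigma).
Local Notation lip := (lip theta theta_c kappa delta).

(** [expR 1] is exp(alpha tau) for alpha = 1 / tau. The bracket bounds the predictor's energy terms
    with tau <= 1 and the same error at both nodes. *)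
Definition mid_const : R :=
  expR 1 * (1 + 2 * lip ^+ 2 / eps ^+ 2 + 8 * sigma ^+ 2 + 2 * C ^+ 2).
(** Arises by inserting e0 + e1 <= (1 + mid_const) (e0 + X) into the corrector's bound with alpha =
    1, where e0, e1 are the squared errors of [un] and of the predictor, and X = M^2 q^2. *)
Definition step_const : R :=
  (lip ^+ 2 / eps ^+ 2 + 4 * sigma ^+ 2) * (1 + mid_const) + 2 * C ^+ 2.

Lemma mid_const_ge0 : 0 <= mid_const.
Proof.
rewrite /mid_const mulr_ge0 ?expR_ge0 // !addr_ge0 //.
- by rewrite divr_ge0 ?sqr_ge0 // mulr_ge0 ?sqr_ge0.
- by rewrite mulr_ge0 // sqr_ge0.
- by rewrite mulr_ge0 // sqr_ge0.
Qed.

Lemma step_const_ge0 : 0 <= step_const.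
Proof.
rewrite /step_const addr_ge0 //; last by rewrite mulr_ge0 // sqr_ge0.
rewrite mulr_ge0 //; last by rewrite addr_ge0 // mid_const_ge0.
by rewrite addr_ge0 ?divr_ge0 ?sqr_ge0 // mulr_ge0 // sqr_ge0.
Qed.

Hypotheses (q0 : 0 <= q) (b10 : 0 <= b1) (b20 : 0 <= b2) (b1q : tau * b1 <= C * q)
  (b2q : b2 <= C * q).
Variables (un un1 : 'M[R]_M) (W rem : R -> 'M[R]_M).
Hypothesis step : PETDRK2_step h eps sigma theta theta_c kappa delta tau un un1.
Hypotheses (und : forall i j, `|un i j| <= 1 - delta) (unm : mean_h un = m).
Hypotheses (W0d : forall i j, `|W 0 i j| <= 1 - 2 * delta)
  (Wtd : forall i j, `|W tau i j| <= 1 - 2 * delta).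
Hypothesis Wm : `|m - mean_h (W tau)| <= delta.
Hypothesis Wc : forall i j, {within `[0, tau], continuous (fun s : R => W s i j)}.
Hypothesis Wd : forall (s : R) i j, 0 < s < tau ->
  is_derive s 1 (fun s : R => W s i j) ((- L (W s) + (F (W s) + rem s)) i j).
Hypothesis Wb1 : forall (s : R) i j, 0 < s < tau ->
  `|(F (W 0) - (F (W s) + rem s)) i j| <= b1.
Hypothesis Wb2 : forall (s : R) i j, 0 < s < tau ->
  `|((1 - s / tau) *: F (W 0) + (s / tau) *: F (W tau) - (F (W s) + rem s)) i j| <= b2.

(** The predictor's error is at most a multiple of e0 + X, so the corrector's forcing is too, and
    the factor tau of a single step remains in front of it. *)
Lemma PETDRK2_step_error :
  [/\ mean_h un1 = m, (forall i j, `|un1 i j| <= 1 - delta) &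
  dot (un1 - W tau) (un1 - W tau) <= expR ((1 + step_const) * tau) *
    (dot (un - W 0) (un - W 0) + tau * (step_const * (M%:R ^+ 2 * q ^+ 2)))].
Proof.
have [E0 [E1 [E2 [umid [sE0 sE1 sE2 pmid pun1]]]]] := step.
have [d0 tau_le] := (delta0, tau1).
have W0d' i j : `|W 0 i j| <= 1 - delta by apply: le_trans (W0d i j) _; lra.
have Wtd' i j : `|W tau i j| <= 1 - delta by apply: le_trans (Wtd i j) _; lra.
(* The predictor is the corrector formula with both nonlinear values equal to [F un], so
   [stage_error] applies to it. *)
have pmid' : is_projection h delta
    (appmx E0 un + tau *: (appmx (E1 - E2) (F un) + appmx E2 (F un))) umid.
  have -> : appmx (E1 - E2) (F un) + appmx E2 (F un) = appmx E1 (F un).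
    by rewrite /appmx mulmxBr linearB subrK.
  exact: pmid.
have tV : 0 < tau^-1 by rewrite invr_gt0.
have Wb1' (s : R) i j : 0 < s < tau ->
    `|((1 - s / tau) *: F (W 0) + (s / tau) *: F (W 0) - (F (W s) + rem s)) i j| <= b1.
  by rewrite -scalerDl subrK scale1r; exact: Wb1.
set e0 := dot (un - W 0) (un - W 0).
set X := M%:R ^+ 2 * q ^+ 2.
have e00 : 0 <= e0 by exact: dot_ge0.
have X0 : 0 <= X by rewrite mulr_ge0 // sqr_ge0.
have [mm md me] := stage_error M0 h0 eps0 sigma0 theta0 theta_c0 kappa0 delta0 tau0
  und und W0d' W0d' Wc Wd Wb1' unm unm Wm Wtd tV sE0 sE1 sE2 pmid' (erefl _).
have [nm nd ne] := stage_error M0 h0 eps0 sigma0 theta0 theta_c0 kappa0 delta0 tau0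
  und md W0d' Wtd' Wc Wd Wb2 unm mm Wm Wtd ltr01 sE0 sE1 sE2 pun1 (erefl _).
split=> //; move: me ne; rewrite -/e0 invrK mulVf ?gt_eqF // mul1r divr1.
set e1 := dot (umid - W tau) _; set en := dot (un1 - W tau) _ => me ne.
have l0 : 0 <= lip ^+ 2 / eps ^+ 2 by rewrite divr_ge0 ?sqr_ge0.
have s0 : 0 <= sigma ^+ 2 by exact: sqr_ge0.
have C0 : 0 <= C ^+ 2 by exact: sqr_ge0.
have M20 : 0 <= M%:R ^+ 2 :> R by exact: sqr_ge0.
have t1 : tau <= 1 by lra.
have tt0 : 0 <= tau by exact: ltW.
have Cq0 : 0 <= C * q by exact: le_trans b20 b2q.
have e1le : e1 <= mid_const * (e0 + X).
  apply: (le_trans me); rewrite /mid_const -(mulrA (expR 1)) ler_pM2l ?expR_gt0 //.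
  have c1 : tau * (lip ^+ 2 * (e0 + e0) / eps ^+ 2) <= 2 * lip ^+ 2 / eps ^+ 2 * e0.
    have -> : tau * (lip ^+ 2 * (e0 + e0) / eps ^+ 2) =
      tau * (2 * lip ^+ 2 / eps ^+ 2 * e0) by field; rewrite gt_eqF.
    by rewrite ler_piMl // mulr_ge0 // -mulrA mulr_ge0.
  have c2 : tau * (4 * sigma ^+ 2 * (e0 + e0) * tau) <= 8 * sigma ^+ 2 * e0.
    have -> : tau * (4 * sigma ^+ 2 * (e0 + e0) * tau) = (tau * tau) * (8 * sigma ^+ 2 * e0) by ring.
    by rewrite ler_piMl ?mulr_ile1 // mulr_ge0 // mulr_ge0.
  (* The second factor tau is 1 / alpha: the residual [b1] enters as tau b1, which is of second
     order. *)
  have c3 : tau * (2 * M%:R ^+ 2 * b1 ^+ 2 * tau) <= 2 * C ^+ 2 * X.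
    have -> : tau * (2 * M%:R ^+ 2 * b1 ^+ 2 * tau) = 2 * M%:R ^+ 2 * (tau * b1) ^+ 2 by ring.
    have -> : 2 * C ^+ 2 * X = 2 * M%:R ^+ 2 * (C * q) ^+ 2 by rewrite /X; ring.
    by rewrite ler_wpM2l ?(mulr_ge0 _ M20) // lerXn2r ?nnegrE ?(mulr_ge0 tt0 b10).
  have -> : tau * (lip ^+ 2 * (e0 + e0) / eps ^+ 2 +
     (4 * sigma ^+ 2 * (e0 + e0) + 2 * M%:R ^+ 2 * b1 ^+ 2) * tau) =
     tau * (lip ^+ 2 * (e0 + e0) / eps ^+ 2) + tau * (4 * sigma ^+ 2 * (e0 + e0) * tau) +
     tau * (2 * M%:R ^+ 2 * b1 ^+ 2 * tau) by ring.
  have n1 : 0 <= 2 * lip ^+ 2 / eps ^+ 2 * X by rewrite mulr_ge0 // -mulrA mulr_ge0.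
  have n2 : 0 <= 8 * sigma ^+ 2 * X by rewrite mulr_ge0 // mulr_ge0.
  have n3 : 0 <= 2 * C ^+ 2 * e0 by rewrite mulr_ge0 // mulr_ge0.
  have -> : (1 + 2 * lip ^+ 2 / eps ^+ 2 + 8 * sigma ^+ 2 + 2 * C ^+ 2) * (e0 + X) =
    e0 + X + 2 * lip ^+ 2 / eps ^+ 2 * e0 + 2 * lip ^+ 2 / eps ^+ 2 * X +
    8 * sigma ^+ 2 * e0 + 8 * sigma ^+ 2 * X + 2 * C ^+ 2 * e0 + 2 * C ^+ 2 * X by ring.
  lra.
have mc0 := mid_const_ge0; have sc0 := step_const_ge0.
have ele : lip ^+ 2 * (e0 + e1) / eps ^+ 2 + (4 * sigma ^+ 2 * (e0 + e1) + 2 * M%:R ^+ 2 * b2 ^+ 2)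
    <= step_const * (e0 + X).
  have c3 : 2 * M%:R ^+ 2 * b2 ^+ 2 <= 2 * C ^+ 2 * X.
    have -> : 2 * C ^+ 2 * X = 2 * M%:R ^+ 2 * (C * q) ^+ 2 by rewrite /X; ring.
    by rewrite ler_wpM2l ?(mulr_ge0 _ M20) // lerXn2r ?nnegrE.
  have c4 : e0 + e1 <= (1 + mid_const) * (e0 + X).
    by rewrite mulrDl mul1r lerD // lerDl.
  have k0 : 0 <= lip ^+ 2 / eps ^+ 2 + 4 * sigma ^+ 2 by rewrite addr_ge0 // mulr_ge0.
  have c5 := ler_wpM2l k0 c4.
  have n3 : 0 <= 2 * C ^+ 2 * e0 by rewrite mulr_ge0 // mulr_ge0.
  have -> : lip ^+ 2 * (e0 + e1) / eps ^+ 2 + (4 * sigma ^+ 2 * (e0 + e1) +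
    2 * M%:R ^+ 2 * b2 ^+ 2) = (lip ^+ 2 / eps ^+ 2 + 4 * sigma ^+ 2) * (e0 + e1) +
    2 * M%:R ^+ 2 * b2 ^+ 2 by field; rewrite gt_eqF.
  have -> : step_const * (e0 + X) = (lip ^+ 2 / eps ^+ 2 + 4 * sigma ^+ 2) *
    ((1 + mid_const) * (e0 + X)) + 2 * C ^+ 2 * e0 + 2 * C ^+ 2 * X by rewrite /step_const; ring.
  lra.
apply: (le_trans ne).
have -> : expR ((1 + step_const) * tau) = expR tau * expR (step_const * tau).
  by rewrite -expRD mulrDl mul1r.
rewrite -(mulrA (expR tau)) ler_pM2l ?expR_gt0 //.
apply: (@le_trans _ _ (e0 + tau * (step_const * (e0 + X)))).
  by rewrite lerD2l ler_wpM2l.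
(* The growth 1 + step_const tau of e0 is absorbed by a further exponential; hence the rate 1 +
   step_const, whose 1 is alpha. *)
have kt0 : 0 <= step_const * tau by rewrite mulr_ge0.
have ex : 1 + step_const * tau <= expR (step_const * tau) by exact: expR_ge1Dx.
have y0 : 0 <= tau * (step_const * X) by rewrite !mulr_ge0.
have -> : e0 + tau * (step_const * (e0 + X)) =
  (1 + step_const * tau) * e0 + 1 * (tau * (step_const * X)) by ring.
rewrite mulrDr lerD // ler_wpM2r //; lra.
Qed.

End OneStep.

(** * Choice of the constants and summation over the time steps *)

Theorem theorem4p2 (R : realType) :
  exists r : nat,
  forall (L T eps sigma theta theta_c kappa delta : R)
         (u : R -> R -> R -> R) (N : nat -> nat),
    0 < L -> 0 < T -> 0 < eps -> 0 < sigma ->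
    0 < theta -> theta < theta_c -> 0 < kappa -> 0 < delta ->
    smooth_upto r T u ->
    is_nonlocal_CH_solution L T eps sigma theta theta_c u ->
    (forall t x y : R, 0 <= t <= T -> `|u t x y| <= 1 - 2 * delta) ->
    proj_estimate L T r u N ->
    proj_quadrature L T u N ->
    exists C h0 : R, 0 < C /\ 0 < h0 /\
      forall (M : nat) (tau : R) (U : nat -> 'M[R]_M),
        let h := L / M%:R in
        (0 < M)%N -> h <= h0 ->
        0 < tau -> tau <= 2^-1 ->
        U 0%N = Ih M h (fourier_proj L (N M) (u 0)) ->
        (forall n : nat, n.+1%:R * tau <= T ->
           PETDRK2_step h eps sigma theta theta_c kappa delta tau
             (U n) (U n.+1)) ->
        forall n : nat, n%:R * tau <= T ->
          norm_h h (U n - Ih M h (u (n%:R * tau)))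
            <= C * (tau ^+ 2 + h ^+ 2).
Proof.
(* Six orders of smoothness, as required by the consistency of the discrete biharmonic operator. *)
exists 6%N => L T eps sigma theta theta_c kappa delta u N L0 T0 eps0 sigma0 theta0 thc kappa0
  delta0 [D [uD Dc Dxy Dt]] uCH usep uN uq.
have thc0 : 0 < theta_c by exact: lt_trans thc.
have r6 : (6 <= 6)%N by [].
have r4 : (4 <= 6)%N by [].
have [Ci Ci0 interp] :=
  solution_interpolation kappa L0 T0 sigma0 delta0 r6 uD Dc Dxy Dt uCH usep.
have [Cr Cr0 resid] :=
  solution_residual kappa L0 T0 sigma0 delta0 r6 uD Dc Dxy Dt uCH usep uN uq.
have [Cd Cd0 drift] := mean_h_drift kappa L0 T0 sigma0 delta0 r6 uD Dc Dxy Dt uCH usep uN uq.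
have [Cp Cp0 proj] := projection_sup_error L0 T0 r4 uD Dc Dxy uN.
pose C := Ci + Cr; have C0 : 0 <= C by exact: addr_ge0.
pose K := step_const eps sigma theta theta_c kappa delta C.
have K0 : 0 <= K by exact: step_const_ge0.
(* Bounds the squared error divided by M^2 q^2: the Gronwall factor at time T, times the initial
   projection error plus the accumulated residuals. *)
pose S := expR ((1 + K) * T) * (Cp ^+ 2 + T * K).
have S0 : 0 <= S.
  by rewrite mulr_ge0 ?expR_ge0 // addr_ge0 ?sqr_ge0 // mulr_ge0 // ltW.
(* The added 1s keep the constant and the denominator positive. Since h^2 <= h for h <= 1, the
   threshold gives (Cd + Cp) h^2 <= delta. *)
exists (L * Num.sqrt S + 1), (Num.min 1 (delta / (Cd + Cp + 1))).
have CdCp : 0 < Cd + Cp + 1 by rewrite ltr_pwDr // addr_ge0.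
split; first by rewrite ltr_pwDr // mulr_ge0 ?sqrtr_ge0 // ltW.
split; first by rewrite lt_min ltr01 divr_gt0.
move=> M tau U h M0 hle tau0 tau1 U0 step.
have MR : 0 < M%:R :> R by rewrite ltr0n.
have h0 : 0 < h by rewrite divr_gt0.
have h2 : 0 <= h ^+ 2 by exact: sqr_ge0.
have [h1 hd] : h <= 1 /\ (Cd + Cp) * h ^+ 2 <= delta.
  move: hle; rewrite le_min => /andP[h1 hd]; split => //.
  move: hd; rewrite ler_pdivlMr // => hd.
  have hh : h ^+ 2 <= h by rewrite expr2 ler_piMl // ltW.
  have c0 : 0 <= Cd + Cp by exact: addr_ge0.
  have := ler_wpM2l c0 hh; lra.
have Cph : Cp * h ^+ 2 <= delta.
  by apply: le_trans hd; rewrite ler_wpM2r // lerDr.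
have [rem remP] := resid M M0.
pose W t := Ih M h (u t).
pose m := mean_h (U 0%N).
have TT0 : 0 <= (0 : R) <= T by rewrite lexx ltW.
have grid (i : 'I_M) : 0 <= i.+1%:R * h <= L.
  by have := grid_coord_le i L0; rewrite ger0_norm ?mulr_ge0 // ltW.
have U0W i j : `|(U 0%N - W 0) i j| <= Cp * h ^+ 2.
  rewrite U0 /W [X in `|X|]mxE [X in _ + X]mxE 2!mxE.
  exact: proj.
have Wsep t i j : 0 <= t <= T -> `|W t i j| <= 1 - 2 * delta.
  by move=> tT; rewrite mxE; exact: usep.
have mW t : 0 <= t <= T -> `|m - mean_h (W t)| <= delta.
  move=> tT; apply: le_trans hd.
  (* The mass defect is that of the initial data, bounded by Cp h^2, and the drift since time 0,
     bounded by Cd h^2. *)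
  have -> : m - mean_h (W t) = mean_h (U 0%N - W 0) - (mean_h (W t) - mean_h (W 0)).
    by rewrite mean_hB /m; ring.
  apply: (le_trans (ler_normB _ _)); rewrite addrC mulrDl lerD //; first exact: drift.
  exact: le_mean_h.
pose q := tau ^+ 2 + h ^+ 2.
have t2 : 0 <= tau ^+ 2 by exact: sqr_ge0.
have q0 : 0 <= q by exact: addr_ge0.
pose b1 := Ci * tau + Cr * h ^+ 2; pose b2 := Ci * tau ^+ 2 + Cr * h ^+ 2.
have b10 : 0 <= b1 by rewrite addr_ge0 // mulr_ge0 // ltW.
have b20 : 0 <= b2 by rewrite addr_ge0 // mulr_ge0.
have b2q : b2 <= C * q.
  have c1 := mulr_ge0 Ci0 h2; have c2 := mulr_ge0 Cr0 t2.
  by rewrite /b2 /C /q mulrDl !mulrDr; lra.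
(* The factor tau lifts the first-order term of the predictor's residual to tau^2. *)
have b1q : tau * b1 <= C * q.
  apply: le_trans b2q; rewrite /b1 /b2 mulrDr; apply: lerD.
    by rewrite mulrCA -expr2.
  by rewrite ler_piMl ?mulr_ge0 //; lra.
have one n : n.+1%:R * tau <= T -> mean_h (U n) = m -> (forall i j, `|U n i j| <= 1 - delta) ->
  [/\ mean_h (U n.+1) = m, (forall i j, `|U n.+1 i j| <= 1 - delta) &
  dot (U n.+1 - W (n.+1%:R * tau)) (U n.+1 - W (n.+1%:R * tau)) <= expR ((1 + K) * tau) *
    (dot (U n - W (n%:R * tau)) (U n - W (n%:R * tau)) + tau * (K * (M%:R ^+ 2 * q ^+ 2)))].
  move=> nT Um Ud; set t := n%:R * tau.
  have t0 : 0 <= t by rewrite mulr_ge0 // ltW.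
  have nt : n.+1%:R * tau = t + tau by rewrite -natr1 mulrDl mul1r.
  have tT : t + tau <= T by rewrite -nt.
  have tin : 0 <= t <= T by apply/andP; split; lra.
  have ttin : 0 <= t + tau <= T by apply/andP; split; lra.
  have sin s : 0 < s < tau -> 0 < t + s < T by move=> ?; lra.
  have := @PETDRK2_step_error R M h eps sigma theta theta_c kappa delta tau C q m b1 b2
    M0 h0 eps0 sigma0 theta0 thc0 kappa0 delta0 tau0 tau1 q0 b10 b20 b1q b2q (U n) (U n.+1)
    (fun s => W (t + s)) (fun s => rem (t + s)) (step n nT) Ud Um.
  rewrite /= addr0 nt; apply.
  - by move=> i j; exact: Wsep.
  - by move=> i j; exact: Wsep.
  - exact: mW.
  - move=> i j; apply: (@within_continuous_shift _ (fun s => W s i j) T) => //.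
    exact: (solution_continuous T0 uD Dc Dxy Dt).
  - move=> s i j st; have [_ d] := remP (t + s) i j (sin s st).
    exact: (is_derive_translate (f := fun s => W s i j) d).
  - move=> s i j st; have [_ e2] := interp M t s tau i j M0 t0 st tT.
    have [e3 _] := remP (t + s) i j (sin s st).
    rewrite opprD addrA mxE [X in _ + X]mxE; apply: (le_trans (ler_normB _ _)).
    exact: lerD.
  - move=> s i j st; have [e2 _] := interp M t s tau i j M0 t0 st tT.
    have [e3 _] := remP (t + s) i j (sin s st).
    rewrite opprD addrA mxE [X in _ + X]mxE; apply: (le_trans (ler_normB _ _)).
    exact: lerD.
(* The initial value is not the result of a projection; its bound comes from the separation property
   and Cp h^2 <= delta. *)
have inv n : n%:R * tau <= T -> mean_h (U n) = m /\ forall i j, `|U n i j| <= 1 - delta.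
  elim: n => [_|n IH nT].
    split=> // i j; have := U0W i j; rewrite mxE [X in _ + X]mxE => U0ij.
    rewrite -(subrK (W 0 i j) (U 0%N i j)); apply: (le_trans (ler_normD _ _)).
    by apply: (le_trans (lerD U0ij (Wsep 0 i j TT0))); lra.
  have nT' : n%:R * tau <= T by apply: le_trans nT; rewrite ler_pM2r // ler_nat.
  have [Um Ud] := IH nT'.
  by have [] := one n nT Um Ud.
move=> n nT; have Q0 : 0 <= K * (M%:R ^+ 2 * q ^+ 2) by rewrite !mulr_ge0 // sqr_ge0.
have K1 : 0 <= 1 + K by rewrite addr_ge0.
have leT k : (k <= n)%N -> k%:R * tau <= T.
  by move=> kn; apply: le_trans nT; rewrite ler_pM2r // ler_nat.
have := gronwall_discrete (a := fun k => dot (U k - W (k%:R * tau)) (U k - W (k%:R * tau)))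
  K1 (ltW tau0) Q0 (m := n) _ (leqnn n).
rewrite mul0r => /(_ _) gr.
have {}gr : dot (U n - W (n%:R * tau)) (U n - W (n%:R * tau)) <=
    expR ((1 + K) * (n%:R * tau)) * (dot (U 0%N - W 0) (U 0%N - W 0)
      + n%:R * tau * (K * (M%:R ^+ 2 * q ^+ 2))).
  apply: gr => k kn; have [Um Ud] := inv k (leT _ (ltnW kn)).
  by have [] := one k (leT _ kn) Um Ud.
have nt0 : 0 <= n%:R * tau by rewrite mulr_ge0 // ltW.
have e0q : dot (U 0%N - W 0) (U 0%N - W 0) <= Cp ^+ 2 * (M%:R ^+ 2 * q ^+ 2).
  apply: (le_trans (dot_le_const U0W)).
  have -> : Cp ^+ 2 * (M%:R ^+ 2 * q ^+ 2) = M%:R ^+ 2 * (Cp * q) ^+ 2 by ring.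
  have hq : Cp * h ^+ 2 <= Cp * q by rewrite ler_wpM2l // lerDr.
  have M2 : 0 <= M%:R ^+ 2 :> R by exact: sqr_ge0.
  by rewrite ler_wpM2l // lerXn2r // nnegrE mulr_ge0.
have {}gr : dot (U n - W (n%:R * tau)) (U n - W (n%:R * tau)) <= S * (M%:R ^+ 2 * q ^+ 2).
  apply: (le_trans gr); rewrite /S -(mulrA (expR _)).
  apply: ler_pM; rewrite ?expR_ge0 //.
  - by rewrite addr_ge0 ?dot_ge0 // mulr_ge0.
  - by rewrite ler_expR ler_wpM2l.
  - rewrite (mulrDl (Cp ^+ 2)) lerD // -(mulrA T) ler_wpM2r //.
rewrite /norm_h inner_hE -/(W _).
have Lq : 0 <= L * q by rewrite mulr_ge0 // ltW.
apply: (@le_trans _ _ (Num.sqrt (S * (L * q) ^+ 2))).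
  rewrite ler_wsqrtr //; apply: (le_trans (ler_wpM2l h2 gr)).
  (* Restoring the weight h^2 turns M^2 into L^2. *)
  have -> : h ^+ 2 * (S * (M%:R ^+ 2 * q ^+ 2)) = S * ((M%:R * h) * q) ^+ 2 by ring.
  by rewrite /h [M%:R * _]mulrC divfK // gt_eqF.
rewrite sqrtrM // sqrtr_sqr ger0_norm // -/q.
have -> : (L * Num.sqrt S + 1) * q = Num.sqrt S * (L * q) + q by ring.
by rewrite lerDl.
Qed.
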